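(* Let $\varphi:\mathbb{P}^N\dashrightarrow\mathbb{P}^N$ be (the extension to $\mathbb{P}^N$ of) a regular affine automorphism defined over $\overline{\mathbb{Q}}$, and let $P\in\mathbb{A}^N(\overline{\mathbb{Q}})$. Then $$\alpha_\varphi(P)=\begin{cases}\delta_\varphi&\text{if }P\notin\mathrm{Per}(\varphi),\\ 1&\text{if }P\in\mathrm{Per}(\varphi).\end{cases}$$
   Context: A regular affine automorphism is an automorphism $\varphi:\mathbb{A}^N\to\mathbb{A}^N$ such that the extensions of $\varphi$ and $\varphi^{-1}$ to rational maps $\mathbb{P}^N\dashrightarrow\mathbb{P}^N$ are not morphisms but satisfy $Z(\varphi)\cap Z(\varphi^{-1})=\emptyset$, where $Z(\cdot)$ denotes the indeterminacy locus in $\mathbb{P}^N$. The dynamical degree is $\delta_\varphi=\lim_{n\to\infty}(\deg\varphi^n)^{1/n}$, where the degree of a rational map of $\mathbb{P}^N$ is the common degree of homogeneous coordinate polynomials without common factor. $\mathrm{Per}(\varphi)$ is the set of periodic points of $\varphi$. With $h$ the absolute logarithmic Weil height on $\mathbb{P}^N(\overline{\mathbb{Q}})$, the arithmetic degree is $\alpha_\varphi(P)=\limsup_{n\to\infty}h(\varphi^n(P))^{1/n}$, with the convention $\alpha_\varphi(P)=1$ if $h(\varphi^n(P))=0$ for all sufficiently large $n$. *)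

(* Defs.v *)
From HB Require Import structures.
From mathcomp Require Import all_boot all_order all_algebra.
From mathcomp Require Import finmap.
From mathcomp Require Import algC algnum fieldext.
From mathcomp Require Import complex.
From mathcomp Require Import boolp classical_sets functions cardinality fsbigop.
From mathcomp Require Import reals ereal topology normedtype sequences exp.
From mathcomp Require mpoly.
(* The notations of mpoly clash with those of MathComp-Analysis. *)
Import -(notations) mpoly.

Set Implicit Arguments.
Unset Strict Implicit.
Unset Printing Implicit Defensive.

Import Order.TTheory GRing.Theory Num.Theory.
Import numFieldNormedType.Exports.

Local Open Scope classical_set_scope.
Local Open Scope ring_scope.

(* Throughout, the field of algebraic numbers is algC; R is the field of real
   numbers and R[i] the field of complex numbers.  Points of P^N are given by
   nonzero vectors (x_0, ..., x_N), and A^N is embedded as x_0 <> 0. *)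

Notation polyvar i := (mpolyX algC (mnm1 i)).

Definition mhomogenize N (d : nat) (m : multinom N) : multinom N.+1 :=
  Multinom [tuple (if unlift ord0 j is Some i then m i else (d - mdeg m)%N)
            | j < N.+1].

(* X_0^d p(X_1/X_0, ..., X_N/X_0), for d at least the degree of p *)
Definition homogenize N (d : nat) (p : mpoly N algC) : mpoly N.+1 algC :=
  \sum_(m <- msupp p) mcoeff m p *: mpolyX algC (mhomogenize d m).

Definition no_common_factor n (I : Type) (f : I -> mpoly n algC) : Prop :=
  forall p, (forall i, exists q, f i = p * q) -> exists c, p = mpolyC n c.

(* Rational maps from P^N to itself: the coordinates are unique up to a common
   nonzero scalar, so that the degree and the indeterminacy locus below only
   depend on the map. *)
Record ratmap N := RatMap {
  ratdeg : nat;
  ratcoord : 'I_N.+1 -> mpoly N.+1 algC;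
  ratcoord_homog : forall i, ratcoord i \is ishomog1 ratdeg mdeg;
  ratcoord_coprime : no_common_factor ratcoord }.

Definition indeterminacy N (f : ratmap N) : set 'rV[algC]_N.+1 :=
  [set x : 'rV_N.+1 | x != 0 /\ forall i, meval (x 0) (ratcoord f i) = 0].

Definition is_morphism N (f : ratmap N) : Prop := indeterminacy f = set0.

Definition affmap N := N.-tuple (mpoly N algC).

Definition aff_id N : affmap N := [tuple polyvar i | i < N].

Definition aff_comp N (f g : affmap N) : affmap N :=
  [tuple comp_mpoly g (tnth f i) | i < N].

Definition aff_iter N (f : affmap N) (n : nat) : affmap N :=
  iter n (aff_comp f) (aff_id N).

Definition aff_eval N (f : affmap N) (P : 'rV[algC]_N) : 'rV[algC]_N :=
  \row_i meval (P 0) (tnth f i).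

Definition aff_maxdeg N (f : affmap N) : nat :=
  \max_(i < N) (msize (tnth f i)).-1.

(* [X_0^d : X_0^d f_1(X/X_0) : ... : X_0^d f_N(X/X_0)] *)
Definition ext_coord N (f : affmap N) (j : 'I_N.+1) : mpoly N.+1 algC :=
  homogenize (aff_maxdeg f) (if unlift ord0 j is Some i then tnth f i else 1).

Section Extension.
Variable N : nat.
Implicit Types (p q : mpoly N algC) (P Q : mpoly N.+1 algC) (f : affmap N).

Let mhomogenizeS d (m : multinom N) i : mhomogenize d m (lift ord0 i) = m i.
Proof. by rewrite multinomE tnth_mktuple liftK. Qed.

Let mhomogenize0 d (m : multinom N) : mhomogenize d m ord0 = (d - mdeg m)%N.
Proof. by rewrite multinomE tnth_mktuple unlift_none. Qed.

Let mhomogenize_inj d : injective (@mhomogenize N d).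
Proof.
by move=> m m' e; apply/mnmP => i; rewrite -(mhomogenizeS d) e mhomogenizeS.
Qed.

Let mdeg_mhomogenize d (m : multinom N) :
  (mdeg m <= d)%N -> mdeg (mhomogenize d m) = d.
Proof.
move=> le_md; rewrite mdegE big_ord_recl mhomogenize0.
under eq_bigr do rewrite mhomogenizeS.
by rewrite -mdegE subnK.
Qed.

Lemma homogenize_homog d p :
  ((msize p).-1 <= d)%N -> homogenize d p \is ishomog1 d mdeg.
Proof.
move=> le_pd; rewrite /homogenize big_seq; apply: rpred_sum => m m_p.
apply: rpredZ; rewrite dhomogX; apply/eqP/mdeg_mhomogenize.
by apply: leq_trans le_pd; have := msize_mdeg_lt m_p; case: (msize p).
Qed.

Let ext_coord_homog f i : ext_coord f i \is ishomog1 (aff_maxdeg f) mdeg.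
Proof.
apply: homogenize_homog; case: (unlift _ _) => [j|]; last by rewrite msize1.
exact: (leq_bigmax (F := fun i => (msize (tnth f i)).-1)).
Qed.

Lemma mcoeff_homogenize d p m :
  mcoeff (mhomogenize d m) (homogenize d p) = mcoeff m p.
Proof.
rewrite /homogenize raddf_sum /= (eq_bigr (fun m' =>
  if m' == m then mcoeff m p else 0)).
  rewrite -big_mkcond /=; case: (boolP (m \in msupp p)) => m_p.
    by rewrite -big_filter filter_pred1_uniq ?msupp_uniq // big_seq1.
  rewrite big_seq_cond big1 ?(memN_msupp_eq0 m_p) //.
by move=> m' _; rewrite mcoeffZ mcoeffX (inj_eq (@mhomogenize_inj d));
  case: eqP => [->|]; rewrite ?mulr1 ?mulr0.
Qed.

Let X0 : mpoly N.+1 algC := polyvar ord0.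

Let subst0 P := comp_mpoly
  [tuple (if j == ord0 then 0 else polyvar j) | j < N.+1] P.

Let subst0M P Q : subst0 (P * Q) = subst0 P * subst0 Q.
Proof. exact: rmorphM. Qed.

Let subst0X m : subst0 (mpolyX algC m) = if m ord0 == 0%N then mpolyX algC m else 0.
Proof.
rewrite /subst0 comp_mpolyX big_ord_recl tnth_mktuple eqxx expr0n.
case: eqP => [m0|_]; last by rewrite mul0r.
rewrite mul1r [RHS]mpolyXE_id big_ord_recl m0 expr0 mul1r.
by apply: eq_bigr => i _; rewrite tnth_mktuple.
Qed.

Let mcoeff_subst0 P (m : multinom N.+1) :
  m ord0 = 0%N -> mcoeff m (subst0 P) = mcoeff m P.
Proof.
move=> m0; rewrite [in LHS](mpolyE P) [in RHS](mpolyE P) /subst0.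
rewrite (linear_sum (comp_mpoly _)) !raddf_sum /=.
apply: eq_bigr => m' _; rewrite comp_mpolyZ -/(subst0 _) subst0X !mcoeffZ.
case: ifP => // m'0; rewrite mcoeff0 mcoeffX.
by case: eqP => // e; rewrite e m0 eqxx in m'0.
Qed.

Let subst0_dvd P : subst0 P = 0 -> exists Q, P = X0 * Q.
Proof.
move=> P0.
exists (\sum_(m <- msupp P) mcoeff m P *: mpolyX algC (mnm_sub m (mnm1 ord0))).
rewrite {1}(mpolyE P) mulr_sumr big_seq [RHS]big_seq; apply: eq_bigr => m m_P.
rewrite -scalerAr -mpolyXD addmC submK //; apply/mnm_lepP => i.
rewrite mnm1E; case: eqP => // <-; rewrite lt0n; apply/eqP => m0.
move: m_P; rewrite mcoeff_msupp -(mcoeff_subst0 _ m0) P0 mcoeff0.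
by rewrite eqxx.
Qed.

Let dvd_X0 d P Q :
  subst0 P != 0 -> X0 ^+ d = P * Q -> exists c, P = mpolyC N.+1 c.
Proof.
move=> P0; elim: d Q => [|d IH] Q.
  rewrite expr0 => PQ; have : P \in @mpoly_unit _ _.
    by apply: (@mpoly_intro_unit _ _ P Q); rewrite mulrC -PQ.
  by case/andP => /eqP -> _; eexists.
move=> PQ; have /eqP : subst0 P * subst0 Q = 0.
  by rewrite -subst0M -PQ exprS subst0M /X0 subst0X mnm1E eqxx mul0r.
rewrite mulf_eq0 (negPf P0) /= => /eqP /subst0_dvd[Q' Q'E].
apply: (IH Q'); apply: (mulfI (x := X0)).
  by rewrite -msupp_eq0 msuppX.
by rewrite -exprS PQ Q'E mulrCA.
Qed.

Let ext_coord_coprime f : no_common_factor (ext_coord f).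
Proof.
move=> P Pf; set d := aff_maxdeg f.
have f0 : ext_coord f ord0 = X0 ^+ d.
  rewrite /ext_coord unlift_none /homogenize msupp1 big_seq1 mcoeff1 eqxx.
  rewrite scale1r /X0 mpolyXn; congr (mpolyX _ _); apply/mnmP => i.
  rewrite mulmnE mnm1E; case: (unliftP ord0 i) => [j ->|->].
    by rewrite mhomogenizeS mnm0E mul0n.
  by rewrite mhomogenize0 mdeg0 subn0 eqxx mul1n.
have [j fj] : exists j, subst0 (ext_coord f j) != 0.
  have [d0|d_gt0] := posnP d.
    exists ord0; rewrite f0 d0 expr0 /subst0 comp_mpoly1; exact: oner_neq0.
  have N_gt0 : (0 < #|'I_N|)%N.
    rewrite lt0n; apply: contraTN d_gt0 => /eqP N0; rewrite -eqn0Ngt /d.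
    by rewrite /aff_maxdeg big_pred0 // => i; have := fintype0 i N0.
  have [i di] := bigop.eq_bigmax (fun i => (msize (tnth f i)).-1) N_gt0.
  have {}di : (msize (tnth f i)).-1 = d by rewrite -di.
  have fi0 : tnth f i != 0.
    by apply/eqP => fi0; rewrite -di fi0 msize0 in d_gt0.
  exists (lift ord0 i); pose m := mhomogenize d (mlead (tnth f i)).
  apply/eqP => /(congr1 (mcoeff m)); rewrite mcoeff_subst0; last first.
    by rewrite mhomogenize0 -di -mlead_deg // subnn.
  rewrite /ext_coord liftK mcoeff_homogenize mcoeff0 => /eqP.
  by rewrite mleadc_eq0 (negPf fi0).
have [Q0 e0] := Pf ord0; have [Qj ej] := Pf j.
apply: (dvd_X0 (d := d) (Q := Q0)); last by rewrite -f0.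
by apply: contraNneq fj => P0; rewrite ej subst0M P0 mul0r.
Qed.

Definition extension f : ratmap N :=
  RatMap (@ext_coord_homog f) (@ext_coord_coprime f).

End Extension.

Definition are_inverse N (f g : affmap N) : Prop :=
  aff_comp f g = aff_id N /\ aff_comp g f = aff_id N.

Definition regular_affine_automorphism N (f : affmap N) : Prop :=
  exists g : affmap N,
    [/\ are_inverse f g,
        ~ is_morphism (extension f),
        ~ is_morphism (extension g) &
        indeterminacy (extension f) `&` indeterminacy (extension g) = set0].

Definition degree N (f : affmap N) : nat := ratdeg (extension f).

Definition dynamical_degree (R : realType) N (f : affmap N) : R :=
  limn (fun n => (degree (aff_iter f n))%:R `^ n%:R^-1).

Definition periodic N (f : affmap N) (P : 'rV[algC]_N) : Prop :=
  exists2 n : nat, (0 < n)%N & iter n (aff_eval f) P = P.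

(* The finite places of a number field, represented by their normalized
   discrete valuations; the value at 0 is a junk value. *)
Definition finite_place (K : fieldExtType rat) (v : K -> int) : Prop :=
  [/\ v 0 = 0,
      forall x y : K, x != 0 -> y != 0 -> v (x * y) = v x + v y,
      forall x y : K, x != 0 -> y != 0 -> x + y != 0 ->
        Num.min (v x) (v y) <= v (x + y) &
      exists2 x : K, x != 0 & v x = 1].

Section WeilHeight.
Variables (R : realType) (K : fieldExtType rat).

Definition valuation_ring (v : K -> int) : set K := [set x : K | x = 0 \/ 0 <= v x].

Definition maximal_ideal (v : K -> int) : set K := [set x : K | x = 0 \/ 0 < v x].

(* The number of elements of the residue field, which is finite. *)
Definition residue_card (v : K -> int) : nat :=
  #|` fset_set [set C : set K | exists2 x, valuation_ring v x &
                                C = [set y : K | maximal_ideal v (y - x)]]|.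

(* This is |x|_v ^ [K_v : Q_v] for the absolute value |.|_v which extends the
   standard p-adic one. *)
Definition finite_abs (v : K -> int) (x : K) : R :=
  if x == 0 then 0 else (residue_card v)%:R ^ (- v x).

Definition max_abs n (abs : K -> R) (x : 'I_n -> K) : R :=
  \big[Num.max/0]_(i < n) abs (x i).

Definition complex_embeddings : set (K -> R[i]) :=
  range (fun s : {rmorphism K -> R[i]} => s : K -> R[i]).

(* Summing over embeddings counts each complex place with multiplicity 2.  The
   sum over finite places has finitely many nonzero terms if x is nonzero. *)
Definition relative_height n (x : 'I_n -> K) : R :=
  \sum_(v \in finite_place (K := K)) ln (max_abs (finite_abs v) x) +
  \sum_(s \in complex_embeddings) ln (max_abs (fun y => Normc.normc (s y)) x).

End WeilHeight.

(* The absolute height, computed in the number field generated over Q by the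
   given coordinates. *)
Definition height (R : realType) n (x : 'rV[algC]_n) : R :=
  let: existT K (existT _ (exist2 s _ _)) :=
    num_field_exists [seq x 0 i | i : 'I_n] in
  relative_height R (fun i : 'I_n => s`_i) / (\dim {: K})%:R.

Definition aff_height (R : realType) N (P : 'rV[algC]_N) : R :=
  height R (row_mx (const_mx 1 : 'rV_1) P).

Definition arithmetic_degree (R : realType) N (f : affmap N)
    (P : 'rV[algC]_N) : \bar R :=
  let h n := aff_height R (iter n (aff_eval f) P) in
  if `[< \forall n \near \oo, h n = 0 >] then 1%E
  else limn_esup (fun n => (h n `^ n%:R^-1)%:E).

(* Main.v *)
Require Import Defs.
From HB Require Import structures.
From mathcomp Require Import all_boot all_order all_algebra.
From mathcomp Require Import finmap.
From mathcomp Require Import algC algnum fieldext falgebra separable.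
From mathcomp Require Import complex.
From mathcomp Require Import boolp classical_sets cardinality fsbigop.
From mathcomp Require Import reals ereal topology normedtype sequences exp.
From mathcomp Require mpoly.
Import -(notations) mpoly.
From mathcomp Require Import zify ring lra.

Set Implicit Arguments.
Unset Strict Implicit.
Unset Printing Implicit Defensive.

Import Order.TTheory GRing.Theory Num.Theory.
Import numFieldNormedType.Exports.

Local Open Scope classical_set_scope.
Local Open Scope card_scope.
Local Open Scope ring_scope.

(* Write d and d' for the degrees of f and of its inverse g, and F = f^n, G = g^m with
   d^n <= d'^m.  The indeterminacy loci of F and G are disjoint, so by the
   Nullstellensatz some power of each coordinate is a combination of the homogeneous
   coordinates of F and G.  At every place this bounds |P|^(d^n) by the sizes of F(P)
   and G(P), whence
     h(P) <= (B / d^n) (h(F(P)) + h(G(P))) + C_n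
   with B independent of n.  Along the orbit of P, a record height therefore grows by
   a factor of about d^n / B within n steps.  By Northcott the heights on the orbit of
   a non-periodic point are unbounded, so the growth rate is at least
   (d^n / B - 2)^(1/n), which tends to d; it is at most d as f has degree d, and
   deg f^n = d^n.
   As a constant factor B is harmless, heights are only compared up to a factor
   depending on the degree of the number field: the size of a point is measured by a
   common denominator q of its coordinates and a bound M for all their conjugates. *)

(** * The Nullstellensatz *)

(** The inverse is indispensable: where the homogeneous coordinates of F are all small, F alone
    gives no lower bound, and disjointness says that G is then large. The Nullstellensatz is applied
    on the charts x_k = 1, and at each place the chart of a largest coordinate of P is used. As x_0
    = 1, that coordinate has absolute value at least 1; by d^n <= d'^m its surplus power in the
    terms of G carries a nonpositive exponent and is harmless. The coefficients of these relations
    depend on n, but act as constant factors at each place and so enter only C_n. B comes from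
    comparing sizes with heights over one number field that contains the coefficients of f and the
    coordinates of P, hence the whole orbit. Exact local degrees are replaced by crude facts:
    ramification indices, residue degrees and numbers of places above a prime are at most the degree
    of the field. Passing from heights back to denominators needs enough places: every non-integral
    element must have a pole at some discrete valuation, which has to be constructed. *)

Section PrimeIdeals.
Variable T : comNzRingType.

Definition ideal (J : set T) : Prop :=
  [/\ J 0, forall x y, J x -> J y -> J (x + y) & forall a x, J x -> J (a * x)].

Definition prime_ideal (J : set T) : Prop :=
  [/\ ideal J, ~ J 1 & forall x y, J (x * y) -> J x \/ J y].

Lemma idealB (J : set T) x y : ideal J -> J x -> J y -> J (x - y).
Proof.
by move=> [_ JD JM] Jx Jy; apply: JD => //; rewrite -mulN1r; apply: JM.
Qed.

Lemma ideal_sum (J : set T) (I : Type) (r : seq I) (F : I -> T) :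
  ideal J -> (forall i, J (F i)) -> J (\sum_(i <- r) F i).
Proof. by move=> [J0 JD _] JF; apply: big_ind. Qed.

Lemma prime_idealX (J : set T) x n : prime_ideal J -> J (x ^+ n) -> J x.
Proof.
move=> [_ J1 JM]; elim: n => [|n IH]; first by rewrite expr0.
by rewrite exprS => /JM[].
Qed.

(** A maximal ideal above J is prime: if x and y lie outside it, then 1 = a x + q and 1 = b y + r
    with q, r inside, and in the product of the two every term but (a b)(x y) lies in the ideal, so
    x y does not. *)
Lemma exists_prime_ideal (J : set T) :
  ideal J -> ~ J 1 -> exists2 Q, prime_ideal Q & J `<=` Q.
Proof.
move=> idJ J1.
pose P (A : set T) := A = set0 \/ [/\ ideal A, ~ A 1 & J `<=` A].
have [F FP Ftot|Q [PQ maxQ]] := @Zorn_bigcup _ P.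
  have [F0|/existsNP[A0 /not_implyP[FA0 A0n]]] := pselect (forall A, F A -> A = set0).
    by left; rewrite -subset0 => x [A FA Ax]; rewrite -(F0 _ FA).
  have good A : F A -> A !=set0 -> [/\ ideal A, ~ A 1 & J `<=` A].
    by move=> FA [x Ax]; case: (FP _ FA) => // A_0; rewrite A_0 in Ax.
  have A0P : A0 !=set0 by apply/set0P/eqP.
  have [[A00 _ _] _ JA0] := good _ FA0 A0P.
  right; split; last by move=> x Jx; exists A0 => //; apply: JA0.
    split; first by exists A0.
      move=> x y [A FA Ax] [B FB By].
      have [[_ AD _] _ _] := good _ FA (ex_intro _ _ Ax).
      have [[_ BD _] _ _] := good _ FB (ex_intro _ _ By).
      case: (Ftot _ _ FA FB) => AB.
        by exists B => //; apply: BD => //; apply: AB.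
      by exists A => //; apply: AD => //; apply: AB.
    move=> a x [A FA Ax]; exists A => //.
    by have [[_ _ AM] _ _] := good _ FA (ex_intro _ _ Ax); apply: AM.
  by move=> [A FA A1]; have [_ ] := good _ FA (ex_intro _ _ A1).
have {PQ} [idQ Q1 JQ] : [/\ ideal Q, ~ Q 1 & J `<=` Q].
  case: PQ => // Q0; exfalso; apply: (maxQ J); last by right; split.
  rewrite Q0; rewrite properEneq; split; last exact: sub0set.
  by apply/eqP => /esym J0; have [] := idJ; rewrite J0.
exists Q => //; split=> // x y Qxy; apply: contrapT => /not_orP[].
have [Q0 QD QM] := idQ.
have key z : ~ Q z -> exists a q, Q q /\ 1 = a * z + q.
  move=> Qz; apply: contrapT => nz.
  apply: (maxQ [set w | exists a q, Q q /\ w = a * z + q]).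
    rewrite properEneq; split; last first.
      by move=> w Qw; exists 0, w; rewrite mul0r add0r.
    apply/eqP => E; apply: Qz; rewrite E; exists 1, 0.
    by rewrite mul1r addr0.
  right; split; [split| |].
  - by exists 0, 0; rewrite mul0r addr0.
  - move=> _ _ [a [q [Qq ->]]] [b [r [Qr ->]]]; exists (a + b), (q + r).
    by split; [apply: QD|ring].
  - move=> b _ [a [q [Qq ->]]]; exists (b * a), (b * q).
    by split; [apply: QM|ring].
  - by move=> [a [q H]]; apply: nz; exists a, q.
  - by move=> w Jw; exists 0, w; rewrite mul0r add0r; split=> //; apply: JQ.
move=> /key [a [q [Qq e1]]] /key [b [r [Qr e2]]]; apply: Q1.
rewrite -(mulr1 1) {1}e1 e2.
have -> : (a * x + q) * (b * y + r) =
  (a * b) * (x * y) + ((a * x + q) * r + (b * y) * q) by ring.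
by apply: (QD); [apply: QM|apply: QD; apply: QM].
Qed.

End PrimeIdeals.

Section IteratedPolynomials.
Variable k : closedFieldType.

(** The ring k[X_0][X_1]...[X_(n-1)]. The induction behind the Nullstellensatz views an element as a
    univariate polynomial in the last variable and divides with remainder, which the nested form
    gives directly. *)
Fixpoint itpoly n : idomainType :=
  if n is m.+1 then ({poly itpoly m} : idomainType) else k.

(** The assignment a is defined on all of [nat], so that one point can be used for fewer variables
    or changed at the last one. *)
Fixpoint iteval (T : comNzRingType) (c : {rmorphism k -> T}) (a : nat -> T) n :
    {rmorphism itpoly n -> T} :=
  match n return {rmorphism itpoly n -> T} with
  | 0 => c
  | m.+1 => horner_morph (fun x => mulrC (a m) (iteval c a m x))
  end.

Lemma itevalS (T : comNzRingType) (c : {rmorphism k -> T}) a n (p : itpoly n.+1) :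
  iteval c a n.+1 p = (map_poly (iteval c a n) (p : {poly itpoly n})).[a n].
Proof. by []. Qed.

Lemma eq_iteval (T : comNzRingType) (c : {rmorphism k -> T}) a b n :
  (forall i, (i < n)%N -> a i = b i) -> iteval c a n =1 iteval c b n.
Proof.
elim: n => // n IH ab p; rewrite !itevalS ab //; congr (_.[_]).
by apply: eq_map_poly => x; apply: IH => i /ltnW/ab.
Qed.

Fixpoint itvar n (i : nat) : itpoly n :=
  match n return itpoly n with
  | 0 => 0
  | m.+1 => if i == m then ('X : {poly itpoly m}) else ((itvar m i)%:P : {poly itpoly m})
  end.

Lemma iteval_var (T : comNzRingType) (c : {rmorphism k -> T}) a n i :
  (i < n)%N -> iteval c a n (itvar n i) = a i.
Proof.
elim: n => // n IH; rewrite ltnS leq_eqVlt itevalS /=.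
case: eqP => [-> _|_ /= /IH <-]; first by rewrite map_polyX hornerX.
by rewrite map_polyC hornerC.
Qed.

Fixpoint itconst n : {rmorphism k -> itpoly n} :=
  match n return {rmorphism k -> itpoly n} with
  | 0 => idfun
  | m.+1 => (polyC : itpoly m -> {poly itpoly m}) \o itconst m
  end.

Lemma iteval_const (T : comNzRingType) (c : {rmorphism k -> T}) a n x :
  iteval c a n (itconst n x) = c x.
Proof.
elim: n => // n IH; rewrite itevalS /= map_polyC hornerC; exact: IH.
Qed.

End IteratedPolynomials.

(** p splits into linear factors, each of which divides q; the exponent [size p] is one more than
    their number. *)
Lemma dvdp_exp_roots (k : closedFieldType) (p q : {poly k}) :
  p != 0 -> (forall x, root p x -> root q x) -> p %| q ^+ (size p).
Proof.
move=> p0 pq; have [rs pE] := closed_field_poly_normal p.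
have lp0 : lead_coef p != 0 by rewrite lead_coef_eq0.
have -> : size p = (size rs).+1 by rewrite {1}pE size_scale // size_prod_XsubC.
have : forall x, x \in rs -> root q x.
  by move=> x xr; apply: pq; rewrite pE rootZ // root_prod_XsubC.
rewrite {1}pE dvdpZl // => {pE}; elim: rs => [|x rs IH] H.
  by rewrite big_nil dvd1p.
rewrite big_cons /= exprS dvdp_mul //.
  by rewrite dvdp_XsubCl H // mem_head.
by apply: IH => y yr; apply: H; rewrite in_cons yr orbT.
Qed.

Section PrimeZero.
Variable k : closedFieldType.
Local Notation itpoly := (itpoly k).
Local Notation ev a n := (iteval (idfun : {rmorphism k -> k}) a n).

(** The leading coefficient lies in J as a constant, so removing the leading term of g leaves a
    smaller element of J; induction on the size reaches all coefficients. *)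
Lemma ideal_coef_lead (A : idomainType) (J : set {poly A}) m :
  ideal J -> (forall g, J g -> (size g <= m)%N -> J (lead_coef g)%:P) ->
  forall g, J g -> (size g <= m)%N -> forall i, J (g`_i)%:P.
Proof.
move=> idJ H g; have [J0 JD JM] := idJ.
move: {2}(size g) (leqnn (size g)) => s; elim: s g => [|s IH] g sg Jg gm i.
  by move: sg; rewrite leqn0 size_poly_eq0 => /eqP ->; rewrite coef0.
have Jl := H _ Jg gm.
have [->|g0] := eqVneq g 0; first by rewrite coef0.
pose h := g - lead_coef g *: 'X^((size g).-1).
have Jh : J h.
  by apply: idealB => //; rewrite -mul_polyC mulrC; apply: JM.
have sh : (size h < size g)%N.
  rewrite (polySpred g0) ltnS; apply/leq_sizeP => j.
  rewrite leq_eqVlt coefB coefZ coefXn => /predU1P[<-|lt_j].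
    by rewrite eqxx mulr1 subrr.
  rewrite gtn_eqF // mulr0 subr0 nth_default //.
  by rewrite (polySpred g0).
have hs : (size h <= s)%N by rewrite -ltnS (leq_trans sh).
have hm : (size h <= m)%N by rewrite (leq_trans (ltnW sh)).
have := IH h hs Jh hm i; rewrite coefB coefZ coefXn.
case: eqP => [-> _|_]; last by rewrite mulr0 subr0.
exact: Jl.
Qed.

Lemma ideal_coefs (A : idomainType) (J : set {poly A}) (g : {poly A}) :
  ideal J -> (forall i, J (g`_i)%:P) -> J g.
Proof.
move=> idJ H; rewrite -[g]coefK poly_def; apply: ideal_sum => // i.
by have [_ _ JM] := idJ; rewrite -mul_polyC mulrC; apply: JM.
Qed.

Lemma prime_contract (A : idomainType) (J : set {poly A}) :
  prime_ideal J -> prime_ideal [set c : A | J c%:P].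
Proof.
move=> [[J0 JD JM] J1 JP]; split; [split| |] => //=.
- by move=> x y Jx Jy; rewrite polyCD; apply: JD.
- by move=> a x Jx; rewrite polyCM; apply: JM.
- by move=> x y; rewrite polyCM => /JP.
Qed.

(* With l the leading coefficient of an element g of J of least degree among
   those with l not in J, any f in J satisfies l^e f = h g modulo coefficients in J;
   so only a root of g(a, X) outside s(a, X) has to be found. *)
Lemma prime_zero n (J : set (itpoly n)) (s : itpoly n) :
  prime_ideal J -> ~ J s ->
  exists a, (forall f, J f -> ev a n f = 0) /\ ev a n s <> 0.
Proof.
elim: n J s => [|n IH] J s prJ Js.
  have [[J0 _ JM] J1 _] := prJ.
  exists (fun _ => 0); split; last by move=> s0; apply: Js; rewrite -[s]/(ev (fun=> 0) 0 s) s0.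
  move=> f Jf; apply/eqP/negP => /negP f0; apply: J1.
  by rewrite -(mulVf (x := f : k)) //; apply: JM.
pose A := itpoly n.
have J'prime : prime_ideal [set c : A | (J : set {poly A}) c%:P].
  exact: prime_contract.
have [idJ J1 JP] := prJ; have [J0 JD JM] := idJ.
have polyX a x (p : {poly A}) :
    ev (fun i => if i == n then x else a i) n.+1 p = (map_poly (ev a n) p).[x].
  rewrite itevalS eqxx; congr (_.[_]); apply: eq_map_poly => c.
  by apply: eq_iteval => i /ltn_eqF ->.
pose good m := `[< exists g : {poly A}, [/\ J g, size g = m & ~ J (lead_coef g)%:P] >].
(* If there is no such g, all coefficients of members of J lie in J. Over a zero a of the
   contraction all of J then vanishes whatever the last coordinate is, and this coordinate only has
   to avoid the roots of s(a, X). *)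
have [[m0 good_m0]|] := pselect (exists m, good m); last first.
  move=> ngood.
  have coefJ : forall g : {poly A}, J g -> forall i, J (g`_i)%:P.
    move=> g Jg; apply: (ideal_coef_lead (m := size g) idJ) => // h Jh _.
    by apply: contrapT => nh; apply: ngood; exists (size h); apply/asboolP; exists h.
  have [i si] : exists i, ~ J ((s : {poly A})`_i)%:P.
    by apply/existsNP => H; apply: Js; exact: (@ideal_coefs A).
  have [a [aJ as0]] := IH _ _ J'prime si.
  have : map_poly (ev a n) s != 0.
    by apply/eqP => /polyP/(_ i); rewrite coef_map coef0.
  move=> /closed_nonrootP[x xs].
  exists (fun i => if i == n then x else a i); split.
    move=> f Jf; rewrite (polyX a x f).
    have -> : map_poly (ev a n) (f : {poly A}) = 0.
      by apply/polyP => j; rewrite coef_map coef0; apply: aJ; apply: coefJ.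
    exact: horner0.
  by rewrite polyX; apply/eqP.
case: (ex_minnP (ex_intro good m0 good_m0)) => e /asboolP[g [Jg sg Jl]] min_e.
have small h : J h -> (size (h : {poly A}) < e)%N -> forall i, J ((h : {poly A})`_i)%:P.
  move=> Jh he; apply: (ideal_coef_lead (m := e.-1) idJ) => //; last by case: (e) he.
  move=> q Jq; case: (e) he min_e => // e' _ min_e qe; apply: contrapT => nq.
  have := min_e (size q) (asboolT (ex_intro _ q (And3 Jq erefl nq))).
  by rewrite leqNgt ltnS qe.
have g0 : g != 0 by apply/eqP => g0; apply: Jl; rewrite g0 lead_coef0.
have e_gt1 : (1 < e)%N.
  rewrite ltnNge; apply/negP => e1; apply: Jl.
  by rewrite -sg in e1; rewrite (size1_polyC e1) lead_coefC -(size1_polyC e1).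
(* If all roots of g(a, X) were roots of s(a, X), then g(a, X), still of size e when l(a) is
   nonzero, would divide s(a, X)^e and hence the smaller r(a, X), which would vanish. So a is chosen
   with l and some coefficient of r nonzero at it. *)
pose l := lead_coef g; pose sp : {poly A} := s; pose r := sp ^+ e %% g.
have divE (q : {poly A}) : (l ^+ scalp q g) *: q = q %/ g * g + q %% g.
  exact: Pdiv.WeakIdomain.divp_eq.
have modJ (q : {poly A}) : J q -> J (q %% g).
  move=> Jq; have -> : q %% g = (l ^+ scalp q g)%:P * q - q %/ g * g.
    by rewrite mul_polyC divE addrAC subrr add0r.
  by apply: idealB => //; apply: JM.
have mod_small (q : {poly A}) : (size (q %% g)%R < e)%N.
  by rewrite -sg Pdiv.CommonIdomain.ltn_modpN0.
have Jr : ~ J r.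
  move=> Jr; have : J ((l ^+ scalp (sp ^+ e) g)%:P * sp ^+ e).
    by rewrite mul_polyC divE; apply: (JD) => //; apply: JM.
  by move=> /JP[|/(prime_idealX prJ)//]; rewrite polyC_exp => /(prime_idealX prJ).
have [i ri] : exists i, ~ J (r`_i)%:P.
  by apply/existsNP => H; apply: Jr; exact: (@ideal_coefs A).
have [a [aJ]] := IH _ (l * r`_i) J'prime (fun H : J (l * r`_i)%:P =>
  match JP _ _ (eq_ind _ J H _ (polyCM l r`_i)) with
  | or_introl H1 => Jl H1 | or_intror H2 => ri H2 end).
rewrite rmorphM => /eqP; rewrite mulf_eq0 negb_or => /andP[al ar].
pose M := map_poly (ev a n).
have MG : size (M g) = e by rewrite size_map_poly_id0 // sg.
have M0 (q : {poly A}) : (forall i, J (q`_i)%:P) -> M q = 0.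
  by move=> H; apply/polyP => j; rewrite coef_map coef0; apply: aJ; apply: H.
have MdivE (q : {poly A}) :
    (ev a n l ^+ scalp q g) *: M q = M (q %/ g) * M g + M (q %% g).
  by rewrite /M -rmorphXn -map_polyZ divE rmorphD rmorphM.
have [x [gx sx]] : exists x, root (M g) x /\ ~~ root (M sp) x.
  apply: contrapT => H.
  have Mg0 : M g != 0 by rewrite -size_poly_gt0 MG ltnW.
  have : M g %| M sp ^+ size (M g).
    apply: dvdp_exp_roots => // x gx; apply: contrapT => sx; apply: H.
    by exists x; split => //; apply/negP.
  rewrite MG => gs; have := MdivE (sp ^+ e).
  rewrite {1}/M rmorphXn -/M => E.
  have : M g %| M r.
    by rewrite -(dvdp_addr _ (dvdp_mull (M (sp ^+ e %/ g)) (dvdpp (M g)))) -E dvdpZr ?expf_neq0.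
  move=> /dvdp_leq; rewrite MG leqNgt => /implyP.
  rewrite (leq_ltn_trans (size_poly _ _) (mod_small _)) implybF negbK => /eqP Mr0.
  by move: ar; rewrite -coef_map -/M Mr0 coef0 eqxx.
exists (fun i => if i == n then x else a i); split; last first.
  by rewrite polyX; apply/eqP.
move=> f Jf; rewrite (polyX a x f); have := MdivE f.
rewrite (M0 (f %% g)); last by apply: small => //; apply: modJ.
move=> /(congr1 (fun p => p.[x])); rewrite addr0 hornerZ hornerM (eqP gx) mulr0.
by move/eqP; rewrite mulf_eq0 expf_eq0 (negPf al) andbF => /eqP.
Qed.

Lemma nullstellensatz_itpoly n (J : set (itpoly n)) :
  ideal J -> ~ J 1 -> exists a, forall f, J f -> ev a n f = 0.
Proof.
move=> idJ J1; have [Q prQ JQ] := exists_prime_ideal idJ J1.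
have [_ Q1 _] := prQ; have [a [aQ _]] := prime_zero prQ Q1.
by exists a => f /JQ/aQ.
Qed.

End PrimeZero.

Lemma eq_mmap n (R S : nzRingType) (c : R -> S) (a b : 'I_n -> S) (p : mpoly n R) :
  a =1 b -> mmap c a p = mmap c b p.
Proof.
by move=> ab; apply: eq_bigr => m _; congr (_ * _); apply: mmap1_eq.
Qed.

Section Nullstellensatz.
Variables (k : closedFieldType) (n : nat).

(** If the images of the h i generated a proper ideal of the iterated polynomial ring, they would
    have a common zero. Otherwise 1 is a combination there, and the relation is carried back by
    [Psi], for which only [Psi (Phi p) = p] is required. *)
Lemma nullstellensatz (I : finType) (h : I -> mpoly n k) :
  (forall x : 'rV[k]_n, exists i, meval (x 0) (h i) != 0) ->
  exists c : I -> mpoly n k, \sum_i c i * h i = 1.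
Proof.
move=> nozero.
pose Phi := mmap (itconst k n) (fun i : 'I_n => itvar k n i).
pose J : set (itpoly k n) := [set f | exists c, f = \sum_i c i * Phi (h i)].
have idJ : ideal J.
  split.
  - by exists (fun=> 0); rewrite big1 // => i _; rewrite mul0r.
  - move=> _ _ [c ->] [d ->]; exists (fun i => c i + d i).
    by rewrite -big_split; apply: eq_bigr => i _; rewrite mulrDl.
  - move=> a _ [c ->]; exists (fun i => a * c i).
    by rewrite mulr_sumr; apply: eq_bigr => i _; rewrite mulrA.
have ev_mmap (T : comNzRingType) (c : {rmorphism k -> T}) a p :
    iteval c a n (Phi p) = mmap c (fun i : 'I_n => a i) p.
  rewrite /Phi /mmap rmorph_sum; apply: eq_bigr => m _; rewrite rmorphM.
  rewrite iteval_const; congr (_ * _); rewrite /mmap1 rmorph_prod.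
  by apply: eq_bigr => i _; rewrite rmorphXn iteval_var.
have [J1|] := pselect (J 1); last first.
  move=> /(nullstellensatz_itpoly idJ)[a aJ].
  have [i /negP[]] := nozero (\row_i a i); apply/eqP.
  rewrite -[RHS](aJ (Phi (h i))).
    rewrite ev_mmap; apply: eq_mmap.
    by move=> j; rewrite mxE.
  exists (fun j => (j == i)%:R); rewrite (bigD1 i) //= eqxx mul1r.
  by rewrite big1 ?addr0 // => j /negPf ->; rewrite mul0r.
pose T := mpoly n k.
pose X (i : nat) : T := if insub i is Some j then mpolyX k (mnm1 j) else 0.
pose Psi := iteval (@mpolyC n k : {rmorphism k -> T}) X n.
have PsiPhi p : Psi (Phi p) = p.
  rewrite /Psi ev_mmap -[RHS]comp_mpoly_id; apply: eq_mmap => i.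
  by rewrite tnth_mktuple /X valK.
have [c /(congr1 Psi) E] := J1; exists (fun i => Psi (c i)).
rewrite rmorph1 in E; rewrite E rmorph_sum; apply: eq_bigr => i _.
by rewrite rmorphM PsiPhi.
Qed.

End Nullstellensatz.

(** * Places of a number field *)

Section IntegerRelations.
Variable K : fieldExtType rat.

Lemma num_field_intr_eq0 (z : int) : (z%:~R == 0 :> K) = (z == 0).
Proof. by rewrite -(@scaler_int rat K) scaler_eq0 oner_eq0 orbF intr_eq0. Qed.

Lemma num_field_natr_eq0 (n : nat) : (n%:R == 0 :> K) = (n == 0)%N.
Proof. exact: (num_field_intr_eq0 n). Qed.

Lemma common_denominator (n : nat) (k : 'I_n -> rat) :
  exists (d : int) (a : 'I_n -> int), d != 0 /\ forall i, d%:~R * k i = (a i)%:~R.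
Proof.
exists (\prod_i denq (k i)), (fun i => (\prod_(j | j != i) denq (k j)) * numq (k i)).
split; first by apply/prodf_neq0 => i _; rewrite denq_neq0.
move=> i; rewrite (bigD1 i) //= !rmorphM /= numqE; move: (k i) => x.
by move: (_ %:~R) (_ %:~R) => a b; ring.
Qed.

(** Among the nontrivial integer relations take one with least sum of absolute values: if p divided
    all coefficients, dividing by p would give a smaller one. All comparisons of local invariants
    with the degree of K rest on this; where only a nonzero coefficient matters, it is applied with
    p = 2. *)
Lemma integer_relation (p n : nat) (u : 'I_n -> K) :
  prime p -> (\dim {:K} < n)%N ->
  exists a : 'I_n -> int,
    \sum_i (a i)%:~R * u i = 0 /\ exists i, ~~ (p %| a i)%Z.
Proof.
move=> p_pr Dn.
have : ~~ free [tuple u i | i < n].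
  rewrite /free size_tuple; apply: contraTN Dn => /eqP <-.
  by rewrite -leqNgt dimvS // subvf.
move=> /freeP nfree.
have [k [k0 [i0 ki0]]] : exists k : 'I_n -> rat,
    \sum_i k i *: u i = 0 /\ exists i, k i != 0.
  apply: contrapT => H; apply: nfree => k k0 i; apply/eqP; apply: contrapT => ki.
  apply: H; exists k; split; last by exists i; apply/negP.
  by rewrite -[RHS]k0; apply: eq_bigr => j _; rewrite -tnth_nth tnth_mktuple.
have [d [a [d0 aE]]] := common_denominator k.
pose rel m := `[< exists b : 'I_n -> int, [/\ \sum_i (b i)%:~R * u i = 0,
   exists i, b i != 0 & (\sum_i `|b i|)%N = m] >].
have exrel : exists m, rel m.
  exists (\sum_i `|a i|)%N; apply/asboolP; exists a; split => //; last first.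
    by exists i0; rewrite -(@intr_eq0 rat) -aE mulf_neq0 // intr_eq0.
  transitivity (d%:~R *: (\sum_i k i *: u i)); last by rewrite k0 scaler0.
  rewrite scaler_sumr; apply: eq_bigr => i _.
  by rewrite scalerA aE scaler_int mulrzl.
case: (ex_minnP exrel) => m /asboolP[b [b0 [i bi] bm]] min_m.
exists b; split => //; apply: contrapT => H.
have pb j : b j = (b j %/ p)%Z * p.
  by apply/esym/divzK; apply: contrapT => nb; apply: H; exists j; apply/negP.
have p_gt1 := prime_gt1 p_pr.
have : rel (\sum_j `|(b j %/ p)%Z|)%N.
  apply/asboolP; exists (fun j => (b j %/ p)%Z); split => //; last first.
    by exists i; apply: contraNneq bi => E; rewrite pb E mul0r.
  apply/eqP; rewrite -(mulIr_eq0 _ (x := p%:R)); last first.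
    by apply: mulIf; rewrite num_field_natr_eq0 -lt0n ltnW.
  rewrite mulr_suml -[X in _ == X]b0; apply/eqP/eq_bigr => j _.
  by rewrite [in RHS]pb rmorphM /= mulrAC.
move=> /min_m; rewrite -bm leqNgt => /negP[].
rewrite (bigD1 i) //= [ltnRHS](bigD1 i) //= -addSn leq_add //.
  by rewrite [X in (_ < `|X|)%N]pb abszM ltn_Pmulr // absz_gt0;
    apply: contraNneq bi => E; rewrite pb E mul0r.
apply: leq_sum => j _; rewrite [X in (_ <= `|X|)%N]pb abszM leq_pmulr //.
exact: ltnW.
Qed.

End IntegerRelations.

(** * Residue characteristic and ramification index of a finite place *)

Section Places.
Variables (K : fieldExtType rat) (v : K -> int).
Hypothesis v_place : finite_place v.
Local Notation D := (\dim {:K}).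

(** As [v 0] is the junk value 0, lower bounds for the valuation must treat 0 apart, as an element
    of infinite valuation. *)
Definition vge (m : int) (x : K) : bool := (x == 0) || (m <= v x).

Lemma placeM x y : x != 0 -> y != 0 -> v (x * y) = v x + v y.
Proof. by case: v_place => _ vM _ _; apply: vM. Qed.

Lemma place1 : v 1 = 0.
Proof.
have := @placeM 1 1 (oner_neq0 _) (oner_neq0 _).
by rewrite mulr1 => /eqP; rewrite -subr_eq subrr => /eqP.
Qed.

Lemma placeN x : v (- x) = v x.
Proof.
have [->|x0] := eqVneq x 0; first by rewrite oppr0.
have N1 : -1 != 0 :> K by rewrite oppr_eq0 oner_eq0.
rewrite -mulN1r placeM //; have := @placeM (-1) (-1) N1 N1.
rewrite mulrNN mulr1 place1; move: (v (-1)) (v x) => a b; lia.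
Qed.

Lemma placeX x n : x != 0 -> v (x ^+ n) = n%:Z * v x.
Proof.
move=> x0; elim: n => [|n IH]; first by rewrite expr0 place1 mul0r.
by rewrite exprS placeM ?expf_neq0 // IH -add1n PoszD mulrDl mul1r.
Qed.

Lemma placeV x : x != 0 -> v x^-1 = - v x.
Proof.
move=> x0; have := @placeM x x^-1 x0; rewrite invr_eq0 x0 mulfV // place1.
by move=> /(_ isT) /esym/eqP; rewrite addrC addr_eq0 => /eqP.
Qed.

Lemma vgeD m x y : vge m x -> vge m y -> vge m (x + y).
Proof.
rewrite /vge; have [->|x0] := eqVneq x 0; first by rewrite add0r.
have [->|y0] := eqVneq y 0; first by rewrite addr0 (negPf x0).
have [//|xy0 /= mx my] := eqVneq (x + y) 0.
by case: v_place => _ _ vD _; apply: le_trans (vD x y x0 y0 xy0); rewrite le_min mx.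
Qed.

Lemma vgeN m x : vge m (- x) = vge m x.
Proof. by rewrite /vge oppr_eq0 placeN. Qed.

Lemma vgeB m x y : vge m x -> vge m y -> vge m (x - y).
Proof. by move=> mx my; apply: vgeD; rewrite ?vgeN. Qed.

Lemma vgeM m n x y : vge m x -> vge n y -> vge (m + n) (x * y).
Proof.
rewrite /vge; have [->|x0] := eqVneq x 0; first by rewrite mul0r eqxx.
have [->|y0] := eqVneq y 0; first by rewrite mulr0 eqxx.
by rewrite mulf_eq0 (negPf x0) (negPf y0) /= placeM // => mx ny; rewrite lerD.
Qed.

Lemma vge0 m : vge m 0. Proof. by rewrite /vge eqxx. Qed.

Lemma vge_le m n x : m <= n -> vge n x -> vge m x.
Proof. by rewrite /vge; case: eqP => //= _; apply: le_trans. Qed.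

Lemma vge_val x : vge (v x) x. Proof. by rewrite /vge lexx orbT. Qed.

Lemma vge_sum m (I : Type) (r : seq I) (P : pred I) (F : I -> K) :
  (forall i, P i -> vge m (F i)) -> vge m (\sum_(i <- r | P i) F i).
Proof. by move=> H; apply: (big_ind (vge m)) => //; [exact: vge0|exact: vgeD]. Qed.

Lemma vge_int (z : int) : vge 0 z%:~R.
Proof.
have vge_nat (n : nat) : vge 0 n%:R.
  elim: n => [|n IH]; first exact: vge0.
  by rewrite -natr1 vgeD // /vge place1 lexx orbT.
by case: z => n; [exact: vge_nat|rewrite NegzE rmorphN vgeN; exact: vge_nat].
Qed.

(** A term of strictly smallest valuation would be the opposite of a sum of elements of larger
    valuation. *)
Lemma place_sum_eq0 (I : finType) (F : I -> K) i :
  \sum_j F j = 0 -> F i != 0 -> exists j, [/\ j != i, F j != 0 & v (F j) <= v (F i)].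
Proof.
move=> sum0 Fi; apply: contrapT => H.
have : vge (v (F i) + 1) (F i).
  move: sum0; rewrite (bigD1 i) //= => /eqP; rewrite addr_eq0 => /eqP {2}->.
  rewrite vgeN; apply: vge_sum => j ji; rewrite /vge.
  case: eqVneq => //= Fj; rewrite leNgt; apply/negP => lt; apply: H.
  by exists j; split => //; rewrite -ltzD1.
by rewrite /vge (negPf Fi) /=; move: (v _) => a; lia.
Qed.

Lemma place_sum_eq0_tie (I : finType) (F : I -> K) i :
  \sum_j F j = 0 -> F i != 0 ->
  exists j k, [/\ j != k, F j != 0, F k != 0 & v (F j) = v (F k)].
Proof.
move=> sum0 Fi.
case: (@arg_minP _ int I i (fun j => F j != 0) (fun j => v (F j)) Fi) => j Fj minj.
have [k [kj Fk le_kj]] := place_sum_eq0 sum0 Fj.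
by exists k, j; split => //; apply/eqP; rewrite eq_le le_kj minj.
Qed.

Lemma vge_natr (n : nat) : vge 0 n%:R.
Proof. exact: (vge_int n). Qed.

Lemma place_natr_ge0 (n : nat) : (0 < n)%N -> 0 <= v n%:R.
Proof. by move=> n0; have := vge_natr n; rewrite /vge num_field_natr_eq0 gtn_eqF. Qed.

Lemma place_natrM (m n : nat) :
  (0 < m)%N -> (0 < n)%N -> v (m * n)%:R = v m%:R + v n%:R.
Proof.
by move=> m0 n0; rewrite natrM placeM // num_field_natr_eq0 -lt0n.
Qed.

Lemma place_intr (z : int) : v z%:~R = v `|z|%N%:R.
Proof. by case: z => n //; rewrite NegzE rmorphN placeN. Qed.

Lemma place_prod_primes n : (0 < n)%N -> (forall p, prime p -> v p%:R = 0) -> v n%:R = 0.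
Proof.
move=> n0 vp; elim/ltn_ind: n n0 => n IH n0.
have [n1|n1] := leqP n 1; first by have -> : n = 1%N; [lia|rewrite place1].
have /dvdnP[m nE] := pdiv_dvd n; have p_pr := pdiv_prime n1.
have m0 : (0 < m)%N by case: m nE => [nE|//]; rewrite nE in n1.
have mn : (m < n)%N by rewrite nE -[ltnLHS]muln1 ltn_pmul2l // prime_gt1.
have := place_natrM m0 (prime_gt0 p_pr); rewrite -nE => ->.
by rewrite IH // add0r vp.
Qed.

(** If all primes had valuation 0, so would all nonzero integers. The terms of an integer relation
    among 1, t, ..., t^D, with t a uniformizer, would then have distinct valuations. *)
Lemma place_residue_char : exists2 p, prime p & 0 < v p%:R.
Proof.
apply: contrapT => H.
have vp p : prime p -> v p%:R = 0.
  move=> p_pr; apply/eqP; rewrite eq_le place_natr_ge0 ?prime_gt0 // andbT leNgt.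
  by apply/negP => vp; apply: H; exists p.
have [_ _ _ [t t0 vt]] := v_place.
have [a [sum0 [i ai]]] := integer_relation (fun i : 'I_(D.+1) => t ^+ i) (isT : prime 2) (ltnSn _).
have ai0 : a i != 0 by apply: contraNneq ai => ->; rewrite dvdz0.
have nz (j : 'I_(D.+1)) : ((a j)%:~R * t ^+ j != 0 :> K) = (a j != 0).
  by rewrite mulf_eq0 expf_eq0 (negPf t0) andbF orbF num_field_intr_eq0.
have val (j : 'I_(D.+1)) : a j != 0 -> v ((a j)%:~R * t ^+ j) = j.
  move=> aj; rewrite placeM ?num_field_intr_eq0 ?expf_neq0 // placeX // vt mulr1.
  by rewrite place_intr place_prod_primes ?absz_gt0 // add0r.
have [j [k [jk]]] := place_sum_eq0_tie (F := fun j : 'I_(D.+1) =>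
  (a j)%:~R * t ^+ j) (i := i) sum0 (etrans (nz i) ai0).
rewrite !nz => aj ak; rewrite !val // => -[] /val_inj /eqP; exact/negP.
Qed.

Section ResidueChar.
Variable p : nat.
Hypotheses (p_pr : prime p) (vp : 0 < v p%:R).

Lemma place_coprime n : (0 < n)%N -> ~~ (p %| n)%N -> v n%:R = 0.
Proof.
move=> n0 pn; apply/eqP; rewrite eq_le place_natr_ge0 // andbT leNgt.
apply/negP => vn.
have [a b ab _] := egcdnP p n0.
have : coprime n p by rewrite coprime_sym prime_coprime.
rewrite /coprime => /eqP cop; rewrite cop in ab.
have : vge 1 (1 : K).
  have -> : 1 = (a * n)%:R - (b * p)%:R :> K by rewrite ab natrD addrC addKr.
  apply: vgeB; rewrite natrM -[1]add0r; apply: vgeM; rewrite ?vge_natr // /vge.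
    by rewrite -gtz0_ge1 vn orbT.
  by rewrite -gtz0_ge1 vp orbT.
by rewrite /vge oner_eq0 place1.
Qed.

Lemma place_natr n : (0 < n)%N -> v n%:R = (logn p n)%:Z * v p%:R.
Proof.
move=> n0; have [m pm nE] := pfactor_coprime p_pr n0.
have m0 : (0 < m)%N by move: n0; rewrite nE muln_gt0 => /andP[].
have pl0 : (0 < p ^ logn p n)%N by rewrite expn_gt0 prime_gt0.
have := place_natrM m0 pl0; rewrite -nE => ->.
rewrite natrX placeX ?num_field_natr_eq0 -?lt0n ?prime_gt0 //.
by rewrite place_coprime ?add0r // -prime_coprime.
Qed.

(** With e the valuation of p, a term a_j t^j has valuation congruent to j modulo e. Two terms of a
    relation among 1, t, ..., t^D must have equal valuation, so e divides a nonzero difference of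
    absolute value at most D. *)
Lemma place_ramification : v p%:R <= D.
Proof.
have [_ _ _ [t t0 vt]] := v_place.
have [a [sum0 [i ai]]] := integer_relation (fun i : 'I_(D.+1) => t ^+ i) p_pr (ltnSn _).
have ai0 : a i != 0 by apply: contraNneq ai => ->; rewrite dvdz0.
have nz (j : 'I_(D.+1)) : ((a j)%:~R * t ^+ j != 0 :> K) = (a j != 0).
  by rewrite mulf_eq0 expf_eq0 (negPf t0) andbF orbF num_field_intr_eq0.
have val (j : 'I_(D.+1)) : a j != 0 ->
    v ((a j)%:~R * t ^+ j) = (logn p `|a j|)%:Z * v p%:R + j.
  move=> aj; rewrite placeM ?num_field_intr_eq0 ?expf_neq0 // placeX // vt mulr1.
  by rewrite place_intr place_natr ?absz_gt0.
have [j [k [jk]]] := place_sum_eq0_tie (F := fun j : 'I_(D.+1) =>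
  (a j)%:~R * t ^+ j) (i := i) sum0 (etrans (nz i) ai0).
rewrite !nz => aj ak; rewrite !val //.
have : (j : nat) <> k by move=> /val_inj/eqP; apply/negP.
move: vp (ltn_ord j) (ltn_ord k);
  move: (v _) (logn _ _) (logn _ _) (nat_of_ord j) (nat_of_ord k) => e a1 a2 j' k' e0 jD kD jk' E.
rewrite leNgt; apply/negP => eD.
have E2 : (a1%:Z - a2%:Z) * e = j'%:Z - k'%:Z by rewrite mulrBl; clear -E;
  move: (_ * e) (_ * e) E => A B E; lia.
have : a1%:Z - a2%:Z != 0 by apply/eqP => d0; clear -d0 E2 jk'; rewrite d0 mul0r in E2; lia.
move: (a1%:Z - a2%:Z) E2 => d E2 d0.
have : `|d| * e = `|j'%:Z - k'%:Z| by rewrite -E2 normrM (gtr0_norm e0).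
have : e <= `|d| * e by apply: ler_peMl; [exact: ltW|move: d0; clear; lia].
move: eD jD kD jk' d0; clear; lia.
Qed.

End ResidueChar.

End Places.

Lemma card_fset_set_image (T : finType) (U : choiceType) (S : set U) (g : T -> U) :
  S `<=` range g -> finite_set S /\ (#|` fset_set S| <= #|T|)%N.
Proof.
move=> Sg; have SI : S #<= `I_#|T|.
  have sub : S `<=` range (fun i : 'I_#|T| => g (enum_val i)).
    by move=> y /Sg[x _ <-]; exists (enum_rank x) => //; rewrite enum_rankK.
  apply: card_le_trans (subset_card_le sub) _.
  apply: card_le_trans (card_image_le _ _) _.
  by rewrite -(card_le_eql card_II) card_lexx.
by split; [apply/finite_set_leP; eexists; exact: SI | exact: geq_card_fset_set].
Qed.

Lemma leq_card_fset_set_inj (n : nat) (U : choiceType) (S : set U) (g : 'I_n -> U) :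
  finite_set S -> injective g -> (forall i, S (g i)) -> (n <= #|` fset_set S|)%N.
Proof.
move=> finS injg Sg; apply: leq_card_fset_set => //.
have gS : range g `<=` S by move=> _ [i _ <-].
apply: card_le_trans (subset_card_le gS).
rewrite (card_le_eql card_II).
by rewrite -(card_le_eql (inj_card_eq (f := g) _)) ?card_lexx // => x y _ _; apply: injg.
Qed.

Lemma ltn_neq_injective (T : Type) n (G : nat -> T) :
  (forall i j, (i < j)%N -> (j < n)%N -> G i <> G j) ->
  injective (fun i : 'I_n => G i).
Proof.
move=> H i j /= E; apply: ord_inj; case: (ltngtP i j) => // ij.
  by have := H _ _ ij (ltn_ord j).
by have := H _ _ ij (ltn_ord i); rewrite E.
Qed.

(** * Cardinality of the residue field *)

Section Residue.
Variables (K : fieldExtType rat) (v : K -> int) (p : nat).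
Hypotheses (v_place : finite_place v) (p_pr : prime p) (vp : 0 < v p%:R).
Local Notation D := (\dim {:K}).

Lemma valuation_ringE x : valuation_ring v x <-> vge v 0 x.
Proof. by split=> [[->|H]|/orP[/eqP|]]; rewrite /vge ?eqxx ?H ?orbT //; [left|right]. Qed.

Lemma maximal_idealE x : maximal_ideal v x <-> vge v 1 x.
Proof.
by split=> [[->|H]|/orP[/eqP|]]; rewrite /vge ?eqxx -?gtz0_ge1 ?H ?orbT //; [left|right].
Qed.

Lemma vge_dvd (a : int) : (p %| a)%Z -> vge v 1 a%:~R.
Proof.
move=> /dvdzP[b ->]; rewrite rmorphM -[1]add0r; apply: vgeM => //.
  exact: vge_int.
by rewrite /vge -gtz0_ge1 vp orbT.
Qed.

(** Linear independence over the prime field of the images in the residue field, expressed with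
    integer representatives of the coefficients. *)
Definition residue_indep r (x : nat -> K) : Prop :=
  (forall i, (i < r)%N -> vge v 0 (x i)) /\
  forall a : nat -> int, vge v 1 (\sum_(i < r) (a i)%:~R * x i) ->
    forall i, (i < r)%N -> (p %| a i)%Z.

Lemma residue_indep_le r x : residue_indep r x -> (r <= D)%N.
Proof.
move=> [_ indep]; rewrite leqNgt; apply/negP => Dr.
have [a [sum0 [i /negP[]]]] := integer_relation (fun i : 'I_r => x i) p_pr Dr.
pose b i := if insub i is Some j then a j else 0.
have bE (j : 'I_r) : b j = a j by rewrite /b valK.
rewrite -bE; apply: indep => //.
by under eq_bigr do rewrite bE; rewrite sum0 vge0.
Qed.

(** A maximal independent family spans the residue field: adding y produces a relation in which the
    coefficient of y is prime to p, and this coefficient can be inverted modulo p. *)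
Lemma residue_span : exists r (x : nat -> K), (r <= D)%N /\
  forall y, vge v 0 y -> exists f : {ffun 'I_r -> 'I_p},
    vge v 1 (y - \sum_(i < r) (f i)%:R * x i).
Proof.
pose P r := `[< exists x, residue_indep r x >].
have exP : exists r, P r by exists 0%N; apply/asboolP; exists (fun=> 0); split.
have leP r : P r -> (r <= D)%N by move=> /asboolP[x] /residue_indep_le.
case: (ex_maxnP exP leP) => r /[dup] Pr /asboolP[x [x0 indep]] maxr.
exists r, x; split => [|y y0]; first exact: leP.
pose x' i := if (i < r)%N then x i else y.
have [a [suma [i ir ai]]] : exists a : nat -> int,
    vge v 1 (\sum_(i < r) (a i)%:~R * x i + (a r)%:~R * y) /\
    exists2 i, (i < r.+1)%N & ~ (p %| a i)%Z.
  apply: contrapT => H; suff /maxr : P r.+1 by rewrite ltnn.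
  apply/asboolP; exists x'; split.
    by move=> i _; rewrite /x'; case: ifP => [/x0|].
  move=> a; rewrite big_ord_recr /= {2}/x' ltnn => suma i ir.
  apply: contrapT => ai; apply: H; exists a; split; last by exists i.
  congr (vge v 1 (_ + _)) : suma; apply: eq_bigr => j _; by rewrite /x' ltn_ord.
have par : ~~ (p %| a r)%Z.
  apply/negP => par; apply: ai; move: ir; rewrite ltnS leq_eqVlt => /predU1P[-> //|].
  apply: (indep a); rewrite -[X in vge v 1 X](addrK ((a r)%:~R * y)).
  by apply: vgeB => //; rewrite -[1]addr0; apply: vgeM => //; exact: vge_dvd.
have [[c d] cd] : exists cd : int * int, cd.1 * a r + cd.2 * p = 1.
  have : coprimez (a r) p.
    by rewrite /coprimez gcdzC -[_ == _]/(coprime p `|a r|) prime_coprime.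
  by move=> /coprimezP[u uE]; exists u.
rewrite /= in cd.
have p0 : p%:Z != 0 by rewrite eqz_nat -lt0n prime_gt0.
(* c is an inverse of [a r] modulo p, so m j represents - a_j / a_r modulo p. *)
pose m j := ((- c * a j) %% p)%Z.
have m0 j : 0 <= m j by rewrite modz_ge0.
have mp j : m j < p by rewrite ltz_pmod // ltz_nat prime_gt0.
have mp' j : (`|m j| < p)%N by rewrite -ltz_nat gez0_abs.
exists [ffun i : 'I_r => Ordinal (mp' i)].
have -> : y - \sum_(i < r) ([ffun i : 'I_r => Ordinal (mp' i)] i)%:R * x i =
  c%:~R * (\sum_(i < r) (a i)%:~R * x i + (a r)%:~R * y) + (d * p)%:~R * y +
   \sum_(i < r) (((- c * a i) %/ p)%Z * p)%:~R * x i.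
  have -> : \sum_(i < r) ([ffun i : 'I_r => Ordinal (mp' i)] i)%:R * x i =
     - (c%:~R * (\sum_(i < r) (a i)%:~R * x i)) -
      \sum_(i < r) (((- c * a i) %/ p)%Z * p)%:~R * x i.
    rewrite mulr_sumr -!sumrN -big_split /=; apply: eq_bigr => j _; rewrite ffunE /=.
    rewrite mulrA -rmorphM -!mulNr -mulrDl; congr (_ * _); rewrite -!rmorphN -rmorphD /=.
    have := divz_eq (- c * a j) p; rewrite -/(m j) => E.
    have -> : - (c * a j) - ((- c * a j) %/ p)%Z * p = m j.
      by rewrite -mulNr {1}E addrAC subrr add0r.
    by rewrite -[in RHS](gez0_abs (m0 j)).
  set A := \sum_(i < r) _; set B := \sum_(i < r) _.
  have -> : c%:~R * (A + (a r)%:~R * y) + (d * p)%:~R * y = c%:~R * A + y.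
    by rewrite mulrDr mulrA -addrA -rmorphM -mulrDl -rmorphD /= cd mul1r.
  by rewrite opprD !opprK addrA [y + _]addrC.
apply: (vgeD v_place); last first.
  apply: (vge_sum v_place) => j _; rewrite -[1]addr0; apply: (vgeM v_place); last exact: x0.
  by apply: vge_dvd; rewrite dvdz_mull.
apply: (vgeD v_place); rewrite -[1]addr0.
  by rewrite addrC; apply: vgeM => //; exact: vge_int.
by apply: vgeM => //; apply: vge_dvd; rewrite dvdz_mull.
Qed.

(** Every residue class is a combination of at most D elements with coefficients in 0, ..., p - 1,
    while 0, ..., p - 1 themselves represent distinct classes. *)
Lemma residue_card_bounds : (p <= residue_card v <= p ^ D)%N.
Proof.
have [r [x [rD span]]] := residue_span.
rewrite /residue_card; set S := [set C | _].
have [|finS cardS] := @card_fset_set_image {ffun 'I_r -> 'I_p} _ S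
   (fun f => [set y | maximal_ideal v (y - \sum_(i < r) (f i)%:R * x i)]).
- move=> C [y /valuation_ringE /span[f fy] ->]; exists f => //.
  apply/seteqP; split=> z /maximal_idealE H; apply/maximal_idealE.
    rewrite -(subrKA (\sum_(i < r) (f i)%:R * x i)); apply: (vgeD v_place) => //.
    by rewrite -(vgeN v_place) opprB.
  by rewrite -(subrKA y); apply: (vgeD v_place).
- rewrite card_ffun !card_ord in cardS.
apply/andP; split; last first.
  by rewrite (leq_trans cardS) // leq_pexp2l // prime_gt0.
pose G (i : nat) := [set y : K | maximal_ideal v (y - i%:R)].
apply: (leq_card_fset_set_inj (g := fun i : 'I_p => G i)) => //.
  apply: ltn_neq_injective => i j ij jp /seteqP[_ /(_ j%:R)].
  have Gj : G j j%:R by rewrite /G /= subrr; left.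
  move=> /(_ Gj)/maximal_idealE; rewrite -natrB; last exact: ltnW.
  rewrite /vge num_field_natr_eq0 subn_eq0 leqNgt ij /=.
  rewrite (place_coprime v_place p_pr vp) // ?subn_gt0 //.
  by rewrite gtnNdvd ?subn_gt0 // (leq_ltn_trans (leq_subr _ _)).
by move=> i; exists i%:R => //; apply/valuation_ringE; exact: vge_natr.
Qed.

End Residue.

(** * Independence of places *)

Section TwoPlaces.
Variable K : fieldExtType rat.
Implicit Types v w : K -> int.

Lemma placeXz v x (n : int) : finite_place v -> x != 0 -> v (x ^ n) = n * v x.
Proof.
move=> vP x0; case: n => n; first exact: placeX.
by rewrite -[x ^ _]/(x ^- n.+1) placeV ?expf_neq0 // placeX // NegzE mulNr.
Qed.

Lemma place1D_neg v x : finite_place v -> x != 0 -> v x < 0 ->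
  1 + x != 0 /\ v (1 + x) = v x.
Proof.
move=> vP x0 vx.
have x1 : 1 + x != 0.
  by apply/eqP => /eqP; rewrite addr_eq0 => /eqP E; move: vx; rewrite -(placeN vP) -E place1.
split=> //; apply/eqP; rewrite eq_le; apply/andP; split.
  have : vge v (Num.min 0 (v (1 + x))) x.
    rewrite -[x in vge _ _ x](addKr 1) -[- 1 + _]addrC; apply: (vgeB vP).
      by apply: vge_le (vge_val _ _); rewrite ge_min lexx orbT.
    by rewrite /vge place1 // ge_min lexx orbT.
  by rewrite /vge (negPf x0) /= ge_min leNgt vx.
have : vge v (v x) (1 + x).
  by apply: (vgeD vP); [rewrite /vge place1 // ltW // orbT|exact: vge_val].
by rewrite /vge (negPf x1).
Qed.

Lemma place1D_pos v x : finite_place v -> x != 0 -> 0 < v x ->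
  1 + x != 0 /\ v (1 + x) = 0.
Proof.
move=> vP x0 vx; have [||xi1 E] := place1D_neg vP (x := x^-1).
- by rewrite invr_eq0.
- by rewrite placeV // oppr_lt0.
have xE : 1 + x = x * (1 + x^-1) by rewrite mulrDr mulr1 mulfV // addrC.
by rewrite xE mulf_neq0 // placeM // E placeV // subrr.
Qed.

(** For a uniformizer t of v, the element x t^(- v x) is a unit at v, hence at w, so w x = v x * w
    t. As w takes the value 1 and w t is nonnegative, w t = 1. *)
Lemma place_incl_eq v w : finite_place v -> finite_place w ->
  (forall x, vge v 0 x -> vge w 0 x) -> v = w.
Proof.
move=> vP wP vw; have [v0 _ _ [t t0 vt]] := vP; have [w0 _ _ [s s0 ws]] := wP.
have key x : x != 0 -> w x = v x * w t.
  move=> x0; pose u := x * t ^ (- v x).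
  have tX : t ^ (- v x) != 0 by rewrite expfz_neq0.
  have u0 : u != 0 by rewrite mulf_neq0.
  have uE z : finite_place z -> z u = z x - v x * z t.
    by move=> zP; rewrite placeM // placeXz // mulNr.
  have vu : v u = 0 by rewrite uE // vt mulr1 subrr.
  have := vw u; rewrite /vge vu lexx orbT (negPf u0) /= => /(_ isT) wu.
  have := vw u^-1; rewrite /vge placeV // vu oppr0 lexx orbT invr_eq0 (negPf u0) /=.
  rewrite placeV // => /(_ isT) wu'.
  by apply/eqP; rewrite -subr_eq0 -uE // eq_le wu andbT -oppr_ge0.
have := vw t; rewrite /vge vt ler01 orbT (negPf t0) => /(_ isT) /= wt.
have wt1 : w t = 1.
  have := key s s0; rewrite ws; move: (v s) (w t) wt => a b b0 E.
  have ab : a * b \is a GRing.unit by rewrite -E unitr1.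
  move: ab; rewrite unitrM => /andP[_]; rewrite qualifE /= => /orP[/eqP //|/eqP bE].
  by rewrite bE in b0.
apply/funext => x; have [->|x0] := eqVneq x 0; first by rewrite v0 w0.
by rewrite key // wt1 mulr1.
Qed.

Lemma place_separate v w : finite_place v -> finite_place w -> v <> w ->
  exists2 z, z != 0 & 0 <= v z /\ w z < 0.
Proof.
move=> vP wP nvw; apply: contrapT => H; apply: nvw; apply: place_incl_eq => // x vx.
apply: contrapT => /negP; rewrite /vge negb_or -ltNge => /andP[x0 wx]; apply: H.
by exists x => //; split => //; move: vx; rewrite /vge (negPf x0).
Qed.

Lemma place_separate_strict v w : finite_place v -> finite_place w -> v <> w ->
  exists2 t, t != 0 & v t < 0 /\ 0 < w t.
Proof.
move=> vP wP nvw; have [z z0 [vz wz]] := place_separate vP wP nvw.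
have [y y0 [wy vy]] := place_separate wP vP (nesym nvw).
exists (y / z); first by rewrite mulf_neq0 ?invr_eq0.
rewrite !placeM ?invr_eq0 // !placeV //.
by split; rewrite ?subr_gt0 ?subr_lt0; [apply: lt_le_trans vz|apply: lt_le_trans wy].
Qed.

(* The approximation theorem of Artin and Whaples. *)
Lemma place_approximation (I : eqType) (w : I -> K -> int) (v : K -> int) (s : seq I) :
  finite_place v -> (forall i, finite_place (w i)) -> (forall i, i \in s -> v <> w i) ->
  exists2 t, t != 0 & v t < 0 /\ forall i, i \in s -> 0 < w i t.
Proof.
move=> vP wP; elim: s => [_|i s IH vs].
  have [_ _ _ [t t0 vt]] := vP; exists t^-1; rewrite ?invr_eq0 //.
  by rewrite placeV // vt; split.
have [|t t0 [vt wt]] := IH; first by move=> j js; apply: vs; rewrite inE js orbT.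
have [u u0 [vu wu]] := place_separate_strict vP (wP i) (vs i (mem_head _ _)).
(* This power makes t outweigh u at the places already treated, where w_j(t) is at least 1. *)
pose m := (\sum_(j <- s) `|w j u|).+1.
have mj j : j \in s -> (`|w j u| < m)%N.
  by move=> js; rewrite ltnS (big_rem j) //= leq_addr.
have pos j : j \in s -> 0 < m%:Z * w j t + w j u.
  move=> js; have := wt j js; have := mj j js.
  move: (w j t) (w j u) => a b bm a0.
  have : m%:Z <= m%:Z * a by rewrite ler_peMr.
  move: (_ * a) bm; clear; move: m => m c; lia.
have tm0 : t ^+ m != 0 by rewrite expf_neq0.
have vtm : v (t ^+ m) < 0 by rewrite placeX // pmulr_rlt0.
have [wit|wit] := leP 0 (w i t).
  exists (t ^+ m * u); first by rewrite mulf_neq0.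
  split; first by rewrite placeM // -[ltRHS]addr0 ltrD.
  move=> j; rewrite inE placeM // placeX // => /predU1P[->|/pos //].
  by rewrite ltr_wpDl // mulr_ge0.
have witm : w i (t ^+ m) < 0 by rewrite placeX // pmulr_rlt0.
have [t1 vt1] := place1D_neg vP tm0 vtm.
have [_ wt1] := place1D_neg (wP i) tm0 witm.
(* The fraction is a unit at v and at [w i], where t has a pole, so u decides there; at the other
   places, where t vanishes, it has the valuation of t^m. *)
exists (t ^+ m / (1 + t ^+ m) * u); first by rewrite !mulf_neq0 ?invr_eq0.
have val z : finite_place z ->
    z (t ^+ m / (1 + t ^+ m) * u) = z (t ^+ m) - z (1 + t ^+ m) + z u.
  by move=> zP; rewrite !placeM ?mulf_neq0 ?invr_eq0 // placeV.
split; first by rewrite val // vt1 subrr add0r.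
move=> j; rewrite inE val // => /predU1P[->|js]; first by rewrite wt1 subrr add0r.
have [|_ ->] := place1D_pos (wP j) tm0; first by rewrite placeX // mulr_gt0 // wt.
by rewrite subr0 placeX // pos.
Qed.

End TwoPlaces.

Section PlacesAbove.
Variables (K : fieldExtType rat) (p : nat).
Hypothesis p_pr : prime p.

Definition places_above : set (K -> int) := [set v | finite_place v /\ 0 < v p%:R].

(** Approximation gives for each i an element that is a unit at [w i] and vanishes at all the other
    places. With more than D places these elements have an integer relation with some a_i prime to
    p, whose i-th term alone has valuation 0 at [w i]. *)
Lemma places_above_le n (w : 'I_n -> K -> int) :
  (forall i, places_above (w i)) -> injective w -> (n <= \dim {:K})%N.
Proof.
move=> wP wI; rewrite leqNgt; apply/negP => Dn.
have wF i : finite_place (w i) by have [] := wP i.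
have /choice[x xP] : forall i, exists y : K,
    [/\ y != 0, w i y = 0 & forall j, j != i -> 0 < w j y].
  move=> i.
  have [|t t0 [wt wjt]] := @place_approximation _ _ w (w i) (enum (predC1 i)) (wF i) wF.
    by move=> j; rewrite mem_enum inE => /negP ji /wI ij; apply: ji; rewrite ij.
  have [t1 wt1] := place1D_neg (wF i) t0 wt.
  exists (t / (1 + t)); rewrite mulf_neq0 ?invr_eq0 //; split => //.
    by rewrite placeM ?invr_eq0 // placeV // wt1 subrr.
  move=> j ji; have jt : 0 < w j t by apply: wjt; rewrite mem_enum.
  have [_ wjt1] := place1D_pos (wF j) t0 jt.
  by rewrite placeM ?invr_eq0 // placeV // wjt1 subr0.
have [a [sum0 [i pai]]] := integer_relation x p_pr Dn.
have ai0 : a i != 0 by apply: contraNneq pai => ->; rewrite dvdz0.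
have [xi0 wxi _] := xP i; have [_ wip] := wP i.
have Fi : (a i)%:~R * x i != 0 by rewrite mulf_neq0 // num_field_intr_eq0.
have [j [ji Fj]] := place_sum_eq0 (F := fun i => (a i)%:~R * x i) (wF i) sum0 Fi.
have [xj0 _ /(_ i)] := xP j; rewrite eq_sym => /(_ ji) wxj.
have aj0 : a j != 0 by apply: contraNneq Fj => ->; rewrite mul0r.
rewrite !placeM ?num_field_intr_eq0 // wxi addr0 !place_intr //.
rewrite (place_coprime (n := `|a i|%N) (wF i) p_pr wip) ?absz_gt0 //.
have := place_natr_ge0 (wF i) (n := `|a j|); rewrite absz_gt0 aj0 => /(_ isT) waj.
by move=> le0; have := lt_le_trans (ltr_wpDl waj wxj) le0; rewrite ltxx.
Qed.

Lemma places_above_finite :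
  finite_set places_above /\ (#|` fset_set places_above| <= \dim {:K})%N.
Proof.
have bound (B : {fset (K -> int)}) : [set` B] `<=` places_above -> (#|` B| <= \dim {:K})%N.
  move=> BP; pose w (i : 'I_#|` B|) := nth (fun=> 0) (enum_fset B) i.
  apply: (@places_above_le _ w) => [i|i j /eqP].
    by apply: BP; rewrite /= /w mem_nth.
  by rewrite nth_uniq ?fset_uniq // => /eqP /ord_inj.
have fin : finite_set places_above.
  apply: contrapT => /(@infinite_set_fset _ _ (\dim {:K}).+1)[B /bound le lt].
  by have := leq_trans lt le; rewrite ltnn.
by split => //; apply: bound => v; rewrite /= in_fset_set // inE.
Qed.

End PlacesAbove.

(** * Construction of places from valuation rings *)

Section MaximalSubring.
Variables (K : fieldType) (y : K).

Definition subring_set (A : set K) : Prop :=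
  [/\ A 1, forall x z, A x -> A z -> A (x - z) & forall x z, A x -> A z -> A (x * z)].

(** Containing y^-1 but not y makes y^-1 a non-unit of A. As in Chevalley's extension theorem, a
    maximal subring of this kind is a valuation ring, and y has a pole at its valuation. *)
Definition avoids (A : set K) : Prop := [/\ subring_set A, A y^-1 & ~ A y].

Section Subring.
Variable A : set K.
Hypothesis A_ring : subring_set A.

Lemma subring_set0 : A 0.
Proof. by have [A1 AB _] := A_ring; rewrite -(subrr 1); apply: AB. Qed.

Lemma subring_setN x : A x -> A (- x).
Proof. by have [_ AB _] := A_ring; rewrite -sub0r; apply: AB => //; apply: subring_set0. Qed.

Lemma subring_setD x z : A x -> A z -> A (x + z).
Proof.
by have [_ AB _] := A_ring; move=> Ax Az; rewrite -[z]opprK; apply: AB => //; apply: subring_setN.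
Qed.

Lemma subring_setM x z : A x -> A z -> A (x * z).
Proof. by have [_ _] := A_ring; apply. Qed.

Lemma subring_set1 : A 1.
Proof. by have [] := A_ring. Qed.

Lemma subring_sum (I : Type) (r : seq I) (P : pred I) (F : I -> K) :
  (forall i, P i -> A (F i)) -> A (\sum_(i <- r | P i) F i).
Proof.
move=> H; apply: (big_ind A) => //; [exact: subring_set0|exact: subring_setD].
Qed.

Lemma subring_setX x n : A x -> A (x ^+ n).
Proof.
move=> Ax; elim: n => [|n IH]; first exact: subring_set1.
by rewrite exprS; apply: subring_setM.
Qed.

Lemma subring_int (n : int) : A n%:~R.
Proof.
have nat_A (m : nat) : A m%:R.
  elim: m => [|m IH]; first exact: subring_set0.
  by rewrite -natr1; apply: subring_setD => //; exact: subring_set1.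
by case: n => n; [exact: nat_A|rewrite NegzE rmorphN; apply: subring_setN; exact: nat_A].
Qed.

End Subring.

Definition adjoin_set (A : set K) (z : K) : set K :=
  [set w | exists2 q : {poly K}, (forall i, A q`_i) & w = q.[z]].

Lemma adjoin_subring A z : subring_set A -> subring_set (adjoin_set A z).
Proof.
move=> Ar; split.
- exists 1; last by rewrite hornerC.
  by move=> i; rewrite coef1; case: (_ == _); [exact: subring_set1|exact: subring_set0].
- move=> _ _ [q Aq ->] [r Ar' ->]; exists (q - r); last by rewrite hornerD hornerN.
  by move=> i; rewrite coefB; have [_ AB _] := Ar; apply: AB.
- move=> _ _ [q Aq ->] [r Ar' ->]; exists (q * r); last by rewrite hornerM.
  move=> i; rewrite coefM; apply: subring_sum => // j _; exact: subring_setM.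
Qed.

Lemma adjoin_sub A z : subring_set A -> A `<=` adjoin_set A z.
Proof.
move=> Ar x Ax; exists x%:P; last by rewrite hornerC.
by move=> i; rewrite coefC; case: ifP => // _; exact: subring_set0.
Qed.

Lemma adjoin_mem A z : subring_set A -> adjoin_set A z z.
Proof.
move=> Ar; exists 'X; last by rewrite hornerX.
by move=> i; rewrite coefX; case: (_ == _); [exact: subring_set1|exact: subring_set0].
Qed.

Lemma exists_maximal_avoiding A0 : avoids A0 ->
  exists A, avoids A /\ forall z, ~ A z -> adjoin_set A z y.
Proof.
move=> A0P; pose P (A : set K) := A = set0 \/ avoids A.
have [F FP Ftot|A [PA maxA]] := @Zorn_bigcup _ P.
  have [F0|/existsNP[B0 /not_implyP[FB0 B0n]]] := pselect (forall A, F A -> A = set0).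
    by left; rewrite -subset0 => x [A FA Ax]; rewrite -(F0 _ FA).
  have good A x : F A -> A x -> avoids A.
    by move=> FA Ax; case: (FP _ FA) => // A_0; rewrite A_0 in Ax.
  have /set0P[b0 Bb0] : B0 != set0 by apply/eqP.
  have [B0r B0y _] := good _ _ FB0 Bb0.
  have two x z A B : F A -> F B -> A x -> B z -> exists C, [/\ F C, C x & C z].
    move=> FA FB Ax Bz; case: (Ftot _ _ FA FB) => sub.
      by exists B; split => //; apply: sub.
    by exists A; split => //; apply: sub.
  right; split; [split| |].
  - by exists B0 => //; exact: subring_set1.
  - move=> x z [A FA Ax] [B FB Bz]; have [C [FC Cx Cz]] := two _ _ _ _ FA FB Ax Bz.
    by exists C => //; have [[_ CB _] _ _] := good _ _ FC Cx; apply: CB.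
  - move=> x z [A FA Ax] [B FB Bz]; have [C [FC Cx Cz]] := two _ _ _ _ FA FB Ax Bz.
    by exists C => //; have [[_ _ CM] _ _] := good _ _ FC Cx; apply: CM.
  - by exists B0.
  - by move=> [A FA Ay]; have [_ _] := good _ _ FA Ay.
have {}PA : avoids A.
  case: PA => // A_0; exfalso; apply: (maxA A0); last by right.
  rewrite A_0 properEneq; split; last exact: sub0set.
  by apply/eqP => /esym E; have [_ + _] := A0P; rewrite E.
exists A; split => // z Az; apply: contrapT => nAy; have [Ar Ay _] := PA.
apply: (maxA (adjoin_set A z)).
  split; first exact: adjoin_sub.
  by move=> sub; apply: Az; apply: sub; exact: adjoin_mem.
right; split => //; first exact: adjoin_subring.
exact: adjoin_sub.
Qed.

Section Maximal.
Variable A : set K.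
Hypotheses (A_avoids : avoids A) (A_max : forall z, ~ A z -> adjoin_set A z y).

Let Ar : subring_set A. Proof. by have [] := A_avoids. Qed.
Let Ay : A y^-1. Proof. by have [] := A_avoids. Qed.
Let nAy : ~ A y. Proof. by have [] := A_avoids. Qed.
Let y0 : y != 0. Proof. by apply/eqP => E; apply: nAy; rewrite E; exact: subring_set0. Qed.

(** Let u = 1 + b / y. If u^-1 were outside A, maximality would make y a polynomial in u^-1, and y
    u^N would lie in A for N large. As u^N = 1 + c / y with c in A, this element is y + c, so y
    would lie in A. *)
Lemma maximal_local b : A b -> 1 + b / y != 0 /\ A (1 + b / y)^-1.
Proof.
move=> Ab; set u := 1 + b / y.
have Au : A u by apply: subring_setD => //; [exact: subring_set1|exact: subring_setM].
have u0 : u != 0.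
  apply/eqP => /eqP; rewrite addr_eq0 => /eqP E; apply: nAy.
  have -> : y = - b by rewrite -[LHS]mul1r E mulNr mulfVK.
  exact: subring_setN.
split => //; apply: contrapT => /A_max[q Aq yE].
have [c Ac uE] : exists2 c, A c & u ^+ (size q) = 1 + c / y.
  elim: (size q) => [|n [c Ac E]]; first by exists 0; [exact: subring_set0|rewrite mul0r addr0].
  exists (b + c + b * c / y).
    exact: (subring_setD Ar (subring_setD Ar Ab Ac) (subring_setM Ar (subring_setM Ar Ab Ac) Ay)).
  by rewrite exprS E /u; ring.
apply: nAy; have -> : y = y * u ^+ size q -
  c by rewrite uE mulrDr mulr1 mulrCA mulfV // mulr1 addrK.
have [_ AB _] := Ar; apply: AB => //.
rewrite yE horner_coef mulr_suml; apply: subring_sum => // i _.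
have -> : q`_i * u^-1 ^+ i * u ^+ size q = q`_i * u ^+ (size q - i).
  rewrite -mulrA; congr (_ * _); rewrite exprVn.
  have E (j m : nat) : (j <= m)%N -> u ^- j * u ^+ m = u ^+ (m - j).
    by move=> jm; rewrite -{1}(subnK jm) exprD mulrCA mulVf ?mulr1 // expf_neq0.
  exact: E (ltnW (ltn_ord i)).
by apply: subring_setM => //; exact: subring_setX.
Qed.

(** Subtracting the constant term from y = g(z^-1) gives y u = g_1 z^-1 + g_2 z^-2 + ..., with u = 1
    - g_0 / y a unit of A. Dividing by y u writes 1 as a combination of negative powers of z, by
    which the leading term of f is replaced with lower ones; the size condition keeps the exponents
    nonnegative. *)
Lemma maximal_reduce (z : K) (f g : {poly K}) : z != 0 -> (forall i, A f`_i) -> (forall i,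
  A g`_i) ->
  y = f.[z] -> y = g.[z^-1] -> (size g <= size f)%N ->
  exists f' : {poly K}, [/\ forall i, A f'`_i, y = f'.[z] & (size f' < size f)%N].
Proof.
move=> z0 Af Ag yf yg gf.
have g_gt1 : (1 < size g)%N.
  by rewrite ltnNge; apply/negP => /size1_polyC E; apply: nAy; rewrite yg E hornerC.
have [u0 Au] := maximal_local (subring_setN Ar (Ag 0%N)).
set u := 1 + _ in u0 Au.
have yu : y * u = \sum_(i < (size g).-1) g`_i.+1 * z^-1 ^+ i.+1.
  rewrite mulrDr mulr1 mulrCA mulfV // mulr1 {1}yg horner_coef.
  rewrite -[in LHS](prednK (ltnW g_gt1)) big_ord_recl expr0 mulr1.
  by rewrite addrAC subrr add0r; apply: eq_bigr => i _.
pose n := (size f).-1; pose l := f`_n.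
have nE : size f = n.+1 by rewrite prednK // (leq_trans _ gf) // ltnW.
exists (f - l *: 'X^n + \sum_(i < (size g).-1) (l * g`_i.+1 * (y^-1 * u^-1)) *: 'X^(n - i.+1)).
split.
- move=> i; rewrite coefD coef_sum; apply: subring_setD => //.
    rewrite coefB coefZ coefXn; have [_ AB _] := Ar; apply: AB => //.
    by case: (_ == _); rewrite ?mulr1 ?mulr0 //; [exact: Af|exact: subring_set0].
  apply: subring_sum => // j _; rewrite coefZ coefXn.
  apply: subring_setM => //; last by case: (_ == _); [exact: subring_set1|exact: subring_set0].
  exact: (subring_setM Ar (subring_setM Ar (Af _) (Ag _)) (subring_setM Ar Ay Au)).
- rewrite 2!hornerD hornerN hornerZ hornerXn horner_sum -yf.
  suff -> : \sum_(i < (size g).-1) ((l * g`_i.+1 * (y^-1 * u^-1)) *: 'X^(n -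
    i.+1)).[z] = l * z ^+ n.
    by rewrite subrK.
  have -> : l * z ^+ n = l * z ^+ n * (y^-1 * u^-1) * (y * u).
    by rewrite -!mulrA [u^-1 * _]mulrCA [y^-1 * (y * _)]mulrA mulVf // mul1r mulVf // mulr1.
  rewrite yu mulr_sumr; apply: eq_bigr => i _; rewrite hornerZ hornerXn.
  have -> : z ^+ n = z ^+ (n - i.+1) * z ^+ i.+1.
    rewrite -exprD subnK // -ltnS -nE; apply: leq_trans gf.
    apply: (@leq_trans (size g).-1.+1); first exact: ltn_ord.
    by rewrite prednK // ltnW.
  rewrite exprVn; set Z := z ^+ i.+1; set W := z ^+ (n - _).
  have -> : l * (W * Z) * (y^-1 * u^-1) * (g`_i.+1 * Z^-1) =
     l * g`_i.+1 * (y^-1 * u^-1) * W * (Z * Z^-1) by ring.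
  by rewrite mulfV ?mulr1 // expf_neq0.
- rewrite nE ltnS; apply/leq_sizeP => j nj.
  rewrite coefD coefB coefZ coefXn coef_sum big1 => [|i _].
    rewrite addr0; move: nj; rewrite leq_eqVlt => /predU1P[<-|nj].
      by rewrite eqxx mulr1 subrr.
    by rewrite gtn_eqF // mulr0 subr0 nth_default // nE.
  rewrite coefZ coefXn gtn_eqF ?mulr0 // (leq_trans _ nj) //.
  have n0 : (0 < n)%N by rewrite -ltnS -nE (leq_trans g_gt1).
  by rewrite ltn_subrL n0.
Qed.

(** If neither z nor its inverse belonged to A, y would be a polynomial in z and one in z^-1. The
    longer of the two can always be shortened, an infinite descent on the sum of the sizes. *)
Lemma maximal_valuation z : z != 0 -> A z \/ A z^-1.
Proof.
move=> z0; apply: contrapT => /not_orP[/A_max[f Af yf] /A_max[g Ag yg]].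
move: {2}(size f + size g)%N (leqnn (size f + size g)) => n.
elim: n z z0 f g Af Ag yf yg => [|n IH] z z0 f g Af Ag yf yg.
  rewrite leqn0 addn_eq0 => /andP[f0 _].
  by move: f0 y0; rewrite size_poly_eq0 => /eqP f0; rewrite yf f0 horner0 eqxx.
move=> fgn; have [gf|fg] := leqP (size g) (size f).
  have [f' [Af' yf' f'f]] := maximal_reduce z0 Af Ag yf yg gf.
  apply: (IH z z0 f' g) => //; rewrite -ltnS; apply: leq_trans fgn.
  by rewrite ltn_add2r.
have zi0 : z^-1 != 0 by rewrite invr_eq0.
have yf1 : y = f.[z^-1^-1] by rewrite invrK.
have [g' [Ag' yg' g'g]] := maximal_reduce zi0 Ag Af yg yf1 (ltnW fg).
apply: (IH z z0 f g') => //; rewrite -ltnS; apply: leq_trans fgn.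
by rewrite ltn_add2l.
Qed.

End Maximal.
End MaximalSubring.

Section DiscreteValuation.
Variables (K : fieldExtType rat) (A : set K) (p : nat).
Hypotheses (Ar : subring_set A) (A_val : forall z, z != 0 -> A z \/ A z^-1).
Hypotheses (p_pr : prime p) (Ap : ~ A (p%:R)^-1).
Local Notation D := (\dim {:K}).

Let p0 : p%:R != 0 :> K. Proof. by rewrite num_field_natr_eq0 -lt0n prime_gt0. Qed.

(** The maximal ideal of A; since A is a valuation ring, x lies in A as soon as its inverse does
    not. *)
Definition nonunit (x : K) : Prop := x = 0 \/ ~ A x^-1.

Lemma nonunit_A x : nonunit x -> A x.
Proof.
have [-> _|x0] := eqVneq x 0; first exact: subring_set0.
by move=> [E|nx]; [rewrite E eqxx in x0|case: (A_val x0)].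
Qed.

Lemma nonunitM a x : A a -> nonunit x -> nonunit (a * x).
Proof.
have [->|a0] := eqVneq a 0; first by rewrite mul0r; left.
move=> Aa [->|nx]; first by rewrite mulr0; left.
right=> H; apply: nx; have -> : x^-1 = a * (a * x)^-1.
  by rewrite invfM mulrA mulfV // mul1r.
exact: subring_setM.
Qed.

Lemma nonunit1 : ~ nonunit 1.
Proof.
by move=> [/eqP|]; [rewrite oner_eq0|rewrite invr1 => H; apply: H; exact: subring_set1].
Qed.

Lemma nonunitD x z : nonunit x -> nonunit z -> nonunit (x + z).
Proof.
have key a b : a != 0 -> nonunit a -> A (b / a) -> nonunit (a + b).
  move=> a0 na Aba; have -> : a + b = (1 + b / a) * a by rewrite mulrDl mul1r mulfVK.
  by apply: nonunitM => //; apply: subring_setD => //; exact: subring_set1.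
move=> nx nz; have [->|x0] := eqVneq x 0; first by rewrite add0r.
have [->|z0] := eqVneq z 0; first by rewrite addr0.
have /A_val : x / z != 0 by rewrite mulf_neq0 ?invr_eq0.
by rewrite invf_div => -[|] H; [rewrite addrC|]; apply: key.
Qed.

Lemma nonunitN x : nonunit x -> nonunit (- x).
Proof. by move=> nx; rewrite -mulN1r; apply: nonunitM => //; apply: subring_setN => //;
  exact: subring_set1. Qed.

Lemma nonunit_sum (I : Type) (r : seq I) (P : pred I) (F : I -> K) :
  (forall i, P i -> nonunit (F i)) -> nonunit (\sum_(i <- r | P i) F i).
Proof. by move=> H; apply: (big_ind nonunit) => //; [left|exact: nonunitD]. Qed.

Lemma nonunit_p : nonunit p%:R. Proof. by right. Qed.

Lemma nonunit_dvd (a : int) : nonunit a%:~R -> (p %| a)%Z.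
Proof.
move=> na; apply: contrapT => /negP pa; apply: nonunit1.
have : coprimez a p by rewrite /coprimez gcdzC -[_ == _]/(coprime p `|a|) prime_coprime.
move=> /coprimezP[[c d] /= cd].
have -> : 1 = c%:~R * a%:~R + d%:~R * p%:R :> K.
  by rewrite -[LHS]/(1%:~R) -cd rmorphD !rmorphM.
apply: nonunitD; apply: nonunitM => //; [exact: subring_int|exact: subring_int|exact: nonunit_p].
Qed.

Definition val_lt (x z : K) : bool := [&& x != 0, z != 0 & `[< nonunit (z / x) >]].

Lemma val_lt_trans : transitive val_lt.
Proof.
move=> z x w /and3P[x0 z0 /asboolP xz] /and3P[_ w0 /asboolP zw].
apply/and3P; split => //; apply/asboolP.
have -> : w / x = (w / z) * (z / x) by rewrite mulrA mulfVK.
by apply: nonunitM => //; exact: nonunit_A.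
Qed.

(* A relation between the elements of the chain, divided by the term of least
   value among those with a coefficient prime to p, is impossible. *)
Lemma chain_size (s : seq K) : path val_lt 1 (rcons s p%:R) -> (size s < D)%N.
Proof.
rewrite -cats1 cat_path => /andP[s_path /= /andP[last_p _]].
rewrite ltnNge; apply/negP => Ds.
pose u (i : 'I_(size s).+1) := nth 0 (1 :: s) i.
have [a [sum0 [i0 ai0]]] := integer_relation u p_pr (Ds : (D < (size s).+1)%N).
case: (arg_minnP (P := fun i => ~~ (p %| a i)%Z) (fun i => nat_of_ord i) ai0) => i pai mini.
have u_lt (j k : 'I_(size s).+1) : (j < k)%N -> val_lt (u j) (u k).
  move=> jk; apply: (@sorted_ltn_nth _ val_lt val_lt_trans 0 (1 :: s)) => //; exact: ltn_ord.
have lt1 (j k : 'I_(size s).+1) : (j < k)%N -> u j != 0 /\ nonunit (u k / u j).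
  by move=> /u_lt /and3P[? _ /asboolP].
have up (j : 'I_(size s).+1) : u j != 0 /\ nonunit (p%:R / u j).
  have lastE : last 1 s = u ord_max by rewrite /u (last_nth 0).
  have : val_lt (u j) p%:R.
    have := leq_ord j; rewrite leq_eqVlt => /orP[/eqP jE|jm].
      by have -> : u j = last 1 s; [rewrite lastE /u jE|].
    by apply: val_lt_trans last_p; rewrite lastE; apply: u_lt.
  by move=> /and3P[? _ /asboolP].
have Au (j : 'I_(size s).+1) : A (u j).
  case: j => -[|j] jlt; first exact: subring_set1.
  have [|_] := @lt1 ord0 (Ordinal jlt); first by [].
  by rewrite /u /= divr1 => /nonunit_A.
apply: (negP pai); apply: nonunit_dvd.
have [ui0 _] := up i.
have -> : (a i)%:~R = - \sum_(j | j != i) (a j)%:~R * (u j / u i).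
  apply: (mulIf ui0); rewrite mulNr mulr_suml.
  move: sum0; rewrite (bigD1 i) //= => /eqP; rewrite addr_eq0 => /eqP ->; congr (- _).
  by apply: eq_bigr => j _; rewrite -mulrA mulfVK.
apply: nonunitN; apply: nonunit_sum => j ji.
(* For j after i the quotient u_j / u_i is a non-unit; for j before i the factor p of a_j is used,
   since p / u_i is a non-unit. *)
have [ij|ji'|/ord_inj E] := ltngtP i j; last by rewrite E eqxx in ji.
  by apply: nonunitM; [exact: subring_int|have [] := lt1 _ _ ij].
have /dvdzP[b ->] : (p %| a j)%Z.
  by apply: contrapT => /negP /mini; rewrite leqNgt ji'.
have -> : (b * p)%:~R * (u j / u i) = (b%:~R * u j) * (p%:R / u i) :> K.
  by rewrite rmorphM /= -!mulrA; congr (_ * _); rewrite mulrCA.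
apply: nonunitM; last by have [] := up i.
by apply: subring_setM => //; exact: subring_int.
Qed.

(** Take a longest chain strictly between 1 and p in the divisibility order. Its first element, or p
    if it is empty, generates the maximal ideal: a non-unit not divisible by it could be put in
    front. *)
Lemma exists_uniformizer : exists t, [/\ t != 0, nonunit t &
  forall z, nonunit z -> A (z / t)].
Proof.
pose P n := `[< exists s : seq K, path val_lt 1 (rcons s p%:R) /\ size s = n >].
have exP : exists n, P n.
  exists 0%N; apply/asboolP; exists [::]; split => //=; rewrite andbT.
  apply/and3P; split; rewrite ?oner_neq0 //.
  by apply/asboolP; rewrite divr1; exact: nonunit_p.
have boundP n : P n -> (n <= D)%N by move=> /asboolP[s [/chain_size + <-]] => /ltnW.
case: (ex_maxnP exP boundP) => n /asboolP[s [s_path sn]] maxn.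
pose t := head p%:R (rcons s p%:R).
have t1 : val_lt 1 t by move: s_path; rewrite /t; case: (s) => [|x s'] /= /andP[].
have /and3P[_ t0 /asboolP] := t1; rewrite divr1 => nt.
exists t; split => // z nz; have [->|z0] := eqVneq z 0; first by rewrite mul0r; exact: subring_set0.
apply: contrapT => nzt; suff /maxn : P n.+1 by rewrite ltnn.
apply/asboolP; exists (z :: s); rewrite /= sn; split => //.
apply/andP; split.
  by apply/and3P; split; rewrite ?oner_neq0 //; apply/asboolP; rewrite divr1.
have zt : val_lt z t.
  by apply/and3P; split => //; apply/asboolP; right; rewrite invf_div.
by move: s_path zt; rewrite /t; case: (s) => [_ /= -> //|x s' /= /andP[_ ->] ->].
Qed.

Section Uniformizer.
Variable t : K.
Hypotheses (t0 : t != 0) (nt : nonunit t) (t_min : forall z, nonunit z -> A (z / t)).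

Let unit_elt (u : K) := A u /\ A u^-1.

(** Otherwise t, t^2, ..., t^D would be a chain below p longer than [chain_size] allows. *)
Lemma uniformizer_bound_p : exists k, ~ A (p%:R / t ^+ k).
Proof.
apply: contrapT => H; have {}H k : A (p%:R / t ^+ k).
  by apply: contrapT => nA; apply: H; exists k.
suff /chain_size : path val_lt 1 (rcons (mkseq (fun i => t ^+ i.+1) D) p%:R).
  by rewrite size_mkseq ltnn.
have step i : val_lt (t ^+ i) (t ^+ i.+1).
  by rewrite /val_lt !expf_neq0 //=; apply/asboolP; rewrite exprS mulfK ?expf_neq0.
have lastp i : val_lt (t ^+ i) p%:R.
  rewrite /val_lt expf_neq0 // p0 /=; apply/asboolP.
  have -> : p%:R / t ^+ i = (p%:R / t ^+ i.+1) * t.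
    by rewrite exprSr invfM mulrA mulfVK.
  exact: nonunitM.
rewrite -cats1 cat_path /= andbT; apply/andP; split; last first.
  by case: D => [|d]; [rewrite -[last _ _](expr0 t)|rewrite /mkseq -addn1 iotaD map_cat
    last_cat /=].
have : forall m i, path val_lt (t ^+ i) [seq t ^+ j.+1 | j <- iota i m].
  by elim=> //= m IH i; rewrite step IH.
by move=> /(_ D 0%N).
Qed.

Lemma unit_part (z : K) : A z -> z != 0 -> (exists k, ~ A (z / t ^+ k)) ->
  exists n, unit_elt (z / t ^+ n).
Proof.
move=> Az z0 [k Ak].
have exP : exists k, `[< ~ A (z / t ^+ k) >] by exists k; apply/asboolP.
case: (ex_minnP exP) => -[|m] /asboolP nA min_m; first by rewrite expr0 divr1 in nA.
have Am : A (z / t ^+ m).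
  by apply: contrapT => nAm; have /min_m := asboolT nAm; rewrite ltnn.
exists m; split => //; apply: contrapT => nu; apply: nA.
rewrite exprSr invfM mulrA; apply: t_min; by right.
Qed.

Lemma unit_elt_not_nonunit u : unit_elt u -> u != 0 -> ~ nonunit u.
Proof. by move=> [_ Au] u0 [/eqP|//]; rewrite (negPf u0). Qed.

(** z divides a nonzero integer in A, by a relation among its powers. This integer is, up to sign, m
    p^l with m a unit of A, and p is a unit times t^e; so t^(e l + 1) cannot divide z. *)
Lemma uniformizer_bound z : A z -> z != 0 -> exists k, ~ A (z / t ^+ k).
Proof.
move=> Az z0; apply: contrapT => H; have {}H k : A (z / t ^+ k).
  by apply: contrapT => nA; apply: H; exists k.
have [e [Ae1 Ae2]] := unit_part (nonunit_A nonunit_p) p0 uniformizer_bound_p.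
have [a [sum0 [i0 pai0]]] := integer_relation (fun i : 'I_D.+1 => z ^+ i) p_pr (ltnSn _).
have ai00 : a i0 != 0 by apply: contraNneq pai0 => ->; rewrite dvdz0.
case: (arg_minnP (P := fun i => a i != 0) (fun i => nat_of_ord i) ai00) => i ai mini.
have [w Aw aE] : exists2 w, A w & (a i)%:~R = z * w.
  exists (- \sum_(j | j != i) (a j)%:~R * z ^+ (j - i.+1)).
    apply: subring_setN => //; apply: subring_sum => // j _.
    by apply: subring_setM => //; [exact: subring_int|exact: subring_setX].
  have zi : z ^+ i != 0 by rewrite expf_neq0.
  apply: (mulIf zi); rewrite mulrN mulNr mulr_sumr mulr_suml.
  move: sum0; rewrite (bigD1 i) //= => /eqP; rewrite addr_eq0 => /eqP ->; congr (- _).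
  apply: eq_bigr => j ji; have [->|aj] := eqVneq (a j) 0; first by rewrite !mul0r mulr0 mul0r.
  have ij : (i < j)%N.
    by rewrite ltn_neqAle mini // andbT; apply: contraNneq ji => E; rewrite (ord_inj E).
  have -> : z ^+ j = z * z ^+ (j - i.+1) * z ^+ i.
    by rewrite -exprS -exprD; congr (_ ^+ _); lia.
  by rewrite -!mulrA mulrCA.
have a0 : (0 < `|a i|)%N by rewrite absz_gt0.
have [m pm mE] := pfactor_coprime p_pr a0; set l := logn p `|a i| in mE.
have Am : A (m%:R)^-1.
  apply: contrapT => nAm; have : nonunit m%:R by right.
  by move=> /(@nonunit_dvd m%:Z); move: pm; rewrite prime_coprime // => /negP.
have aabs : `|a i|%N%:R = (a i)%:~R * (-1) ^+ (a i < 0)%R :> K.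
  case: (a i) => n; first by rewrite ltNge /= mulr1.
  by rewrite NegzE /= rmorphN mulNr mulrN1 opprK.
have t1 : t ^+ (e * l).+1 != 0 by rewrite expf_neq0.
have te : t ^+ e != 0 by rewrite expf_neq0.
have m0 : m%:R != 0 :> K.
  by rewrite num_field_natr_eq0 -lt0n; move: a0; rewrite mE muln_gt0 => /andP[].
have pe : (p%:R / t ^+ e) ^+ l != 0 by rewrite expf_neq0 // mulf_neq0 ?invr_eq0.
apply: (unit_elt_not_nonunit (u := t)) => //; split; first exact: nonunit_A.
have -> : t^-1 = (p%:R / t ^+ e)^-1 ^+ l * (m%:R)^-1 * (w * (-1) ^+ (a i < 0)%R) *
    (z / t ^+ (e * l).+1).
  have -> : (p%:R / t ^+ e)^-1 ^+ l = t ^+ (e * l) * (p ^ l)%:R^-1.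
    by rewrite invf_div expr_div_n exprM natrX.
  set B := (-1) ^+ _.
  have -> : t ^+ (e * l) * (p ^ l)%:R^-1 * m%:R^-1 * (w * B) * (z / t ^+ (e * l).+1) =
     (z * w * B) * (m * p ^ l)%:R^-1 * (t ^+ (e * l) / t ^+ (e * l).+1).
    have alg (F : fieldType) (T X Y f g h S : F) :
        T * X * Y * (f * g) * (h * S) = (h * f * g) * (Y * X) * (T * S) by ring.
    by rewrite natrM invfM; exact: alg.
  rewrite -aE -mE -aabs mulfV ?num_field_natr_eq0 -?lt0n // mul1r.
  by rewrite exprSr invfM mulrA mulfV ?mul1r // expf_neq0.
apply: subring_setM => //; apply: subring_setM => //.
  by apply: subring_setM => //; exact: subring_setX.
apply: subring_setM => //; apply: subring_setX => //; apply: subring_setN => //.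
exact: subring_set1.
Qed.

Lemma exists_unit_part z : z != 0 -> exists n : int, unit_elt (z / t ^ n).
Proof.
move=> z0; have [Az|Az] := A_val z0.
  by have [n nP] := unit_part Az z0 (uniformizer_bound Az z0); exists n.
have zi0 : z^-1 != 0 by rewrite invr_eq0.
have [n [n1 n2]] := unit_part Az zi0 (uniformizer_bound Az zi0).
exists (- n%:Z); rewrite -exprnN invrK; split.
  by move: n2; rewrite invfM !invrK.
by move: n1; rewrite invfM.
Qed.

Lemma exprz_unif_A (n : int) : A (t ^ n) -> 0 <= n.
Proof.
case: n => // n An; exfalso; have tn : t ^+ n.+1 != 0 by rewrite expf_neq0.
apply: (@unit_elt_not_nonunit (t ^+ n.+1)) => //.
  by split => //; apply: subring_setX => //; exact: nonunit_A.
by rewrite exprSr; apply: nonunitM => //; apply: subring_setX => //; exact: nonunit_A.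
Qed.

Lemma exists_valuation : exists2 v : K -> int, finite_place v &
  forall z, z != 0 -> A z <-> 0 <= v z.
Proof.
have /choice[v vP] : forall z : K, exists n : int,
    (* The clause for z = 0 supplies the value at 0 prescribed by [finite_place]. *)
    (z = 0 -> n = 0) /\ (z != 0 -> unit_elt (z / t ^ n)).
  move=> z; have [->|z0] := eqVneq z 0; first by exists 0.
  by have [n] := exists_unit_part z0; exists n; split => // E; rewrite E eqxx in z0.
have vu z : z != 0 -> unit_elt (z / t ^ v z) by move=> z0; have [_] := vP z; apply.
have tz (n : int) : t ^ n != 0 by rewrite expfz_neq0.
have A_tz (n : int) : 0 <= n -> A (t ^ n).
  by case: n => // n _; apply: subring_setX => //; exact: nonunit_A.
have key z n : z != 0 -> A (z / t ^ n) <-> n <= v z.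
  move=> z0; have [u1 u2] := vu z z0.
  have E : z / t ^ n = (z / t ^ v z) * t ^ (v z - n).
    by rewrite expfzDr // -invr_expz mulrA mulfVK.
  split=> H; last first.
    by rewrite E; apply: subring_setM => //; apply: A_tz; rewrite subr_ge0.
  rewrite -subr_ge0; apply: exprz_unif_A.
  have -> : t ^ (v z - n) = (z / t ^ v z)^-1 * (z / t ^ n).
    by rewrite E mulKf // mulf_neq0 ?invr_eq0.
  exact: subring_setM.
have uniq z n : z != 0 -> unit_elt (z / t ^ n) -> v z = n.
  move=> z0 [u1 u2]; apply/eqP; rewrite eq_le; apply/andP; split; last exact/key.
  rewrite -subr_ge0; apply: exprz_unif_A.
  have [w1 w2] := vu z z0.
  have -> : t ^ (n - v z) = (z / t ^ v z) * (z / t ^ n)^-1.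
    by rewrite invf_div expfzDr // -invr_expz [RHS]mulrC mulrA mulfVK.
  exact: subring_setM.
exists v; last first.
  by move=> z z0; have := key z 0 z0; rewrite expr0z divr1.
split; first by have [+ _] := vP 0; apply.
- move=> x z x0 z0; apply: uniq; first by rewrite mulf_neq0.
  rewrite expfzDr // invfM mulrACA; have [a1 a2] := vu x x0; have [b1 b2] := vu z z0.
  by split; [|rewrite invfM]; apply: subring_setM.
- move=> x z x0 z0 xz0; apply/key => //.
  rewrite mulrDl; apply: subring_setD => //; apply/key => //.
    by rewrite ge_min lexx.
  by rewrite ge_min lexx orbT.
- exists t => //; apply: uniq => //; rewrite expr1z mulfV //.
  by split; rewrite ?invr1; exact: subring_set1.
Qed.

End Uniformizer.
End DiscreteValuation.

Section NonIntegral.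
Variable K : fieldExtType rat.

Definition int_integral (y : K) : Prop :=
  exists2 q : {poly int}, q \is monic & root (map_poly intr q) y.

(** The subring is Z[y^-1]. An equation y = q(y^-1), multiplied by y^n with n the size of q, is a
    monic equation for y over the integers. *)
Lemma not_int_integral_avoids (y : K) :
  ~ int_integral y -> avoids y [set w | exists q : {poly int}, w = (map_poly intr q).[y^-1]].
Proof.
move=> nint.
have y0 : y != 0.
  apply/eqP => y0; apply: nint; exists 'X; rewrite ?monicX //.
  by rewrite map_polyX /root hornerX y0.
split; [split| |] => /=.
- by exists 1; rewrite rmorph1 hornerC.
- by move=> _ _ [q ->] [r ->]; exists (q - r); rewrite rmorphB hornerD hornerN.
- by move=> _ _ [q ->] [r ->]; exists (q * r); rewrite rmorphM hornerM.
- by exists 'X; rewrite map_polyX hornerX.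
move=> [q yq]; apply: nint; pose n := size q.
exists ('X^(n.+1) - \sum_(i < n) q`_i *: 'X^(n - i)).
  apply/monicP; rewrite lead_coefDl ?lead_coefXn // size_polyXn size_polyN ltnS.
  apply: (leq_trans (size_sum _ _ _)); apply/bigmax_leqP => i _.
  by rewrite (leq_trans (size_scale_leq _ _)) // size_polyXn ltnS leq_subr.
rewrite rmorphB rmorph_sum /= map_polyXn /root hornerD hornerN hornerXn horner_sum /=.
rewrite subr_eq0 exprS {1}yq horner_coef size_map_poly_id0; last first.
  by rewrite num_field_intr_eq0 lead_coef_eq0; apply: contra_neq y0 => q0;
    rewrite yq q0 rmorph0 horner0.
rewrite mulr_suml; apply/eqP; apply: eq_bigr => i _.
rewrite map_polyZ map_polyXn hornerZ hornerXn coef_map -mulrA; congr (_ * _).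
have E (j m : nat) : (j <= m)%N -> y^-1 ^+ j * y ^+ m = y ^+ (m - j).
  by move=> jm; rewrite exprVn -{1}(subnK jm) exprD mulrCA mulVf ?mulr1 // expf_neq0.
exact: E (ltnW (ltn_ord i)).
Qed.

(** The valuation ring obtained from [maximal_valuation] is discrete once some prime p is not
    invertible in it. If all primes were invertible, dividing a relation among the powers of y by
    a_i y^(i-1), with i the highest exponent, would express y through y^-1 inside the ring. *)
Lemma not_integral_place (y : K) :
  ~ int_integral y -> exists2 v : K -> int, finite_place v & v y < 0.
Proof.
move=> nint; have y0 : y != 0.
  apply/eqP => y0; apply: nint; exists 'X; rewrite ?monicX //.
  by rewrite map_polyX /root hornerX y0.
have [A [Aav Amax]] := exists_maximal_avoiding (not_int_integral_avoids nint).
have [Ar Ay nAy] := Aav; have Aval := maximal_valuation Aav Amax.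
have [p p_pr Ap] : exists2 p, prime p & ~ A (p%:R)^-1.
  apply: contrapT => H.
  have Ainv n : (0 < n)%N -> A (n%:R)^-1.
    elim/ltn_ind: n => n IH n0.
    have [n1|n1] := leqP n 1; first by have -> : n = 1%N; [lia|rewrite invr1; exact: subring_set1].
    have /dvdnP[m nE] := pdiv_dvd n; have p_pr := pdiv_prime n1.
    have m0 : (0 < m)%N by case: m nE => [nE|//]; rewrite nE in n1.
    have mn : (m < n)%N by rewrite nE -[ltnLHS]muln1 ltn_pmul2l // prime_gt1.
    have -> : n%:R = m%:R * (pdiv n)%:R :> K by rewrite -natrM -nE.
    rewrite invfM; apply: subring_setM => //; first exact: IH.
    by apply: contrapT => nA; apply: H; exists (pdiv n).
  pose D := \dim {:K}.
  have [a [sum0 [i0 pai0]]] := integer_relation (fun i : 'I_D.+1 =>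
    y ^+ i) (isT : prime 2) (ltnSn _).
  have ai00 : a i0 != 0 by apply: contraNneq pai0 => ->; rewrite dvdz0.
  case: (arg_maxnP (P := fun i => a i != 0) (fun i => nat_of_ord i) ai00) => i ai maxi.
  have aiK : (a i)%:~R != 0 :> K by rewrite num_field_intr_eq0.
  have AinvZ : A ((a i)%:~R)^-1.
    case: (a i) ai => n n0; first by apply: Ainv; rewrite lt0n.
    by rewrite NegzE rmorphN invrN; apply: subring_setN => //; exact: Ainv.
  apply: nAy; have -> : y = - \sum_(j | j != i) (a j)%:~R * (y^-1 ^+ i.-1 * y ^+ j) * (a i)%:~R^-1.
    have i0' : (0 < i)%N.
      rewrite lt0n; apply/eqP => iz; move: sum0; rewrite (bigD1 i) //= big1 => [|j ji].
        by rewrite addr0 iz expr0 mulr1 => /eqP; rewrite (negPf aiK).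
      have [->|aj] := eqVneq (a j) 0; first by rewrite mul0r.
      by have /= := maxi j aj; rewrite iz leqn0 => /eqP jz; case/eqP: ji; apply: ord_inj;
        rewrite iz jz.
    apply: (mulIf aiK); rewrite mulNr -mulr_suml mulfVK //.
    have yi : y ^+ i.-1 != 0 by rewrite expf_neq0.
    apply: (mulIf yi); rewrite mulrAC -exprS prednK // mulNr mulr_suml mulrC.
    move: sum0; rewrite (bigD1 i) //= => /eqP; rewrite addr_eq0 => /eqP ->; congr (- _).
    apply: eq_bigr => j _; rewrite -mulrA; congr (_ * _).
    by rewrite mulrAC exprVn mulVf ?mul1r.
  apply: subring_setN => //; apply: subring_sum => // j ji.
  have [->|aj] := eqVneq (a j) 0; first by rewrite !mul0r; exact: subring_set0.
  apply: subring_setM => //; apply: subring_setM => //; first exact: subring_int.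
  have ji' : (j <= i.-1)%N.
    have : (j < i)%N by rewrite ltn_neqAle; apply/andP; split;
      [apply: contraNneq ji => /ord_inj ->|exact: maxi].
    by lia.
  have -> : y^-1 ^+ i.-1 * y ^+ j = y^-1 ^+ (i.-1 - j).
    by rewrite -{1}(subnK ji') exprD -mulrA [y^-1 ^+ j]exprVn mulVf ?mulr1 // expf_neq0.
  exact: subring_setX.
have [t [t0 nt tmin]] := exists_uniformizer Ar Aval p_pr Ap.
have [v vP vA] := exists_valuation Ar Aval p_pr Ap t0 nt tmin.
by exists v => //; rewrite ltNge; apply/negP => /(vA y y0).
Qed.

End NonIntegral.

(** * Embeddings and conjugates *)

Section Embeddings.
Variables (K : fieldExtType rat) (C : numClosedFieldType).
Local Notation qK := (map_poly (in_alg K)).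
Local Notation qC := (map_poly (ratr : rat -> C)).

Lemma exists_primitive : exists t : K, forall u, exists p, u = (qK p).[t].
Proof.
have pchar0 : [pchar K] =i pred0.
  by move=> p; apply/negP => /andP[/prime_gt0 p0]; rewrite num_field_natr_eq0 gtn_eqF.
have sep : separable 1 {:K}%AS.
  by apply/separableP => u _; apply: pcharf0_separable.
have gen := eq_adjoin_separable_generator sep (sub1v _).
exists (separable_generator 1 {:K}) => u; apply/Fadjoin1_polyP.
by rewrite -gen memvf.
Qed.

Lemma rmorph_horner_rat (s : {rmorphism K -> C}) (q : {poly rat}) (u : K) :
  s (qK q).[u] = (qC q).[s u].
Proof.
rewrite -horner_map -map_poly_comp; congr (_.[_]); apply: eq_map_poly => a /=.
by rewrite alg_num_field fmorph_rat.
Qed.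

Lemma annihilating_polynomial (u : K) :
  exists2 q : {poly rat}, q != 0 & (qK q).[u] = 0 /\ (size q <= (\dim {:K}).+1)%N.
Proof.
have [a [sum0 [i ai]]] := integer_relation (fun i : 'I_(\dim {:K}).+1 =>
  u ^+ i) (isT : prime 2) (ltnSn _).
exists (\poly_(i < (\dim {:K}).+1) (a (inord i))%:~R).
  apply/eqP => /polyP/(_ i); rewrite coef_poly ltn_ord coef0 inord_val => /eqP.
  by rewrite intr_eq0; apply: contraNnot ai => /eqP ->; rewrite dvdz0.
split; last exact: size_poly.
rewrite -[RHS]sum0 poly_def rmorph_sum horner_sum; apply: eq_bigr => j _ /=.
rewrite map_polyZ /= map_polyXn hornerZ hornerXn inord_val; congr (_ * _).
by rewrite scaler_int.
Qed.

Lemma exists_minimal_polynomial (u : K) :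
  exists2 m : {poly rat}, m != 0 & (qK m).[u] = 0 /\
    forall q, (qK q).[u] = 0 -> m %| q.
Proof.
pose P n := `[< exists q : {poly rat}, [/\ q != 0, (qK q).[u] = 0 & size q = n] >].
have exP : exists n, P n.
  have [q q0 [qu _]] := annihilating_polynomial u.
  by exists (size q); apply/asboolP; exists q.
case: (ex_minnP exP) => n /asboolP[m [m0 mu mn]] min_n.
exists m => //; split => // q qu; apply: contrapT => /negP nmq.
have : P (size (q %% m)).
  apply/asboolP; exists (q %% m); split => //.
  have := congr1 (fun f => (qK f).[u]) (divp_eq q m).
  by rewrite /= qu rmorphD rmorphM /= hornerD hornerM mu mulr0 add0r => <-.
by move=> /min_n; rewrite -mn leqNgt ltn_modp m0.
Qed.

Lemma exists_embedding (t : K) (z : C) :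
  (forall u, exists p, u = (qK p).[t]) ->
  (forall q, (qK q).[t] = 0 -> (qC q).[z] = 0) ->
  exists s : {rmorphism K -> C}, s t = z /\ forall p, s (qK p).[t] = (qC p).[z].
Proof.
move=> /choice[P PE] tz; pose s u := (qC (P u)).[z].
have sE p : s (qK p).[t] = (qC p).[z].
  apply/eqP; rewrite -subr_eq0 -hornerN -hornerD -rmorphB /=; apply/eqP; apply: tz.
  by rewrite rmorphB hornerD hornerN -PE subrr.
have sB : zmod_morphism s.
  move=> u v; rewrite [u in LHS]PE [v in LHS]PE -hornerN -hornerD -rmorphB sE.
  by rewrite rmorphB hornerD hornerN.
have sM : monoid_morphism s.
  split; last by move=> u v; rewrite [u in LHS]PE [v in LHS]PE -hornerM -rmorphM sE rmorphM hornerM.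
  by have := sE 1; rewrite !rmorph1 !hornerC.
pose sR : {rmorphism K -> C} := HB.pack s (GRing.isZmodMorphism.Build _ _ s sB)
  (GRing.isMonoidMorphism.Build _ _ s sM).
exists sR; split; last exact: sE.
by have := sE 'X; rewrite !map_polyX !hornerX.
Qed.

(* The resultant in X of the minimal polynomial m of a primitive element t and
   of p - Y, where y = p(t), vanishes at Y = y, hence at Y = z; so m and p - z have a
   common root. *)
Lemma embedding_root (y : K) (z : C) :
  (forall q, (qK q).[y] = 0 -> (qC q).[z] = 0) ->
  exists s : {rmorphism K -> C}, s y = z.
Proof.
move=> yz; have [t tP] := exists_primitive.
have [m m0 [mt mdiv]] := exists_minimal_polynomial t.
have size_qK q : size (qK q) = size q by rewrite size_map_poly.
have size_m : (1 < size m)%N.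
  rewrite ltnNge; apply/negP => /size1_polyC E; move: mt m0.
  rewrite E map_polyC hornerC /= => /eqP.
  by rewrite scaler_eq0 oner_eq0 orbF => /eqP ->; rewrite eqxx.
(* Adding m does not change the value at t. For p nonconstant the leading coefficient of p - Y in X
   is free of Y, so it survives every specialization of Y, as [map_resultant] requires. *)
have [p [yp size_p]] : exists p, y = (qK p).[t] /\ (1 < size p)%N.
  have [p yp] := tP y; have [p1|p1] := leqP (size p) 1; last by exists p.
  exists (p + m); split; first by rewrite rmorphD hornerD mt addr0.
  by rewrite addrC size_polyDl // (leq_ltn_trans p1).
(* X is the outer variable; Y is the variable of the coefficients. *)
pose m1 : {poly {poly rat}} := map_poly polyC m.
pose p1 : {poly {poly rat}} := map_poly polyC p - ('X)%:P.
have size_p1 : size p1 = size p.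
  by rewrite size_polyDl size_map_polyC // size_polyN (leq_ltn_trans (size_polyC_leq1 _)).
have lead_m1 : lead_coef m1 = (lead_coef m)%:P by rewrite lead_coef_map_inj //; exact: polyC_inj.
have lead_p1 : lead_coef p1 = (lead_coef p)%:P.
  rewrite lead_coefDl ?lead_coef_map_inj //; first exact: polyC_inj.
  by rewrite size_map_polyC size_polyN (leq_ltn_trans (size_polyC_leq1 _)).
pose N := resultant m1 p1.
have key (F : fieldType) (f : {rmorphism rat -> F}) (w : F) :
    (map_poly f N).[w] = resultant (map_poly f m) (map_poly f p - w%:P).
  pose g : {rmorphism {poly rat} -> F} := horner_morph (fun a => mulrC w (f a)).
  rewrite -[LHS]/(g N) /N map_resultant.
  - congr (resultant _ _); first by rewrite /m1 -map_poly_comp; apply: eq_map_poly => a /=;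
    rewrite /g horner_morphC.
    rewrite /p1 rmorphB /= map_polyC /=; congr (_ - _).
      by rewrite -map_poly_comp; apply: eq_map_poly => a /=; rewrite /g horner_morphC.
    by rewrite /g horner_morphX.
  - by rewrite lead_m1 /g /= horner_morphC fmorph_eq0 lead_coef_eq0.
  - rewrite lead_p1 /g /= horner_morphC fmorph_eq0 lead_coef_eq0.
    by rewrite -size_poly_gt0 ltnW.
have Ny : (qK N).[y] = 0.
  rewrite key; apply/eqP; rewrite resultant_eq0.
  have : 'X - t%:P %| gcdp (qK m) (qK p - y%:P).
    rewrite dvdp_gcd !dvdp_XsubCl /root mt eqxx /=.
    by rewrite hornerD hornerN hornerC -yp subrr.
  move=> /dvdp_leq; rewrite size_XsubC; apply.
  by rewrite gcdp_eq0 negb_and -size_poly_eq0 size_qK size_poly_eq0 m0.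
have /eqP := yz _ Ny.
rewrite key resultant_eq0 => g1.
have /closed_rootP[t'] : size (gcdp (qC m) (qC p - z%:P)) != 1%N by rewrite gtn_eqF.
rewrite root_gcd => /andP[mt' pt'].
have [|s [st sp]] := exists_embedding tP (z := t').
  move=> q /mdiv /dvdpP[r ->]; rewrite rmorphM hornerM.
  by rewrite (eqP mt') mulr0.
exists s; rewrite yp sp; move: pt'; rewrite /root hornerD hornerN hornerC subr_eq0.
by move=> /eqP.
Qed.

Lemma embedding_eq (t : K) (s s' : {rmorphism K -> C}) :
  (forall u, exists p, u = (qK p).[t]) -> s t = s' t -> (s : K -> C) = s'.
Proof.
by move=> tP E; apply/funext => u; have [p ->] := tP u; rewrite !rmorph_horner_rat E.
Qed.

Lemma embeddings_finite :
  finite_set (range (fun s : {rmorphism K -> C} => s : K -> C)) /\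
  (#|` fset_set (range (fun s : {rmorphism K -> C} => s : K -> C))| <= \dim {:K})%N.
Proof.
set S := range _; have [t tP] := exists_primitive.
have [q q0 [qt qD]] := annihilating_polynomial t.
have qC0 : qC q != 0 by rewrite map_poly_eq0.
have bound (B : {fset (K -> C)}) : [set` B] `<=` S -> (#|` B| <= \dim {:K})%N.
  move=> BS; have rootB (f : K -> C) : f \in B -> root (qC q) (f t).
    by move=> /BS[s _ <-]; rewrite /root -rmorph_horner_rat qt rmorph0.
  have inj : {in enum_fset B &, injective (fun f : K -> C => f t)}.
    move=> f g /BS[s _ <-] /BS[s' _ <-]; exact: embedding_eq.
  have := @max_poly_roots _ (qC q) [seq f t | f <- enum_fset B] qC0.
  rewrite size_map map_inj_in_uniq // fset_uniq size_map_poly => H.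
  rewrite -ltnS; apply: leq_trans qD; apply: H => //.
  by apply/allP => _ /mapP[f fB ->]; apply: rootB.
have fin : finite_set S.
  apply: contrapT => /(@infinite_set_fset _ _ (\dim {:K}).+1)[B /bound le lt].
  by have := leq_trans lt le; rewrite ltnn.
by split => //; apply: bound => f; rewrite /= in_fset_set // inE.
Qed.

End Embeddings.

(** * Conjugates and denominators of algebraic numbers *)

Section Houses.
Variable R : realType.
Local Notation C := (R[i]).
Local Notation normc := (@Normc.normc R).

Lemma complex_norm_ge0 (z : C) : 0 <= normc z.
Proof. by case: z => a b; exact: sqrtr_ge0. Qed.

Lemma complex_normD (x y : C) : normc (x + y) <= normc x + normc y.
Proof. exact: (@le_normcD R x y). Qed.

Lemma complex_normX (x : C) n : normc (x ^+ n) = normc x ^+ n.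
Proof.
by elim: n => [|n IH]; [rewrite !expr0 Normc.normc1|rewrite !exprS Normc.normcM IH].
Qed.

(** [algC] and [R[i]] are related only through rational polynomials; conjugacy so defined is
    independent of any number field containing y. *)
Definition conjugate (y : algC) (z : C) : Prop :=
  forall q : {poly rat}, root (map_poly ratr q) y -> root (map_poly ratr q) z.

Definition house_le (M : R) (y : algC) : Prop :=
  forall z, conjugate y z -> normc z <= M.

Lemma house_le_trans M M' y : M <= M' -> house_le M y -> house_le M' y.
Proof. by move=> MM' yM z /yM zM; apply: le_trans MM'. Qed.

Lemma exists_house (y : algC) : exists n : nat, house_le n%:R y.
Proof.
have [p [_ p_mon] pP] := minCpolyP y.
have p0 : map_poly ratr p != 0 :> {poly C} by rewrite map_poly_eq0 monic_neq0.
have [rs pE] := closed_field_poly_normal (map_poly ratr p : {poly C}).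
exists (\sum_(z <- rs) (Num.truncn (normc z)).+1)%N => z yz.
have : root (map_poly ratr p : {poly C}) z by apply: yz; rewrite pP.
rewrite pE rootZ ?lead_coef_eq0 // root_prod_XsubC => zrs.
apply: le_trans (ltW (truncnS_gt _)) _.
by rewrite ler_nat (big_rem z) //= leq_addr.
Qed.

Section NumberField.
Variables (K : fieldExtType rat) (iota : {rmorphism K -> algC}).

Lemma iota_horner (q : {poly rat}) u :
  iota (map_poly (in_alg K) q).[u] = (map_poly ratr q).[iota u].
Proof. exact: rmorph_horner_rat. Qed.

(** By [embedding_root] every conjugate of u is its image under an embedding of K. Sums and products
    can therefore be estimated embedding by embedding in a common field. *)
Lemma house_leP M u :
  house_le M (iota u) <-> forall s : {rmorphism K -> C}, normc (s u) <= M.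
Proof.
split=> H.
  move=> s; apply: H => q; rewrite /root -iota_horner -rmorph_horner_rat.
  by rewrite fmorph_eq0 => /eqP ->; rewrite rmorph0.
move=> z uz; have [q qu|s <- //] := embedding_root (y := u) (z := z).
by apply/eqP; apply: uz; rewrite /root -iota_horner qu rmorph0.
Qed.

Lemma int_integral_iota u : int_integral u <-> iota u \in Aint.
Proof.
have mapE (q : {poly int}) : map_poly iota (map_poly intr q) = map_poly intr q.
  by rewrite -map_poly_comp; apply: eq_map_poly => a /=; rewrite rmorph_int.
split=> [[q q_mon qu]|].
  apply: (@root_monic_Aint (map_poly intr q)).
  - by rewrite -mapE fmorph_root.
  - exact: monic_map.
  - by apply/polyOverP => i; rewrite coef_map rpred_int.
rewrite unfold_in => /floorpP[q qE]; exists q.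
  apply/monicP/eqP; rewrite -(eqr_int algC) -lead_coef_map_inj //; last exact: intr_inj.
  by rewrite -qE (monicP (minCpoly_monic _)).
by rewrite -(fmorph_root iota) mapE -qE root_minCpoly.
Qed.

End NumberField.

Lemma common_field2 (x y : algC) : exists (K : fieldExtType rat)
  (iota : {rmorphism K -> algC}) (a b : K), iota a = x /\ iota b = y.
Proof.
have [K [iota [s sE _]]] := num_field_exists [:: x; y].
by case: s sE => [|a [|b [|]]] // [<- <-]; exists K, iota, a, b.
Qed.

Lemma house_leD M M' x y : house_le M x -> house_le M' y -> house_le (M + M') (x + y).
Proof.
have [K [iota [a [b [<- <-]]]]] := common_field2 x y.
rewrite -rmorphD => /house_leP aM /house_leP bM; apply/house_leP => s.
by rewrite rmorphD; apply: le_trans (complex_normD _ _) _; apply: lerD.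
Qed.

Lemma house_leM M M' x y : house_le M x -> house_le M' y -> house_le (M * M') (x * y).
Proof.
have [K [iota [a [b [<- <-]]]]] := common_field2 x y.
rewrite -rmorphM => /house_leP aM /house_leP bM; apply/house_leP => s.
by rewrite rmorphM Normc.normcM; apply: ler_pM; rewrite ?complex_norm_ge0.
Qed.

Lemma house_le1 : house_le 1 1.
Proof.
have [K [iota _]] := num_field_exists [::]; rewrite -(rmorph1 iota).
by apply/house_leP => s; rewrite rmorph1 Normc.normc1.
Qed.

Lemma house_le0 : house_le 0 0.
Proof.
have [K [iota _]] := num_field_exists [::]; rewrite -(rmorph0 iota).
by apply/house_leP => s; rewrite rmorph0 Normc.normc0.
Qed.

Lemma house_leX M x n : house_le M x -> house_le (M ^+ n) (x ^+ n).
Proof.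
by move=> xM; elim: n => [|n IH]; rewrite ?expr0 ?exprS; [exact: house_le1|apply: house_leM].
Qed.

Lemma house_le_prod (I : Type) (r : seq I) (M : I -> R) (F : I -> algC) :
  (forall i, house_le (M i) (F i)) -> house_le (\prod_(i <- r) M i) (\prod_(i <- r) F i).
Proof. by move=> H; elim/big_rec2: _ => [|i a b _ ab]; [exact: house_le1|apply: house_leM]. Qed.

Lemma house_le_sum (I : eqType) (r : seq I) (M : I -> R) (F : I -> algC) :
  (forall i, i \in r -> house_le (M i) (F i)) ->
  house_le (\sum_(i <- r) M i) (\sum_(i <- r) F i).
Proof.
elim: r => [|i r IH] H; rewrite ?big_nil ?big_cons; first exact: house_le0.
apply: house_leD; first by apply: H; rewrite mem_head.
by apply: IH => j jr; apply: H; rewrite inE jr orbT.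
Qed.

Lemma exists_denominator (x : algC) : exists2 d : nat, (0 < d)%N & d%:R * x \in Aint.
Proof.
have [p [_ p_mon] pP] := minCpolyP x.
have [d [a [d0 aE]]] := common_denominator (fun i : 'I_(size p) => p`_i).
pose n := (size p).-1; have nE : size p = n.+1 by rewrite prednK // size_poly_gt0 monic_neq0.
have px : \sum_(i < size p) (ratr p`_i : algC) * x ^+ i = 0.
  have : root (map_poly ratr p) x by rewrite pP.
  rewrite /root horner_coef size_map_poly => /eqP px; rewrite -[RHS]px.
  by apply: eq_bigr => i _; rewrite coef_map.
have dx : d%:~R * x \in Aint.
  pose b (i : nat) : int := if insub i is Some j then a j else 0.
  have bE i : (i < size p)%N -> (b i)%:~R = d%:~R * p`_i :> rat.
    by move=> ip; rewrite /b insubT -(aE (Ordinal ip)).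
  have px2 : \sum_(i < n) (b i)%:~R * x ^+ i + d%:~R * x ^+ n = 0.
    transitivity (d%:~R * \sum_(i < size p) (ratr p`_i : algC) * x ^+ i); last by rewrite px mulr0.
    rewrite mulr_sumr nE big_ord_recr /=.
    have -> : p`_n = 1 by exact: (monicP p_mon).
    rewrite rmorph1 mul1r; congr (_ + _); apply: eq_bigr => i _.
    rewrite mulrA; congr (_ * _); rewrite -(rmorph_int (ratr : {rmorphism rat -> algC})).
    by rewrite bE ?rmorphM ?rmorph_int // nE ltnS ltnW.
  (* With b_i = d p_i, the equation d p(x) = 0 multiplied by d^(n-1) is monic and integral in d
     x. *)
  pose r : {poly algC} := 'X^n + \sum_(i < n) ((b i)%:~R * d%:~R ^+ (n.-1 - i)) *: 'X^i.
  apply: (@root_monic_Aint r); last 1 first.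
  - apply/polyOverP => i; rewrite /r coefD coefXn coef_sum.
    apply: rpredD; first exact: rpred_nat.
    apply: rpred_sum => j _; rewrite coefZ coefXn.
    by apply: rpredM; [apply: rpredM; [|apply: rpredX]; exact: rpred_int|exact: rpred_nat].
  - rewrite /root hornerD hornerXn horner_sum exprMn.
    have [n0|n0] := posnP n.
      have : (1 < size (map_poly ratr p : {poly algC}))%N.
        by apply: (root_size_gt1 (a := x)); rewrite ?map_poly_eq0 ?monic_neq0 // pP.
      by rewrite size_map_poly nE n0.
    apply/eqP; transitivity (d%:~R ^+ n.-1 * (\sum_(i < n) (b i)%:~R * x ^+ i +
      d%:~R * x ^+ n)); last by rewrite px2 mulr0.
    rewrite mulrDr mulrA -exprSr prednK // addrC mulr_sumr; congr (_ + _).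
    apply: eq_bigr => i _; rewrite hornerZ hornerXn exprMn.
    have {2}<- : (n.-1 - i + i)%N = n.-1 by rewrite subnK // -ltnS prednK.
    by rewrite exprD; ring.
  - apply/monicP; rewrite lead_coefDl ?lead_coefXn // size_polyXn ltnS.
    apply: (leq_trans (size_sum _ _ _)); apply/bigmax_leqP => i _.
    by rewrite (leq_trans (size_scale_leq _ _)) // size_polyXn.
exists `|d|%N; first by rewrite absz_gt0.
have -> : `|d|%N%:R = d%:~R * (-1) ^+ (d < 0)%R :> algC.
  case: (d) => k; first by rewrite ltNge /= mulr1.
  by rewrite NegzE /= rmorphN mulNr mulrN1 opprK.
by rewrite mulrAC rpredM // rpredX // rpredN rpred1.
Qed.

End Houses.

(** If v u were negative, the leading term of a monic integral equation would have strictly smaller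
    valuation than all others. *)
Lemma int_integral_vge (K : fieldExtType rat) (v : K -> int) (u : K) :
  finite_place v -> int_integral u -> vge v 0 u.
Proof.
move=> vP [q q_mon qu]; rewrite /vge; have [//|u0 /=] := eqVneq u 0.
rewrite leNgt; apply/negP => vu; pose n := (size q).-1.
have nE : size q = n.+1 by rewrite prednK // size_poly_gt0 monic_neq0.
have uE : u ^+ n = - \sum_(i < n) (q`_i)%:~R * u ^+ i.
  apply/eqP; rewrite -addr_eq0 addrC; move: qu; rewrite /root horner_coef.
  rewrite size_map_poly_id0; last by rewrite (monicP q_mon) oner_eq0.
  rewrite nE big_ord_recr /= coef_map /= -[q`_n]/(lead_coef q) (monicP q_mon) mul1r.
  by under eq_bigr do rewrite coef_map.
have : vge v (v u * n%:Z + 1) (u ^+ n).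
  rewrite uE vgeN //; apply: (vge_sum vP) => i _.
  rewrite -[X in vge v X _]add0r; apply: (vgeM vP); first exact: vge_int.
  rewrite /vge expf_eq0 (negPf u0) andbF /= placeX // mulrC.
  have := ltn_ord i; move: (nat_of_ord i) vu => j; move: (v u) => a a0 jn.
  have [k ->] : exists k, n = (j + k.+1)%N by exists (n - j.+1)%N; lia.
  by clear -a0; rewrite PoszD; nia.
rewrite /vge expf_eq0 (negPf u0) andbF /= placeX //; clear; move: (v u) => a; lia.
Qed.

Lemma common_field (s : seq algC) : exists (K : fieldExtType rat)
  (iota : {rmorphism K -> algC}), forall y, y \in s -> exists u, iota u = y.
Proof.
have [K [iota [t tE _]]] := num_field_exists s; exists K, iota => y.
by rewrite -tE => /mapP[u _ ->]; exists u.
Qed.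

(** The v-integers are moved into [algC], so that polynomials over [algC] can be evaluated inside a
    subring attached to v. *)
Definition vintegers (K : fieldExtType rat) (iota : {rmorphism K -> algC}) (v : K -> int) :
  set algC := [set y | exists2 u, iota u = y & vge v 0 u].

Lemma vintegers_subring (K : fieldExtType rat) (iota : {rmorphism K -> algC}) v :
  finite_place v -> subring_set (vintegers iota v).
Proof.
move=> vP; split.
- by exists 1; rewrite ?rmorph1 // /vge place1 // lexx orbT.
- move=> _ _ [a <- va] [b <- vb]; exists (a - b); first by rewrite rmorphB.
  exact: vgeB.
- move=> _ _ [a <- va] [b <- vb]; exists (a * b); first by rewrite rmorphM.
  by rewrite -[0]addr0; apply: vgeM.
Qed.

Lemma subring_mevalZ (S : set algC) n (x : 'I_n -> algC) (p : mpoly n algC) (c : algC) :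
  subring_set S -> (forall i, S (x i)) ->
  (forall m, m \in msupp p -> S (c * mcoeff m p)) -> S (c * meval x p).
Proof.
move=> Sr Sx Sp; rewrite mevalE mulr_sumr big_seq; apply: subring_sum => // m mp.
rewrite mulrA; apply: subring_setM => //; first exact: Sp.
apply: (big_ind S) => [||i _]; [exact: subring_set1|exact: subring_setM|exact: subring_setX].
Qed.

Section Sizes.
Variable R : realType.
Local Notation normc := (@Normc.normc R).

Lemma coef_bound (s : seq algC) :
  exists2 c : nat, (0 < c)%N & forall a, a \in s -> c%:R * a \in Aint /\ house_le (c%:R : R) a.
Proof.
elim: s => [|a s [c c0 cP]]; first by exists 1%N.
have [d d0 da] := exists_denominator a; have [n na] := exists_house R a.
exists (d * n.+1 * c)%N; first by rewrite !muln_gt0 d0 c0.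
move=> b; rewrite inE => /predU1P[->|/cP[cb hb]].
  split; last first.
    apply: house_le_trans na; rewrite ler_nat; apply: (@leq_trans n.+1) => //.
    by rewrite mulnAC leq_pmull // muln_gt0 d0.
  have -> : (d * n.+1 * c)%:R * a = (n.+1 * c)%:R * (d%:R * a).
    by rewrite -mulnA natrM mulrCA mulrA.
  by rewrite rpredM // Aint_Cnat // rpred_nat.
split; last by apply: house_le_trans hb; rewrite ler_nat leq_pmull // muln_gt0 d0.
by rewrite natrM -mulrA rpredM // Aint_Cnat // rpred_nat.
Qed.

Definition bounded_point (q : nat) (M : R) N (P : 'rV[algC]_N) : Prop :=
  forall i, q%:R * P 0 i \in Aint /\ house_le M (P 0 i).

Lemma meval_bound N (p : mpoly N algC) D : ((msize p).-1 <= D)%N ->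
  exists2 c : nat, (0 < c)%N & forall q M (P : 'rV[algC]_N), 1 <= M ->
    bounded_point q M P ->
    (c * q ^ D)%:R * meval (P 0) p \in Aint /\
    house_le (c%:R * M ^+ D) (meval (P 0) p).
Proof.
move=> pD; have [c c0 cP] := coef_bound [seq mcoeff m p | m <- msupp p].
(* The number of monomials comes from the triangle inequality; the successor keeps the constant
   positive for p = 0. *)
exists (c * (size (msupp p)).+1)%N; first by rewrite muln_gt0 c0.
move=> q M P M1 qM.
have mD m : m \in msupp p -> (mdeg m <= D)%N.
  by move=> mp; apply: leq_trans pD; have := msize_mdeg_lt mp; case: (msize p).
have cm m : m \in msupp p -> c%:R * mcoeff m p \in Aint /\ house_le (c%:R : R) (mcoeff m p).
  by move=> mp; apply: cP; apply/mapP; exists m.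
rewrite mevalE; split.
  rewrite mulr_sumr big_seq rpred_sum // => m mp.
  have -> : (c * (size (msupp p)).+1 * q ^ D)%:R *
      (mcoeff m p * \prod_(i < N) P 0 i ^+ m i) =
     ((size (msupp p)).+1 * q ^ (D - mdeg m))%:R * (c%:R * mcoeff m p) *
      \prod_(i < N) (q%:R * P 0 i) ^+ m i.
    have -> : \prod_(i < N) (q%:R * P 0 i) ^+ m i = (q ^ mdeg m)%:R * \prod_(i < N) P 0 i ^+ m i.
      under eq_bigr do rewrite exprMn; rewrite big_split /=; congr (_ * _).
      by rewrite prodrXr natrX mdegE.
    rewrite -{1}(subnK (mD m mp)) expnD !natrM; ring.
  have [cm1 _] := cm m mp; rewrite rpredM //; last first.
    by apply: rpred_prod => i _; apply: rpredX; have [] := qM i.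
  by rewrite rpredM // Aint_Cnat // rpred_nat.
apply: (@house_le_trans _ (\sum_(m <- msupp p) c%:R * M ^+ D)).
  rewrite big_const_seq count_predT iter_addr_0.
  have -> : c%:R * M ^+ D *+ size (msupp p) = (c * size (msupp p))%:R * M ^+ D.
    by rewrite natrM mulrAC mulr_natr.
  by apply: ler_wpM2r; [rewrite exprn_ge0 // (le_trans ler01)|rewrite ler_nat leq_pmul2l].
apply: house_le_sum => m mp; have [_ cm2] := cm m mp; apply: house_leM => //.
apply: (@house_le_trans _ (\prod_(i < N) M ^+ m i)).
  by rewrite prodrXr -mdegE ler_weXn2l // mD.
by apply: house_le_prod => i; apply: house_leX; have [] := qM i.
Qed.

Lemma aff_eval_bound N (f : affmap N) D : (aff_maxdeg f <= D)%N ->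
  exists2 c : nat, (0 < c)%N & forall q M (P : 'rV[algC]_N), 1 <= M ->
    bounded_point q M P -> bounded_point (c * q ^ D) (c%:R * M ^+ D) (aff_eval f P).
Proof.
move=> fD.
have /choice[c cP] : forall i : 'I_N, exists c : nat,
  (0 < c)%N /\ forall q M (P : 'rV[algC]_N), 1 <= M ->
    bounded_point q M P ->
    (c * q ^ D)%:R * meval (P 0) (tnth f i) \in Aint /\
    house_le (c%:R * M ^+ D) (meval (P 0) (tnth f i)).
  move=> i; have [|c c0 cP] := @meval_bound N (tnth f i) D; last by exists c.
  by apply: leq_trans fD; exact: (leq_bigmax (F := fun i => (msize (tnth f i)).-1)).
exists (\prod_i c i)%N; first by apply: prodn_gt0 => i; have [] := cP i.
move=> q M P M1 qM i; have [ci0 /(_ q M P M1 qM)[H1 H2]] := cP i; rewrite mxE.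
split; last first.
  apply: house_le_trans H2; apply: ler_wpM2r; first by rewrite exprn_ge0 // (le_trans ler01).
  rewrite ler_nat (bigD1 i) //= leq_pmulr // prodn_gt0 // => j; by have [] := cP j.
rewrite (bigD1 i) //= [(c i * _)%N]mulnC -mulnA natrM -mulrA rpredM //.
by rewrite Aint_Cnat // rpred_nat.
Qed.

End Sizes.

(** * Points of disjoint indeterminacy *)

Lemma regular_identity_alg1 (A : comNzRingType) (x a xi e : A) :
  x * (a * (xi * e)) = (x * xi) * (a * e).
Proof. by ring. Qed.

Lemma regular_identity_alg2 (A : comNzRingType) (x a xi xj e : A) :
  x * (a * (xj * xi * e)) = (x * xi) * (a * e * xj).
Proof. by ring. Qed.

Section Projective.
Variable N : nat.
Implicit Types (f g : affmap N) (P : 'rV[algC]_N).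

Lemma meval_homogenize d (p : mpoly N algC) (y : 'I_N.+1 -> algC) :
  meval y (homogenize d p) = \sum_(m <- msupp p) mcoeff m p *
    (y ord0 ^+ (d - mdeg m) * \prod_i y (lift ord0 i) ^+ m i).
Proof.
rewrite /homogenize rmorph_sum; apply: eq_bigr => m _ /=.
rewrite mevalZ mevalX; congr (_ * _); rewrite big_ord_recl; congr (_ * _).
  by rewrite multinomE tnth_mktuple unlift_none.
by apply: eq_bigr => i _; rewrite multinomE tnth_mktuple liftK.
Qed.

Lemma meval_homogenizeZ d (p : mpoly N algC) (y : 'I_N.+1 -> algC) (l : algC) :
  ((msize p).-1 <= d)%N ->
  meval (fun j => l * y j) (homogenize d p) = l ^+ d * meval y (homogenize d p).
Proof.
move=> pd; rewrite !meval_homogenize mulr_sumr big_seq [RHS]big_seq.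
apply: eq_bigr => m mp; rewrite exprMn.
have md : (mdeg m <= d)%N.
  by apply: leq_trans pd; have := msize_mdeg_lt mp; case: (msize p).
under eq_bigr do rewrite exprMn.
have -> : l ^+ d = l ^+ (d - mdeg m) * l ^+ mdeg m by rewrite -exprD subnK.
by rewrite big_split /= prodrXr -mdegE; ring.
Qed.

Definition proj_point P (j : 'I_N.+1) : algC :=
  if unlift ord0 j is Some i then P 0 i else 1.

Lemma proj_point0 P : proj_point P ord0 = 1.
Proof. by rewrite /proj_point unlift_none. Qed.

Lemma proj_pointS P i : proj_point P (lift ord0 i) = P 0 i.
Proof. by rewrite /proj_point liftK. Qed.

Lemma meval_homogenize_proj d (p : mpoly N algC) P :
  meval (proj_point P) (homogenize d p) = meval (P 0) p.
Proof.
rewrite meval_homogenize mevalE; apply: eq_bigr => m _; rewrite proj_point0 expr1n mul1r.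
by congr (_ * _); apply: eq_bigr => i _; rewrite proj_pointS.
Qed.

Lemma ext_coord_proj f P j :
  meval (proj_point P) (ext_coord f j) = proj_point (aff_eval f P) j.
Proof.
rewrite meval_homogenize_proj /proj_point; case: unliftP => [i _|_].
  by rewrite mxE.
by rewrite meval1.
Qed.

Lemma ext_coordZ f (y : 'I_N.+1 -> algC) l j :
  meval (fun j => l * y j) (ext_coord f j) = l ^+ aff_maxdeg f * meval y (ext_coord f j).
Proof.
apply: meval_homogenizeZ; case: (unlift _ _) => [i|]; last by rewrite msize1.
exact: (leq_bigmax (F := fun i => (msize (tnth f i)).-1)).
Qed.

(** A common zero of X_k - 1 and of all homogeneous coordinates of f and g would be a nonzero vector
    in both indeterminacy loci. So 1 is a combination of these polynomials, and on x_k = 1 the term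
    of X_k - 1 drops out. *)
Lemma regular_certificate f g :
  indeterminacy (extension f) `&` indeterminacy (extension g) = set0 ->
  exists a b : 'I_N.+1 -> 'I_N.+1 -> mpoly N.+1 algC,
    forall k (x : 'I_N.+1 -> algC), x k = 1 ->
    \sum_j meval x (a k j) * meval x (ext_coord f j) +
    \sum_j meval x (b k j) * meval x (ext_coord g j) = 1.
Proof.
move=> fg0.
have H k : exists ab : ('I_N.+1 -> mpoly N.+1 algC) * ('I_N.+1 -> mpoly N.+1 algC),
    forall (x : 'I_N.+1 -> algC), x k = 1 ->
    \sum_j meval x (ab.1 j) * meval x (ext_coord f j) +
    \sum_j meval x (ab.2 j) * meval x (ext_coord g j) = 1.
  pose h (i : 'I_N.+1 + 'I_N.+1 + unit) := match i with
    | inl (inl j) => ext_coord f j | inl (inr j) => ext_coord g j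
    | inr _ => mpolyX algC (mnm1 k) - 1 end.
  have [x|c cE] := @nullstellensatz _ _ _ h.
    apply: contrapT => H.
    have hx i : meval (x 0) (h i) = 0.
      by apply/eqP; apply: contrapT => /negP hi; apply: H; exists i.
    have := hx (inr tt); rewrite /= mevalB meval1 mevalXU => /eqP; rewrite subr_eq0 => /eqP xk.
    have x0 : x != 0.
      by apply/eqP => x0; move/eqP: xk; rewrite x0 mxE eq_sym oner_eq0.
    suff : (indeterminacy (extension f) `&` indeterminacy (extension g)) x by rewrite fg0.
    by split; split=> // j; [exact: (hx (inl (inl j)))|exact: (hx (inl (inr j)))].
  exists (fun j => c (inl (inl j)), fun j => c (inl (inr j))) => x xk /=.
  have := congr1 (meval x) cE; rewrite meval1 => <-.
  rewrite rmorph_sum /= !big_sumType /=.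
  have -> : \sum_(i : unit) meval x (c (inr i) * (mpolyX algC (mnm1 k) - 1)) = 0.
    by rewrite big1 // => i _; rewrite mevalM mevalB meval1 mevalXU xk subrr mulr0.
  by rewrite addr0; congr (_ + _); apply: eq_bigr => j _; rewrite mevalM.
have /choice[ab abP] := H.
by exists (fun k => (ab k).1), (fun k => (ab k).2).
Qed.

(** The relation on the chart, taken at X / X_k and multiplied by X_k to the degree of f. By
    homogeneity the terms of g keep a power of X_k^-1, whose exponent is the difference of the
    degrees; it is harmless when X_k is a largest coordinate. *)
Lemma regular_identity f g (a b : 'I_N.+1 -> mpoly N.+1 algC) k (X : 'I_N.+1 -> algC) :
  (aff_maxdeg f <= aff_maxdeg g)%N -> X k != 0 ->
  (forall x : 'I_N.+1 -> algC, x k = 1 ->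
    \sum_j meval x (a j) * meval x (ext_coord f j) +
    \sum_j meval x (b j) * meval x (ext_coord g j) = 1) ->
  X k ^+ aff_maxdeg f =
    \sum_j meval (fun j => (X k)^-1 * X j) (a j) * meval X (ext_coord f j) +
    (\sum_j meval (fun j => (X k)^-1 * X j) (b j) * meval X (ext_coord g j)) *
      (X k)^-1 ^+ (aff_maxdeg g - aff_maxdeg f).
Proof.
move=> fg Xk ab; set x := (fun j : 'I_N.+1 => (X k)^-1 * X j).
have := ab x; rewrite {1}/x mulVf // => /(_ erefl).
under eq_bigr do rewrite ext_coordZ; under [X in _ + X]eq_bigr do rewrite ext_coordZ.
set F := fun j => meval X (ext_coord f j); set G := fun j => meval X (ext_coord g j).
move=> /(congr1 (fun z => X k ^+ aff_maxdeg f * z)); rewrite mulr1 => <-.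
have XV n : X k ^+ n * (X k)^-1 ^+ n = 1 by rewrite -exprMn mulfV // expr1n.
rewrite mulrDr !mulr_sumr mulr_suml; congr (_ + _); apply: eq_bigr => j _.
  by rewrite regular_identity_alg1 XV mul1r.
by rewrite -{1}(subnK fg) exprD regular_identity_alg2 XV mul1r.
Qed.

End Projective.

Section LocalBounds.
Variables (R : realType) (K : fieldExtType rat) (iota : {rmorphism K -> algC}).
Local Notation normc := (@Normc.normc R).

Lemma Aint_vintegers v u : finite_place v -> iota u \in Aint -> vintegers iota v (iota u).
Proof.
by move=> vP /int_integral_iota uint; exists u => //; exact: int_integral_vge.
Qed.

(** Integrality is a local property because a non-integral element has a pole at some finite
    place. *)
Lemma vintegers_Aint u : (forall v, finite_place v -> vintegers iota v (iota u)) ->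
  iota u \in Aint.
Proof.
move=> H; apply/int_integral_iota; apply: contrapT => /not_integral_place[v vP vu].
have [w /fmorph_inj -> ] := H v vP; rewrite /vge leNgt vu orbF => /eqP u0.
by move: vu; rewrite u0; have [-> _ _ _] := vP; rewrite ltxx.
Qed.

Section Embedding.
Variable s : {rmorphism K -> R[i]}.

Definition norm_le (M : R) (y : algC) : Prop := exists2 u, iota u = y & normc (s u) <= M.

Lemma norm_leD M M' x y : norm_le M x -> norm_le M' y -> norm_le (M + M') (x + y).
Proof.
move=> [a <- aM] [b <- bM]; exists (a + b); rewrite rmorphD //.
by apply: le_trans (complex_normD _ _) _; apply: lerD.
Qed.

Lemma norm_leM M M' x y : norm_le M x -> norm_le M' y -> norm_le (M * M') (x * y).
Proof.
move=> [a <- aM] [b <- bM]; exists (a * b); rewrite rmorphM // Normc.normcM.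
by apply: ler_pM; rewrite ?complex_norm_ge0.
Qed.

Lemma norm_le_trans M M' x : M <= M' -> norm_le M x -> norm_le M' x.
Proof. by move=> MM' [u <- uM]; exists u => //; apply: le_trans MM'. Qed.

Lemma norm_leX x n : norm_le 1 x -> norm_le 1 (x ^+ n).
Proof.
move=> x1; elim: n => [|n IH]; last by rewrite exprS -[1]mulr1; apply: norm_leM.
by exists 1; rewrite ?rmorph1 // Normc.normc1.
Qed.

Lemma norm_le_sum (I : eqType) (r : seq I) (M : R) (F : I -> algC) :
  (forall i, i \in r -> norm_le M (F i)) -> norm_le ((size r)%:R * M) (\sum_(i <- r) F i).
Proof.
elim: r => [_|i r IH H]; rewrite ?big_nil ?big_cons.
  by exists 0; rewrite ?rmorph0 // Normc.normc0 mul0r.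
rewrite /= -natr1 mulrDl mul1r addrC; apply: norm_leD.
  by apply: H; rewrite mem_head.
by apply: IH => j jr; apply: H; rewrite inE jr orbT.
Qed.

Lemma norm_le_sumT (I : finType) (M : R) (F : I -> algC) :
  (forall i, norm_le M (F i)) -> norm_le (#|I|%:R * M) (\sum_i F i).
Proof. by move=> H; rewrite -big_enum cardE; apply: norm_le_sum. Qed.

Lemma norm_le_meval n (x : 'I_n -> algC) (p : mpoly n algC) c :
  (forall i, norm_le 1 (x i)) -> (forall m, m \in msupp p -> norm_le c (mcoeff m p)) ->
  norm_le ((size (msupp p))%:R * c) (meval x p).
Proof.
move=> x1 pc; rewrite mevalE; apply: norm_le_sum => m mp.
rewrite -[c]mulr1; apply: norm_leM; first exact: pc.
apply: (big_ind (norm_le 1)) => [|y z y1 z1|i _]; last exact: norm_leX.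
  by exists 1; rewrite ?rmorph1 // Normc.normc1.
by rewrite -[1]mulr1; apply: norm_leM.
Qed.

Lemma house_le_norm_le M u : house_le M (iota u) -> norm_le M (iota u).
Proof. by move=> /house_leP uM; exists u. Qed.

End Embedding.

Lemma norm_le_house M u : (forall s, norm_le s M (iota u)) -> house_le M (iota u).
Proof. by move=> H; apply/house_leP => s; have [w /fmorph_inj ->] := H s. Qed.

End LocalBounds.

Lemma exists_min_place (K : fieldExtType rat) (v : K -> int) n (x : 'I_n.+1 -> K) :
  finite_place v -> x ord0 = 1 ->
  exists2 k, x k != 0 & forall j, vge v 0 ((x k)^-1 * x j).
Proof.
move=> vP x0; have nz : x ord0 != 0 by rewrite x0 oner_neq0.
case: (@arg_minP _ int _ ord0 (fun j => x j != 0) (fun j => v (x j)) nz) => k xk mink.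
exists k => // j; rewrite /vge mulf_eq0 invr_eq0 (negPf xk) /=.
have [//|xj /=] := eqVneq (x j) 0.
by rewrite placeM ?invr_eq0 // placeV // addrC subr_ge0 mink.
Qed.

Lemma exists_max_norm (R : realType) (K : fieldExtType rat) (s : {rmorphism K -> R[i]})
    n (x : 'I_n.+1 -> K) : x ord0 = 1 ->
  exists2 k, x k != 0 & forall j, Normc.normc (s ((x k)^-1 * x j)) <= 1.
Proof.
move=> x0.
case: (@arg_maxP _ R _ (ord0 : 'I_n.+1) predT (fun j => Normc.normc (s (x j))) isT) => k _ maxk.
have k1 : 1 <= Normc.normc (s (x k)).
  by apply: le_trans (maxk ord0 isT); rewrite x0 rmorph1 Normc.normc1.
have xk : x k != 0.
  by apply/eqP => xk; move: k1; rewrite xk rmorph0 Normc.normc0 ler10.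
exists k => // j; rewrite rmorphM fmorphV Normc.normcM Normc.normcV.
rewrite mulrC ler_pdivrMr ?mul1r; [exact: maxk j isT|exact: lt_le_trans ltr01 k1].
Qed.

Lemma regular_lower_alg1 (A : comNzRingType) (c1 c0 qy qz : nat) (x y : A) :
  (c1 * c0 * qy * qz)%:R * (x * y) = (c1 * qy)%:R * ((c0%:R * x) * (qz%:R * y)).
Proof. by rewrite !natrM; ring. Qed.

Lemma regular_lower_alg2 (A : comNzRingType) (c1 c0 qy qz : nat) (x y : A) :
  (c1 * c0 * qy * qz)%:R * (x * y) = (c1 * qz)%:R * ((c0%:R * x) * (qy%:R * y)).
Proof. by rewrite !natrM; ring. Qed.

Section RegularLowerBound.
Variables (R : realType) (N : nat).

Lemma proj_point_Aint (q : nat) (M : R) (P : 'rV[algC]_N) j :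
  bounded_point q M P -> q%:R * proj_point P j \in Aint.
Proof.
move=> qM; rewrite /proj_point; case: (unlift _ _) => [i|]; first by have [] := qM i.
by rewrite mulr1 Aint_Cnat // rpred_nat.
Qed.

Lemma proj_point_house (q : nat) (M : R) (P : 'rV[algC]_N) j :
  1 <= M -> bounded_point q M P -> house_le M (proj_point P j).
Proof.
move=> M1 qM; rewrite /proj_point; case: (unlift _ _) => [i|]; first by have [] := qM i.
by apply: house_le_trans M1 _; exact: house_le1.
Qed.

(** At each place let k be a coordinate of largest absolute value of (1, P). The ratios to it, among
    them its inverse, are bounded by 1, so [regular_identity] bounds its power, and with it that of
    every coordinate. The coefficient polynomials do not depend on P; c collects their denominators,
    their conjugates and the numbers of terms. *)
Lemma regular_lower_bound (f g : affmap N) :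
  indeterminacy (extension f) `&` indeterminacy (extension g) = set0 ->
  (aff_maxdeg f <= aff_maxdeg g)%N ->
  exists2 c : nat, (0 < c)%N & forall (P : 'rV[algC]_N) qy qz (My Mz : R),
    1 <= My -> 1 <= Mz ->
    bounded_point qy My (aff_eval f P) -> bounded_point qz Mz (aff_eval g P) ->
    forall i, (c * qy * qz)%:R * P 0 i ^+ aff_maxdeg f \in Aint /\
      house_le (c%:R * (My + Mz)) (P 0 i ^+ aff_maxdeg f).
Proof.
move=> fg0 fg; have [a [b ab]] := regular_certificate fg0.
pose I := ('I_N.+1 * 'I_N.+1)%type.
pose ms (p : mpoly N.+1 algC) := [seq mcoeff m p | m <- msupp p].
pose s := flatten [seq ms (a i.1 i.2) ++ ms (b i.1 i.2) | i <- enum {: I}].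
have sa k j m : m \in msupp (a k j) -> mcoeff m (a k j) \in s.
  move=> mp; apply/flattenP; exists (ms (a k j) ++ ms (b k j)).
    by apply/mapP; exists (k, j); rewrite ?mem_enum.
  by rewrite mem_cat; apply/orP; left; apply/mapP; exists m.
have sb k j m : m \in msupp (b k j) -> mcoeff m (b k j) \in s.
  move=> mp; apply/flattenP; exists (ms (a k j) ++ ms (b k j)).
    by apply/mapP; exists (k, j); rewrite ?mem_enum.
  by rewrite mem_cat; apply/orP; right; apply/mapP; exists m.
have [c0 c0_gt0 c0P] := coef_bound R s.
pose T := (\sum_(i : I) (size (msupp (a i.1 i.2)) + size (msupp (b i.1 i.2))))%N.
have Ta k j : (size (msupp (a k j)) <= T)%N.
  by rewrite /T (bigD1 (k, j)) //= -addnA leq_addr.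
have Tb k j : (size (msupp (b k j)) <= T)%N.
  by rewrite /T (bigD1 (k, j)) //= -addnA addnCA leq_addr.
(* Each half of the identity has N.+1 summands, whose coefficient polynomials have at most T
   monomials; T.+1 keeps the constant positive. *)
pose c1 := (N.+1 * T.+1)%N.
exists (c1 * c0)%N; first by rewrite !muln_gt0.
move=> P qy qz My Mz My1 Mz1 Yb Zb i.
set D := aff_maxdeg f; set Y := aff_eval f P; set Z := aff_eval g P.
(* K depends on P, but c has already been fixed. *)
have [K [iota inK]] := common_field (s ++ [seq P 0 i | i : 'I_N] ++ [seq Y 0 i | i : 'I_N] ++
  [seq Z 0 i | i : 'I_N]).
have ins y : y \in s -> exists u, iota u = y by move=> ys; apply: inK; rewrite mem_cat ys.
have inQ (Q : 'rV[algC]_N) l : Q 0 l \in [seq Q 0 i | i : 'I_N] by apply: map_f; rewrite mem_enum.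
have inproj (Q : 'rV[algC]_N) : (forall i, exists u, iota u = Q 0 i) -> forall j, exists u,
  iota u = proj_point Q j.
  move=> HQ j; rewrite /proj_point; case: (unlift _ _) => [l|]; first exact: HQ.
  by exists 1; rewrite rmorph1.
have /choice[x xE] : forall j, exists u, iota u = proj_point P j.
  by apply: inproj => l; apply: inK; rewrite !mem_cat inQ ?orbT.
have /choice[y yE] : forall j, exists u, iota u = proj_point Y j.
  by apply: inproj => l; apply: inK; rewrite !mem_cat inQ ?orbT.
have /choice[z zE] : forall j, exists u, iota u = proj_point Z j.
  by apply: inproj => l; apply: inK; rewrite !mem_cat inQ ?orbT.
have x0 : x ord0 = 1 by apply: (fmorph_inj iota); rewrite xE proj_point0 rmorph1.
have PE : P 0 i = iota (x (lift ord0 i)) by rewrite xE proj_pointS.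
have Xk0 k : x k != 0 -> proj_point P k != 0 by rewrite -xE fmorph_eq0.
have ident k (xk : x k != 0) := regular_identity (X := proj_point P) (k := k) fg
  (Xk0 k xk) (ab k).
have x'E k j : (proj_point P k)^-1 * proj_point P j = iota ((x k)^-1 * x j).
  by rewrite rmorphM fmorphV !xE.
have PkE k : x k != 0 -> P 0 i = proj_point P k * iota ((x k)^-1 * x (lift ord0 i)).
  by move=> xk; rewrite PE -(xE k) -rmorphM mulrA mulfV // mul1r.
have xkV k : (proj_point P k)^-1 = iota ((x k)^-1 * x ord0).
  by rewrite -x'E proj_point0 mulr1.
split.
  have -> : (c1 * c0 * qy * qz)%:R * P 0 i ^+ D =
    iota ((c1 * c0 * qy * qz)%:R * x (lift ord0 i) ^+ D).
    by rewrite rmorphM rmorph_nat rmorphXn PE.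
  apply: vintegers_Aint => v vP.
  have Sr := vintegers_subring iota vP.
  have [k xk mink] := exists_min_place vP x0.
  have Sx' j : vintegers iota v ((proj_point P k)^-1 * proj_point P j).
    by rewrite x'E; exists ((x k)^-1 * x j).
  have Snat n : vintegers iota v n%:R by exact: (subring_int Sr n).
  rewrite rmorphM rmorph_nat rmorphXn -PE (PkE _ xk) exprMn mulrA.
  apply: (subring_setM Sr); last by apply: (subring_setX Sr); rewrite -x'E; exact: Sx'.
  rewrite ident // mulrDr mulrA.
  have Sab (p : mpoly N.+1 algC) : (forall m, m \in msupp p -> mcoeff m p \in s) ->
      vintegers iota v (c0%:R * meval (fun j => (proj_point P k)^-1 * proj_point P j) p).
    move=> ps; apply: subring_mevalZ => // m /ps ms'; have [u uE] := ins _ ms'.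
    have -> : c0%:R * mcoeff m p = iota (c0%:R * u) by rewrite rmorphM rmorph_nat uE.
    by apply: Aint_vintegers => //; rewrite rmorphM rmorph_nat uE; have [] := c0P _ ms'.
  apply: (subring_setD Sr); last first.
    apply: (subring_setM Sr); last by apply: (subring_setX Sr); rewrite xkV -x'E.
    rewrite mulr_sumr; apply: (subring_sum Sr) => j _; rewrite ext_coord_proj.
    rewrite regular_lower_alg1.
    apply: (subring_setM Sr) => //; apply: (subring_setM Sr); first by apply: Sab => m /sb.
    have -> : qz%:R * proj_point (aff_eval g P) j = iota (qz%:R * z j) by rewrite rmorphM
      rmorph_nat zE.
    by apply: Aint_vintegers => //; rewrite rmorphM rmorph_nat zE; exact: proj_point_Aint Zb.
  rewrite mulr_sumr; apply: (subring_sum Sr) => j _; rewrite ext_coord_proj.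
  rewrite regular_lower_alg2.
  apply: (subring_setM Sr) => //; apply: (subring_setM Sr); first by apply: Sab => m /sa.
  have -> : qy%:R * proj_point (aff_eval f P) j = iota (qy%:R * y j) by rewrite rmorphM
    rmorph_nat yE.
  by apply: Aint_vintegers => //; rewrite rmorphM rmorph_nat yE; exact: proj_point_Aint Yb.
have -> : P 0 i ^+ D = iota (x (lift ord0 i) ^+ D) by rewrite rmorphXn PE.
apply: norm_le_house => t; rewrite rmorphXn -PE.
have [k xk maxk] := exists_max_norm t x0.
have Sx' j : norm_le iota t 1 ((proj_point P k)^-1 * proj_point P j).
  by rewrite x'E; exists ((x k)^-1 * x j).
have Sab (p : mpoly N.+1 algC) : (size (msupp p) <= T)%N ->
    (forall m, m \in msupp p -> mcoeff m p \in s) ->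
    norm_le iota t (T%:R * c0%:R) (meval (fun j => (proj_point P k)^-1 * proj_point P j) p).
  move=> pT ps; apply: (@norm_le_trans _ _ _ _ ((size (msupp p))%:R * c0%:R)).
    by rewrite ler_wpM2r ?ler_nat.
  apply: norm_le_meval => // m /ps ms'; have [u uE] := ins _ ms'.
  by rewrite -uE; apply: house_le_norm_le; rewrite uE; have [] := c0P _ ms'.
have Ysum (M : R) (w : 'I_N.+1 -> K) (Q : 'rV[algC]_N) (p : 'I_N.+1 -> mpoly N.+1 algC) :
    1 <= M -> (forall j, iota (w j) = proj_point Q j) -> (exists q, bounded_point q M Q) ->
    (forall j, (size (msupp (p j)) <= T)%N /\ forall m,
      m \in msupp (p j) -> mcoeff m (p j) \in s) ->
    norm_le iota t (N.+1%:R * (T%:R * c0%:R * M))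
     (\sum_j meval (fun j => (proj_point P k)^-1 * proj_point P j) (p j) * proj_point Q j).
  move=> M1 wE [q qM] pP.
  have -> : N.+1%:R = #|'I_N.+1|%:R :> R by rewrite card_ord.
  apply: norm_le_sumT => j; have [p1 p2] := pP j.
  apply: norm_leM; first exact: Sab.
  by rewrite -wE; apply: house_le_norm_le; rewrite wE; apply: proj_point_house M1 qM.
rewrite (PkE _ xk) exprMn -[_ * (My + _)]mulr1.
apply: norm_leM; last by apply: norm_leX; rewrite -x'E.
rewrite ident //.
under eq_bigr do rewrite ext_coord_proj; under [X in _ + X * _]eq_bigr do rewrite ext_coord_proj.
apply: (@norm_le_trans _ _ _ _ (N.+1%:R * (T%:R * c0%:R * My) + N.+1%:R * (T%:R * c0%:R * Mz) * 1)).
  have -> : N.+1%:R * (T%:R * c0%:R * My) + N.+1%:R * (T%:R * c0%:R * Mz) * 1 =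
     (N.+1 * T * c0)%:R * (My + Mz) by rewrite !natrM; ring.
  rewrite ler_wpM2r ?addr_ge0 ?(le_trans ler01) // ler_nat leq_pmul2r //.
  by rewrite leq_pmul2l.
apply: norm_leD.
  by apply: (Ysum _ y) => //; [exists qy|move=> j; split => // m /sa].
apply: norm_leM; last by apply: norm_leX; rewrite xkV -x'E.
by apply: (Ysum _ z) => //; [exists qz|move=> j; split => // m /sb].
Qed.

End RegularLowerBound.

(** * Denominators of roots *)

Lemma logn_prod_primes (Q : nat) (k : nat -> nat) p : p \in primes Q ->
  (k p <= logn p (\prod_(l <- primes Q) l ^ k l))%N.
Proof.
move=> pQ; have p_pr : prime p by move: pQ; rewrite mem_primes => /andP[].
have prod_gt0 : (0 < \prod_(l <- primes Q) l ^ k l)%N.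
  rewrite big_seq; apply: (big_ind (fun m => (0 < m)%N)) => // [m n m0 n0|l].
    by rewrite muln_gt0 m0.
  by rewrite mem_primes => /andP[/prime_gt0 l0 _]; rewrite expn_gt0 l0.
by rewrite -pfactor_dvdn // (big_rem p) //= dvdn_mulr.
Qed.

Lemma prod_primes_gt0 (Q : nat) (k : nat -> nat) : (0 < \prod_(l <- primes Q) l ^ k l)%N.
Proof.
rewrite big_seq; apply: (big_ind (fun m => (0 < m)%N)) => // [m n m0 n0|l].
  by rewrite muln_gt0 m0.
by rewrite mem_primes => /andP[/prime_gt0 l0 _]; rewrite expn_gt0 l0.
Qed.

Lemma prod_primes_logn (Q : nat) : (0 < Q)%N -> Q = (\prod_(l <- primes Q) l ^ logn l Q)%N.
Proof. by move=> Q0; rewrite {1}(prod_prime_decomp Q0) prime_decompE big_map. Qed.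

Section RootDenominator.
Variable K : fieldExtType rat.

(* At a finite place |u| <= |Q|^(-1/D); as valuations of K are integers and the
   ramification is at most the degree of K, most prime factors of Q may be dropped. *)
Lemma root_denominator (Q D : nat) : (0 < Q)%N -> (0 < D)%N ->
  exists r, [/\ (0 < r)%N, (r ^ D <= Q ^ \dim {:K})%N &
    forall u : K, int_integral (Q%:R * u ^+ D) -> int_integral (r%:R * u)].
Proof.
move=> Q0 D0; set d := \dim {:K}; pose k p := (d * logn p Q %/ D)%N.
exists (\prod_(p <- primes Q) p ^ k p)%N; split; first exact: prod_primes_gt0.
  have expn_big (s : seq nat) (F : nat -> nat) m : ((\prod_(p <- s) F p) ^ m = \prod_(p <- s) F
    p ^ m)%N.
    by elim: s => [|p s IH]; rewrite ?big_nil ?exp1n // !big_cons expnMn IH.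
  rewrite expn_big [in leqRHS](prod_primes_logn Q0) expn_big big_seq [leqRHS]big_seq.
  apply: leq_prod => p; rewrite mem_primes => /andP[p_pr _].
  by rewrite -!expnM leq_exp2l ?prime_gt1 // [leqRHS]mulnC leq_trunc_div.
move=> u Qu; apply: contrapT => /not_integral_place[v vP].
set r := (\prod_(p <- primes Q) p ^ k p)%N.
have r0 : (0 < r)%N by exact: prod_primes_gt0.
have [->|u0] := eqVneq u 0; first by rewrite mulr0; have [-> _ _ _] := vP; rewrite ltxx.
have rK : r%:R != 0 :> K by rewrite num_field_natr_eq0 -lt0n.
have QK : Q%:R != 0 :> K by rewrite num_field_natr_eq0 -lt0n.
rewrite placeM //; have := int_integral_vge vP Qu.
rewrite /vge mulf_eq0 (negPf QK) expf_eq0 (negPf u0) andbF /= placeM ?expf_neq0 // placeX //.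
have [p p_pr vp] := place_residue_char vP.
have e_le := place_ramification vP p_pr vp.
rewrite (place_natr vP p_pr vp Q0) (place_natr vP p_pr vp r0) => H.
have kr : (k p <= logn p r)%N.
  have [pQ|pQ] := boolP (p \in primes Q); first exact: logn_prod_primes.
  by rewrite /k (_ : logn p Q = 0%N) ?muln0 ?div0n //; apply/eqP; rewrite -leqn0 leqNgt logn_gt0.
move: H kr (ltn_ceil (d * logn p Q) D0) e_le; rewrite -/(k p) -/d.
move: (logn p Q) (logn p r) (k p) (v p%:R) vp (v u) => l lr kp e e0 w; clearbody d => H kr lt ed.
apply/negP; rewrite -leNgt.
(* From - D w <= l e <= l d, the integer - w is at most the floor kp of d l / D, hence at most lr e,
   the valuation of r, since e is at least 1. *)
have : d%:Z * l%:Z < (kp.+1)%:Z * D%:Z by rewrite -!PoszM ltz_nat.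
move=> lt'.
have h1 : - (D%:Z * w) <= l%:Z * e by lia.
have h2 : l%:Z * e <= l%:Z * d%:Z by rewrite ler_wpM2l.
have h3 : D%:Z * (- w) < D%:Z * (kp.+1)%:Z.
  by rewrite mulrN; apply: (le_lt_trans h1); apply: (le_lt_trans h2); rewrite mulrC [ltRHS]mulrC.
have h4 : - w < (kp.+1)%:Z by move: h3; rewrite ltr_pM2l // ltz_nat.
have h5 : kp%:Z <= lr%:Z * e.
  have : lr%:Z <= lr%:Z * e by rewrite ler_peMr.
  lia.
lia.
Qed.

End RootDenominator.

(** * Heights *)

Section RelativeHeight.
Variables (R : realType) (K : fieldExtType rat) (n : nat) (x : 'I_n.+1 -> K).
Hypothesis x0 : x ord0 = 1.
Local Notation D := (\dim {:K}).
Local Notation normc := (@Normc.normc R).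
Local Notation fterm v := (ln (max_abs (finite_abs R v) x)).
Local Notation aterm s := (ln (max_abs (fun y => normc (s y)) x)).

Lemma max_abs_ge1 (a : K -> R) : a 1 = 1 -> 1 <= max_abs a x.
Proof. by move=> a1; rewrite -{1}a1 -x0; exact: (le_bigmax 0 (fun i => a (x i))). Qed.

Lemma finite_abs1 (v : K -> int) : finite_place v -> finite_abs R v 1 = 1.
Proof. by move=> vP; rewrite /finite_abs oner_eq0 (place1 vP) oppr0 expr0z. Qed.

Lemma fterm_ge0 (v : K -> int) : finite_place v -> 0 <= fterm v.
Proof. by move=> vP; apply: ln_ge0; apply: max_abs_ge1; exact: finite_abs1. Qed.

Lemma aterm_ge0 (s : K -> R[i]) : @complex_embeddings R K s -> 0 <= aterm s.
Proof.
by move=> [t _ <-]; apply: ln_ge0; apply: max_abs_ge1; rewrite rmorph1 Normc.normc1.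
Qed.

Lemma residue_card_gt1 (v : K -> int) : finite_place v -> 1 < (residue_card v)%:R :> R.
Proof.
move=> vP; have [p p_pr vp] := place_residue_char vP.
have /andP[pc _] := residue_card_bounds vP p_pr vp.
by rewrite ltr1n (leq_trans (prime_gt1 p_pr)).
Qed.

Lemma fterm_le (v : K -> int) (k : nat) : finite_place v -> (forall i, vge v (- k%:Z) (x i)) ->
  fterm v <= ln (residue_card v)%:R *+ k.
Proof.
move=> vP vx; have c1 := residue_card_gt1 vP; have c0 := lt_trans ltr01 c1.
have m1 : 1 <= max_abs (finite_abs R v) x by apply: max_abs_ge1; exact: finite_abs1.
have m0 := lt_le_trans ltr01 m1; have ck : 0 < (residue_card v)%:R ^+ k :> R by rewrite exprn_gt0.
rewrite -lnXn // ler_ln ?posrE //.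
apply: bigmax_le => [|i _]; first by rewrite exprn_ge0 // ltW.
rewrite /finite_abs; case: eqP => [_|/eqP xi]; first by rewrite exprn_ge0 // ltW.
move: (vx i); rewrite /vge (negPf xi) /= => kx.
rewrite -[_ ^+ k]/(_ ^ k%:Z); apply: ler_weXz2l; [exact: ltW|lia].
Qed.

Lemma fterm_ge (v : K -> int) (k : nat) i : finite_place v -> x i != 0 -> v (x i) <= - k%:Z ->
  ln (residue_card v)%:R *+ k <= fterm v.
Proof.
move=> vP xi kx; have c1 := residue_card_gt1 vP; have c0 := lt_trans ltr01 c1.
have m1 : 1 <= max_abs (finite_abs R v) x by apply: max_abs_ge1; exact: finite_abs1.
have m0 := lt_le_trans ltr01 m1; have ck : 0 < (residue_card v)%:R ^+ k :> R by rewrite exprn_gt0.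
rewrite -lnXn // ler_ln ?posrE //.
apply: (@le_trans _ _ (finite_abs R v (x i)));
  last exact: (le_bigmax 0 (fun i => finite_abs R v (x i))).
rewrite /finite_abs (negPf xi) -[_ ^+ k]/(_ ^ k%:Z).
by apply: ler_weXz2l; [exact: ltW|lia].
Qed.

Definition places_of (q : nat) : set (K -> int) := [set v | finite_place v /\ 0 < v q%:R].

Lemma place_of_prime q v : (0 < q)%N -> places_of q v ->
  exists p, [/\ p \in primes q, @places_above K p v & prime p].
Proof.
move=> q0 [vP vq]; have [p p_pr vp] := place_residue_char vP.
exists p; split => //; rewrite mem_primes p_pr q0 /=; apply: contraTT vq => pq.
by rewrite (place_coprime vP p_pr vp) ?ltxx.
Qed.

Lemma places_of_finite q : (0 < q)%N -> finite_set (places_of q).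
Proof.
move=> q0; apply: (@sub_finite_set _ _ (\bigcup_(p in [set` primes q]) @places_above K p)).
  by move=> v /(place_of_prime q0)[p [pq vp _]]; exists p.
apply: bigcup_finite; first exact: finite_seq.
by move=> p /=; rewrite mem_primes => /andP[p_pr _]; have [] := places_above_finite K p_pr.
Qed.

Lemma fterm_supp q : (0 < q)%N -> (forall i, int_integral (q%:R * x i)) ->
  forall v, finite_place v -> ~ places_of q v -> fterm v = 0.
Proof.
move=> q0 qx v vP nv; apply/eqP; rewrite eq_le fterm_ge0 // andbT.
rewrite -[0](mulr0n (ln (residue_card v)%:R)); apply: fterm_le => // i.
have qK : q%:R != 0 :> K by rewrite num_field_natr_eq0 -lt0n.
have vq : v q%:R = 0.
  by apply/eqP; rewrite eq_le place_natr_ge0 // andbT leNgt; apply/negP => H; apply: nv.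
have := int_integral_vge vP (qx i); rewrite /vge mulf_eq0 (negPf qK) /=.
by have [//|xi /=] := eqVneq (x i) 0; rewrite placeM // vq add0r oppr0.
Qed.

Lemma finite_part_sum q : (0 < q)%N -> (forall i, int_integral (q%:R * x i)) ->
  \sum_(v \in finite_place (K := K)) fterm v = \sum_(v <- fset_set (places_of q)) fterm v.
Proof.
move=> q0 qx; rewrite -fsbig_finite; last exact: places_of_finite.
apply/esym/fsbig_widen; first by move=> v [].
by move=> v [vP nv] /=; apply: (fterm_supp q0 qx).
Qed.

Lemma complex_embeddings_finite :
  finite_set (@complex_embeddings R K) /\
  (#|` fset_set (@complex_embeddings R K)| <= D)%N.
Proof. exact: embeddings_finite. Qed.

Lemma ln_nat_ge0 (k : nat) : 0 <= ln (k%:R : R).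
Proof. by case: k => [|k]; [rewrite ln0|rewrite ln_ge0 // ler1n]. Qed.

(** At a place above p, v(q) is at most D times the exponent of p in q, and the logarithm of the
    residue cardinality is at most D ln p. There are at most D such places, which makes D^3 in
    all. *)
Lemma finite_part_le q : (0 < q)%N -> (forall i, int_integral (q%:R * x i)) ->
  \sum_(v \in finite_place (K := K)) fterm v <= (D ^ 3)%:R * ln q%:R.
Proof.
move=> q0 qx; rewrite (finite_part_sum q0 qx).
pose G (p : nat) : R := (D * D * logn p q)%:R * ln p%:R.
have G0 p : 0 <= G p by rewrite mulr_ge0 // ln_nat_ge0.
have finS := places_of_finite q0.
have term_le v : v \in fset_set (places_of q) ->
    fterm v <= \sum_(p <- primes q) (if `[< @places_above K p v >] then G p else 0).
  rewrite in_fset_set // inE => Sv; have [vP vq] := Sv.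
  have [p [pq vp p_pr]] := place_of_prime q0 Sv.
  rewrite (big_rem p) //= asboolT //.
  apply: (@le_trans _ _ (G p)); last first.
    by rewrite lerDl sumr_ge0 // => l _; case: ifP.
  have [_ vp0] := vp.
  have /andP[_ cD] := residue_card_bounds vP p_pr vp0.
  have eD := place_ramification vP p_pr vp0.
  have vqE : v q%:R = `|v q%:R|%N by rewrite gez0_abs // ltW.
  apply: le_trans (fterm_le (k := `|v q%:R|%N) vP _) _.
    move=> i; have := int_integral_vge vP (qx i).
    have qK : q%:R != 0 :> K by rewrite num_field_natr_eq0 -lt0n.
    rewrite /vge mulf_eq0 (negPf qK) /=; have [//|xi /=] := eqVneq (x i) 0.
    rewrite placeM //; move: vqE; clear; move: (v _) (v _) => a b; lia.
  have c0 : 0 < (residue_card v)%:R :> R := lt_trans ltr01 (residue_card_gt1 vP).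
  have p0 : 0 < p%:R :> R by rewrite ltr0n prime_gt0.
  have lnc : ln (residue_card v)%:R <= D%:R * ln p%:R :> R.
    by rewrite mulr_natl -lnXn // ler_ln ?posrE ?exprn_gt0 // -natrX ler_nat.
  rewrite -[leLHS]mulr_natl /G.
  have vD : (`|v q%:R| <= D * logn p q)%N.
    have := place_natr vP p_pr vp0 q0; rewrite vqE => E.
    by rewrite -lez_nat E PoszM mulrC; apply: ler_wpM2r.
  apply: (@le_trans _ _ ((D * logn p q)%:R * (D%:R * ln p%:R))); last first.
    rewrite !natrM; move: (logn p q)%:R (ln p%:R) (D%:R) => a b c.
    by have -> : c * a * (c * b) = c * c * a * b by ring.
  apply: ler_pM => //; last by rewrite ler_nat.
  by apply: ln_nat_ge0.
apply: (@le_trans _ _ (\sum_(v <- fset_set (places_of q)) \sum_(p <- primes q) (if `[<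
  @places_above K p v >] then G p else 0))).
  by rewrite big_seq [leRHS]big_seq; apply: ler_sum => v /term_le.
rewrite exchange_big /=.
apply: (@le_trans _ _ (\sum_(p <- primes q) D%:R * G p)).
  rewrite big_seq [leRHS]big_seq; apply: ler_sum => p; rewrite mem_primes => /andP[p_pr _].
  rewrite -big_mkcond /= big_const_seq iter_addr_0 -[leLHS]mulr_natl.
  apply: ler_wpM2r => //; rewrite ler_nat -size_filter.
  have [finp cardp] := places_above_finite K p_pr; apply: leq_trans cardp.
  apply: uniq_leq_size; first by rewrite filter_uniq // fset_uniq.
  by move=> v; rewrite mem_filter => /andP[/asboolP vp _]; rewrite in_fset_set // inE.
have -> : (D ^ 3)%:R * ln q%:R = \sum_(p <- primes q) D%:R * G p.
  have lnprod (s : seq nat) : (forall p, p \in s -> (0 < p)%N) ->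
      ln (\prod_(p <- s) p ^ logn p q)%:R = \sum_(p <- s) (logn p q)%:R * ln p%:R :> R.
    elim: s => [|p s IH] H; first by rewrite !big_nil ln1.
    rewrite !big_cons natrM lnM ?posrE.
    - rewrite natrX lnXn ?ltr0n ?H ?mem_head // mulr_natl; congr (_ + _); apply: IH.
      by move=> l ls; apply: H; rewrite inE ls orbT.
    - by rewrite ltr0n expn_gt0 H ?mem_head.
    - rewrite ltr0n big_seq; apply: (big_ind (fun m => (0 < m)%N)) => [//|a b a0 b0|l ls].
        by rewrite muln_gt0 a0.
      by rewrite expn_gt0 H // inE ls orbT.
  rewrite {1}(prod_primes_logn q0) lnprod; last first.
    by move=> p; rewrite mem_primes => /andP[/prime_gt0].
  rewrite mulr_sumr; apply: eq_bigr => p _; rewrite /G -[(D ^ 3)%N]/(D * (D * D))%N !natrM.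
  by move: (D%:R : R) (logn p q)%:R (ln _) => d l m; ring.
exact: lexx.
Qed.

Lemma relative_height_le q (M : R) : (0 < q)%N -> 1 <= M ->
  (forall i, int_integral (q%:R * x i)) ->
  (forall i (s : {rmorphism K -> R[i]}), normc (s (x i)) <= M) ->
  relative_height R x <= (D ^ 3)%:R * (ln q%:R + ln M).
Proof.
move=> q0 M1 qx sx; rewrite /relative_height mulrDr; apply: lerD.
  exact: finite_part_le.
have [fin card] := complex_embeddings_finite.
have M0 : 0 < M := lt_le_trans ltr01 M1.
rewrite fsbig_finite //.
apply: (@le_trans _ _ (\sum_(s <- fset_set (@complex_embeddings R K)) ln M)).
  rewrite big_seq [leRHS]big_seq; apply: ler_sum => s.
  rewrite in_fset_set // inE => -[t _ <-].
  have m1 : 1 <= max_abs (fun y => normc (t y)) x.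
    by apply: max_abs_ge1; rewrite rmorph1 Normc.normc1.
  rewrite ler_ln ?posrE ?(lt_le_trans ltr01) //.
  by apply: bigmax_le => [|i _]; [exact: ltW|exact: sx].
rewrite big_const_seq iter_addr_0 count_predT -[leLHS]mulr_natl.
apply: ler_wpM2r; first exact: ln_ge0.
rewrite ler_nat; apply: (leq_trans card).
by case: D => // d; rewrite expnS leq_pmulr // expn_gt0.
Qed.

Lemma finite_part_ge0 : 0 <= \sum_(v \in finite_place (K := K)) fterm v.
Proof. by apply: fsumr_ge0 => v; exact: fterm_ge0. Qed.

Lemma embedding_part_ge0 : 0 <= \sum_(s \in @complex_embeddings R K) aterm s.
Proof. by apply: fsumr_ge0 => s; exact: aterm_ge0. Qed.

(** q is the product over places v of p_v^(k_v), with p_v the residue characteristic and k_v the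
    largest pole order of a coordinate; p_v is at most the residue cardinality, so ln q is bounded
    by the finite part of the height. All local terms are nonnegative, so each embedding term is at
    most H and [expR H] bounds the conjugates. The denominator d confines the poles to finitely many
    places. *)
Lemma relative_height_ge d : (0 < d)%N -> (forall i, int_integral (d%:R * x i)) ->
  exists q (M : R), [/\ (0 < q)%N, 1 <= M,
    forall i, int_integral (q%:R * x i),
    forall i (s : {rmorphism K -> R[i]}), normc (s (x i)) <= M &
    ln q%:R <= relative_height R x /\ ln M <= relative_height R x].
Proof.
move=> d0 dx; set H := relative_height R x.
(* Value 0 is allowed so that the coordinate 1 always qualifies and the maximum k v is attained. *)
pose bad (v : K -> int) i := (x i != 0) && (v (x i) <= 0).
pose k (v : K -> int) := (\max_(i < n.+1 | bad v i) `|v (x i)|)%N.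
have /choice[p pP] : forall v : K -> int, exists p, (0 < p)%N /\
    (finite_place v -> prime p /\ 0 < v p%:R).
  move=> v; have [vP|nv] := pselect (finite_place v); last by exists 1%N.
  by have [p p_pr vp] := place_residue_char vP; exists p; rewrite prime_gt0.
pose S := fset_set (places_of d); have finS := places_of_finite d0.
have SP v : v \in S -> finite_place v by rewrite in_fset_set // inE => -[].
have prod_gt0 (s : seq (K -> int)) : (0 < \prod_(v <- s) p v ^ k v)%N.
  by apply: prodn_gt0 => v; rewrite expn_gt0; have [-> _] := pP v.
pose q := (\prod_(v <- S) p v ^ k v)%N.
have q0 : (0 < q)%N by exact: prod_gt0.
have lnq (s : seq (K -> int)) : ln (\prod_(v <- s) p v ^ k v)%:R = \sum_(v <- s) ln (p v)%:R *+
  k v :> R.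
  elim: s => [|v s IH]; first by rewrite !big_nil ln1.
  have [p0 _] := pP v.
  have pk0 : 0 < (p v ^ k v)%:R :> R by rewrite ltr0n expn_gt0 p0.
  have pr0 : 0 < (\prod_(w <- s) p w ^ k w)%:R :> R by rewrite ltr0n prod_gt0.
  by rewrite !big_cons natrM lnM ?posrE // natrX lnXn ?ltr0n // IH.
have kx v i : bad v i -> (`|v (x i)| <= k v)%N by move=> bi; exact: leq_bigmax_cond.
exists q, (expR H); split => //.
- by rewrite -expR0 ler_expR addr_ge0 ?finite_part_ge0 ?embedding_part_ge0.
- move=> i; apply: contrapT => /not_integral_place[w wP wq].
  have qK : q%:R != 0 :> K by rewrite num_field_natr_eq0 -lt0n.
  have [xi|xi] := eqVneq (x i) 0.
    by move: wq; rewrite xi mulr0; have [-> _ _ _] := wP; rewrite ltxx.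
  rewrite placeM // in wq; have wq0 := place_natr_ge0 wP q0.
  have wx : w (x i) < 0 by move: wq wq0; clear; move: (w _) (w _) => a b; lia.
  have Sw : w \in S.
    rewrite in_fset_set // inE; split => //.
    have := int_integral_vge wP (dx i);
      have dK : d%:R != 0 :> K by rewrite num_field_natr_eq0 -lt0n.
    rewrite /vge mulf_eq0 (negPf dK) (negPf xi) /= placeM //.
    by move: wx; clear; move: (w _) (w _) => a b; lia.
  have [p0 /(_ wP)[p_pr wp]] := pP w.
  have qE : q = (p w ^ k w * \prod_(v <- rem w S) p v ^ k v)%N by rewrite /q (big_rem w).
  have pk0 : (0 < p w ^ k w)%N by rewrite expn_gt0 p0.
  have pK : (p w)%:R != 0 :> K by rewrite num_field_natr_eq0 -lt0n.
  move: wq; have := place_natrM wP pk0 (prod_gt0 (rem w S)); rewrite -qE => ->.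
  rewrite natrX placeX //.
  have := place_natr_ge0 wP (prod_gt0 (rem w S)).
  have /kx : bad w i by rewrite /bad xi ltW.
  move: wx wp; clear; move: (w (x i)) (w (p w)%:R) (w _) (k w) => a c b m a0 c0 am b0 lt0.
  have : m%:Z <= m%:Z * c by rewrite ler_peMr.
  by move: am a0 b0 lt0; clear; move: (_ * c) => e; lia.
- move=> i s; have se : @complex_embeddings R K s by exists s.
  have m1 : 1 <= max_abs (fun y => normc (s y)) x.
    by apply: max_abs_ge1; rewrite rmorph1 Normc.normc1.
  apply: (@le_trans _ _ (max_abs (fun y => normc (s y)) x)).
    exact: (le_bigmax 0 (fun i => normc (s (x i)))).
  rewrite -[leLHS]lnK ?posrE ?(lt_le_trans ltr01) // ler_expR.
  apply: (@le_trans _ _ (\sum_(s \in @complex_embeddings R K) aterm s)); last first.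
    by rewrite /H /relative_height lerDr finite_part_ge0.
  have [fin _] := complex_embeddings_finite.
  rewrite fsbig_finite // (big_rem (s : K -> R[i])) /=; last by rewrite in_fset_set // inE.
  rewrite lerDl big_seq; apply: sumr_ge0 => t /mem_rem; rewrite in_fset_set // inE.
  exact: aterm_ge0.
rewrite expRK lexx; split => //.
apply: (@le_trans _ _ (\sum_(v \in finite_place (K := K)) fterm v)); last first.
  by rewrite /H /relative_height lerDl embedding_part_ge0.
rewrite (finite_part_sum d0 dx) lnq big_seq [leRHS]big_seq; apply: ler_sum => v vS.
have vP := SP v vS; have [p0 /(_ vP)[p_pr vp]] := pP v.
have bad0 : bad v ord0 by rewrite /bad x0 oner_neq0 place1.
have [i bi kE] : exists2 i, bad v i & k v = `|v (x i)|%N.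
  have card0 : (0 < #|[pred i | bad v i]|)%N by apply/card_gt0P; exists ord0.
  by have [i bi kE] := eq_bigmax_cond (fun i => `|v (x i)|%N) card0; exists i.
have /andP[xi vxi] := bi.
apply: le_trans (fterm_ge (i := i) (k := k v) vP xi _); last first.
  by rewrite kE; move: vxi; clear; move: (v _) => a; lia.
have /andP[pc _] := residue_card_bounds vP p_pr vp.
rewrite ler_wMn2r // ler_ln ?posrE ?ltr0n ?ler_nat // (leq_trans p0) //.
Qed.

End RelativeHeight.

(** * Degree of the field generated by a point *)

Section GeneratedField.

Lemma adjoin_seq_range (K L : fieldExtType rat) (iK : {rmorphism K -> algC})
    (iL : {rmorphism L -> algC}) (s : seq K) :
  (forall u, u \in s -> exists w, iL w = iK u) ->
  forall u, u \in <<1 & s>>%VS -> exists w, iL w = iK u.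
Proof.
move=> sP; have : forall (E : {subfield K}),
    (forall u, u \in E -> exists w, iL w = iK u) ->
    forall u, u \in <<E & s>>%VS -> exists w, iL w = iK u.
  elim: s sP => [|t s IH] sP E EP u.
    by rewrite Fadjoin_nil => /EP.
  rewrite adjoin_cons => us.
  apply: (IH _ [aspace of <<E; t>>%VS]) us => [v vs|v /Fadjoin_polyP[p pE ->]].
    by apply: sP; rewrite inE vs orbT.
  have [w wE] := sP t (mem_head _ _).
  have : forall i, exists w, iL w = iK p`_i by move=> i; apply: EP; exact: (polyOverP pE).
  move=> /choice[c cE]; exists (\sum_(i < size p) c i * w ^+ i).
  rewrite rmorph_sum horner_coef rmorph_sum; apply: eq_bigr => i _.
  by rewrite !rmorphM !rmorphXn cE wE.
move=> /(_ 1%AS) H u; apply: H => v /vlineP[a ->].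
exists (ratr a); rewrite fmorph_rat; rewrite -(fmorph_rat iK); congr (iK _).
by rewrite -alg_num_field.
Qed.

Lemma dim_range_le (K L : fieldExtType rat) (iK : {rmorphism K -> algC})
    (iL : {rmorphism L -> algC}) :
  (forall u, exists w, iL w = iK u) -> (\dim {:K} <= \dim {:L})%N.
Proof.
move=> H; rewrite leqNgt; apply/negP => lt.
have [w wE] := choice H.
pose b := vbasis {:K}.
have [a [sum0 [i ai]]] := integer_relation (fun i : 'I_(\dim {:K}) => w b`_i) (isT : prime 2) lt.
have /freeP bfree : free b := basis_free (vbasisP _).
have := bfree (fun i => (a i)%:~R) _ i.
have -> : \sum_(j < \dim {:K}) (a j)%:~R *: b`_j = 0.
  apply: (fmorph_inj iK); rewrite rmorph0 -(rmorph0 iL) -sum0 !rmorph_sum.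
  apply: eq_bigr => j _; rewrite rmorphM wE rmorph_int scaler_int.
  by rewrite -mulrzl rmorphM rmorph_int.
move=> /(_ erefl) /eqP; rewrite intr_eq0 => /eqP a0.
by rewrite a0 dvdz0 in ai.
Qed.

End GeneratedField.

Section AffineHeight.
Variables (R : realType) (N : nat).
Implicit Types P : 'rV[algC]_N.

Definition in_field (L : fieldExtType rat) (iL : {rmorphism L -> algC}) P : Prop :=
  forall i, exists u, iL u = P 0 i.

Lemma row_mx_proj P j : row_mx (const_mx 1 : 'rV_1) P 0 j = proj_point P j.
Proof.
rewrite /proj_point; case: unliftP => [i ->|->].
  have -> : lift ord0 i = rshift 1 i by apply: ord_inj.
  by rewrite row_mxEr.
have -> : ord0 = lshift N (ord0 : 'I_1) by apply: ord_inj.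
by rewrite row_mxEl mxE.
Qed.

(** The field chosen inside [height] varies with the point. The last clause bounds its degree by
    that of any field containing the coordinates, so one constant serves a whole orbit. *)
Lemma aff_heightE P : exists (K : fieldExtType rat) (iK : {rmorphism K -> algC})
  (t : 'I_N.+1 -> K), [/\ t ord0 = 1, forall j, iK (t j) = proj_point P j,
   aff_height R P = relative_height R t / (\dim {:K})%:R &
   forall (L : fieldExtType rat) (iL : {rmorphism L -> algC}), in_field iL P ->
     (\dim {:K} <= \dim {:L})%N].
Proof.
rewrite /aff_height /height; case: num_field_exists => K [iK [s sE gen]].
pose t (j : 'I_N.+1) := s`_j.
have tE j : iK (t j) = proj_point P j.
  have szs : size s = N.+1.
    by rewrite -(size_map iK) sE size_map size_enum_ord.
  rewrite -(nth_map 0 0) ?szs // sE (nth_map j) ?size_enum_ord // -row_mx_proj.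
  by congr (row_mx _ _ _ _); apply: ord_inj; rewrite nth_enum_ord.
exists K, iK, t; split => //.
  by apply: (fmorph_inj iK); rewrite tE proj_point0 rmorph1.
move=> L iL LP; apply: dim_range_le (iK) (iL) _ => u.
apply: (adjoin_seq_range (s := s)); last by rewrite gen memvf.
move=> v vs; have : iK v \in map iK s by apply: map_f.
rewrite sE => /mapP[j _ ->]; rewrite row_mx_proj /proj_point.
by case: (unlift _ _) => [i|]; [exact: LP|exists 1; rewrite rmorph1].
Qed.

Lemma dim_gt0 (K : fieldExtType rat) : (0 < \dim {:K})%N.
Proof. exact: adim_gt0. Qed.

Definition size_le (H : R) P : Prop := exists (q : nat) (M : R),
  [/\ (0 < q)%N, 1 <= M, bounded_point q M P, ln q%:R <= H & ln M <= H].

Lemma size_le_ge0 H P : size_le H P -> 0 <= H.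
Proof. by move=> [q [M [q0 M1 _ qH _]]]; apply: le_trans qH; exact: ln_nat_ge0. Qed.

Lemma size_le_trans H H' P : H <= H' -> size_le H P -> size_le H' P.
Proof.
by move=> HH' [q [M [q0 M1 qM qH MH]]]; exists q, M; split=> //;
  [exact: le_trans qH _|exact: le_trans MH _].
Qed.

Lemma aff_height_ge0 P : 0 <= aff_height R P.
Proof.
have [K [iK [t [t0 tE -> _]]]] := aff_heightE P.
by rewrite divr_ge0 // addr_ge0 ?finite_part_ge0 ?embedding_part_ge0.
Qed.

Section Field.
Variables (L : fieldExtType rat) (iL : {rmorphism L -> algC}).
Local Notation d := (\dim {:L}).

(** The 2 comes from adding ln q and ln M, the cube from [relative_height_le]; the division by the
    degree of the field is given away. *)
Lemma aff_height_le H P : in_field iL P -> size_le H P ->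
  aff_height R P <= (2 * d ^ 3)%:R * H.
Proof.
move=> PL /[dup] /size_le_ge0 H0 [q [M [q0 M1 qM qH MH]]].
have [K [iK [t [t0 tE -> dimK]]]] := aff_heightE P.
have KL := dimK L iL PL.
have tint j : int_integral (q%:R * t j).
  by apply/(int_integral_iota iK); rewrite rmorphM rmorph_nat tE; exact: proj_point_Aint qM.
have tM j (s : {rmorphism K -> R[i]}) : Normc.normc (s (t j)) <= M.
  by apply/(house_leP iK) : s; rewrite tE; exact: proj_point_house M1 qM.
have rel := relative_height_le t0 q0 M1 tint tM.
rewrite ler_pdivrMr ?ltr0n ?dim_gt0 //.
apply: (@le_trans _ _ ((2 * d ^ 3)%:R * H)); last first.
  by rewrite ler_peMr ?mulr_ge0 // ler1n dim_gt0.
apply: (le_trans rel); rewrite mulnC natrM -mulrA; apply: ler_pM => //.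
- by rewrite addr_ge0 ?ln_nat_ge0 ?ln_ge0.
- by rewrite ler_nat leq_exp2r.
- by rewrite mulr_natl mulr2n lerD.
Qed.

Lemma aff_height_size P : in_field iL P -> size_le (d%:R * aff_height R P) P.
Proof.
move=> PL; have h0 := aff_height_ge0 P.
have [K [iK [t [t0 tE hE dimK]]]] := aff_heightE P.
have KL := dimK L iL PL.
have /choice[e eP] : forall j, exists e, (0 < e)%N /\ e%:R * proj_point P j \in Aint.
  by move=> j; have [e e0 eP] := exists_denominator (proj_point P j); exists e.
have [||q [M [q0 M1 qt tM [qH MH]]]] := @relative_height_ge R K N t t0 (\prod_j e j)%N.
- by apply: prodn_gt0 => j; have [] := eP j.
- move=> j; apply/(int_integral_iota iK); rewrite rmorphM rmorph_nat tE (bigD1 j) //=.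
  rewrite [(e j * _)%N]mulnC natrM -mulrA; apply: rpredM; last by have [] := eP j.
  by rewrite Aint_Cnat // rpred_nat.
have hK : relative_height R t <= d%:R * aff_height R P.
  have -> : relative_height R t = (\dim {:K})%:R * aff_height R P.
    by rewrite hE mulrC mulfVK // pnatr_eq0 -lt0n dim_gt0.
  by rewrite ler_wpM2r // ler_nat.
exists q, M; split => //; [|exact: le_trans qH hK|exact: le_trans MH hK] => i.
rewrite -proj_pointS -tE; split; last by apply/house_leP => s; exact: tM.
by have /(int_integral_iota iK) := qt (lift ord0 i); rewrite rmorphM rmorph_nat.
Qed.

End Field.
End AffineHeight.

(** * Northcott's theorem *)

Section Northcott.
Variables (R : realType) (L : fieldExtType rat) (iL : {rmorphism L -> algC}).
Local Notation normc := (@Normc.normc R).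
Local Notation d := (\dim {:L}).

Lemma coef_prod_XsubC_le (rs : seq R[i]) (B : R) : 0 <= B ->
  (forall z, z \in rs -> normc z <= B) ->
  forall i, normc (\prod_(z <- rs) ('X - z%:P))`_i <= (1 + B) ^+ (size rs).
Proof.
move=> B0; elim: rs => [_ i|z rs IH H i].
  by rewrite big_nil coef1; case: (_ == _); rewrite ?Normc.normc1 ?Normc.normc0.
have {}IH : forall i, normc (\prod_(z <- rs) ('X - z%:P))`_i <= (1 + B) ^+ (size rs).
  by apply: IH => w wr; apply: H; rewrite inE wr orbT.
have zB : normc z <= B by apply: H; exact: mem_head.
rewrite big_cons mulrBl coefB coefXM coefCM /= exprS mulrDl mul1r.
apply: le_trans (complex_normD _ _) _; apply: lerD.
  case: ifP => _; last exact: IH.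
  by rewrite Normc.normc0 exprn_ge0 // addr_ge0.
have normN (w : R[i]) : normc (- w) = normc w by case: w => a b /=; rewrite !sqrrN.
by rewrite normN Normc.normcM; apply: ler_pM; rewrite ?complex_norm_ge0.
Qed.

Lemma normc_int (z : int) : normc z%:~R = `|z|%:~R.
Proof.
have nat_norm (n : nat) : normc n%:R = n%:R.
  have -> : n%:R = (n%:R)%:C%C :> R[i] by rewrite rmorph_nat.
  by rewrite /= expr0n addr0 sqrtr_sqr ger0_norm.
have normN (w : R[i]) : normc (- w) = normc w by case: w => a b /=; rewrite !sqrrN.
by case: z => n; [exact: nat_norm|rewrite NegzE rmorphN normN; exact: nat_norm].
Qed.

(** The minimal polynomial of w has integer coefficients and degree at most d, and its complex roots
    are conjugates of w, hence bounded by B. Its coefficients are thus bounded by (1 + B)^d, which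
    leaves finitely many polynomials. *)
Lemma northcott_Aint (B : R) : 0 <= B ->
  exists s : seq algC, forall w, w \in Aint -> house_le B w -> (exists u, iL u = w) -> w \in s.
Proof.
move=> B0; pose T := (Num.truncn ((1 + B) ^+ d)).+1.
(* Integers from -T to T are encoded by ordinals shifted by T. *)
pose pol (f : {ffun 'I_d.+1 -> 'I_(T + T).+1}) : {poly algC} :=
  \poly_(i < d.+1) ((f (inord i))%:Z - T%:Z)%:~R.
pose rootsC (p : {poly algC}) := sval (closed_field_poly_normal p).
exists (flatten [seq rootsC (pol f) | f <- enum {: {ffun 'I_d.+1 -> 'I_(T + T).+1}}]).
move=> w wint wB [u uE].
have [p [pE p_mon] pP] := minCpolyP w.
have [q q0 [qu qd]] := annihilating_polynomial u.
have size_p : (size p <= d.+1)%N.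
  apply: leq_trans qd; apply: dvdp_leq => //; rewrite -pP /root -uE.
  by rewrite -(iota_horner iL) qu rmorph0.
have pint : minCpoly w \is a polyOver Num.int by [].
have [pz pzE] := floorpP pint.
have pzp i : (pz`_i)%:~R = p`_i :> rat.
  apply: (fmorph_inj (ratr : {rmorphism rat -> algC})); rewrite rmorph_int -!coef_map.
  by rewrite -pzE pE.
have pC0 : map_poly ratr p != 0 :> {poly R[i]} by rewrite map_poly_eq0 monic_neq0.
have [rs rsE] := closed_field_poly_normal (map_poly ratr p : {poly R[i]}).
have lead1 : lead_coef (map_poly ratr p : {poly R[i]}) = 1.
  by rewrite lead_coef_map (monicP p_mon) rmorph1.
rewrite lead1 scale1r in rsE.
have size_rs : (size rs <= d)%N.
  have := size_prod_XsubC rs (fun z : R[i] => z); rewrite -rsE size_map_poly => E.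
  by rewrite -ltnS -E.
have coefB i : (`|(pz`_i)%R| <= T)%N.
  have rsB z : z \in rs -> normc z <= B.
    move=> zr; apply: wB => g; rewrite pP => /dvdpP[h ->].
    by rewrite rmorphM /= rootM rsE root_prod_XsubC zr orbT.
  have := coef_prod_XsubC_le B0 rsB i; rewrite -rsE coef_map /= -pzp rmorph_int normc_int => H.
  have {}H : (absz (pz`_i))%:R <= (1 + B) ^+ d.
    have -> : (absz (pz`_i))%:R = `|pz`_i|%:~R :> R by rewrite -abszE.
    by apply: (le_trans H); apply: ler_weXn2l => //; rewrite lerDl.
  by rewrite -(ler_nat R); apply: (le_trans H); exact: ltW (truncnS_gt _).
have fP (i : 'I_d.+1) : (`|(pz`_i + T%:Z)%R| < (T + T).+1)%N.
  by move: (coefB i); clear; move: (pz`_i) T => a b; lia.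
pose f := [ffun i : 'I_d.+1 => Ordinal (fP i)].
have polE : pol f = minCpoly w.
  rewrite pzE; apply/polyP => i; rewrite coef_poly coef_map.
  case: ltnP => [id|di].
    rewrite ffunE /= inordK //; congr (_%:~R).
    by move: (coefB i); clear; move: (pz`_i) T => a b; lia.
  have : p`_i = 0 by rewrite nth_default // (leq_trans size_p).
  by rewrite -pzp => /eqP; rewrite intr_eq0 => /eqP ->.
apply/flattenP; exists (rootsC (pol f)).
  by apply/mapP; exists f; rewrite ?mem_enum.
have := svalP (closed_field_poly_normal (pol f)); rewrite -/(rootsC (pol f)) => E.
have : root (pol f) w by rewrite polE root_minCpoly.
rewrite {1}E rootZ ?root_prod_XsubC // polE (monicP (minCpoly_monic w)).
exact: oner_neq0.
Qed.

Lemma northcott_scalar (Q : nat) (M : R) : 0 <= M ->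
  exists s : seq algC, forall y q, (0 < q <= Q)%N -> q%:R * y \in Aint ->
    house_le M y -> (exists u, iL u = y) -> y \in s.
Proof.
move=> M0; have [s sP] := northcott_Aint (mulr_ge0 (ler0n R Q) M0).
exists (flatten [seq [seq w / q%:R | w <- s] | q <- iota 0 Q.+1]).
move=> y q /andP[q0 qQ] yint yM [u uE].
apply/flattenP; exists [seq w / q%:R | w <- s].
  by apply/mapP; exists q; rewrite // mem_iota.
apply/mapP; exists (q%:R * y); last by rewrite mulrC mulKf // pnatr_eq0 -lt0n.
apply: sP => //; last by exists (q%:R * u); rewrite rmorphM rmorph_nat uE.
have qhouse : house_le (q%:R : R) (q%:R : algC).
  rewrite -(rmorph_nat iL); apply/house_leP => t; rewrite rmorph_nat.
  by have := normc_int q; rewrite /= => ->.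
by apply: house_le_trans (house_leM qhouse yM); rewrite ler_wpM2r // ler_nat.
Qed.

Lemma northcott_sequence N (P : nat -> 'rV[algC]_N) (H : R) :
  (forall k, in_field iL (P k)) -> (forall k, size_le H (P k)) ->
  exists i j, (i < j)%N /\ P i = P j.
Proof.
move=> PL PH; have H0 := size_le_ge0 (PH 0%N).
have [s sP] := northcott_scalar (Num.truncn (expR H)) (expR_ge0 H).
have Ps k i : P k 0 i \in s.
  have [q [M [q0 M1 qM qH MH]]] := PH k; have [qP MP] := qM i.
  apply: (sP _ q) => //; last exact: PL.
    rewrite q0 truncn_ge_nat ?expR_ge0 //.
    by rewrite -[leLHS]lnK ?posrE ?ltr0n // ler_expR.
  apply: house_le_trans MP.
  by rewrite -[leLHS]lnK ?posrE ?(lt_le_trans ltr01) // ler_expR.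
have idx k (i : 'I_N) : (index (P k 0%R i) s < size s)%N by rewrite index_mem.
pose F k := [ffun i : 'I_N => Ordinal (idx k i)].
pose T : finType := {ffun 'I_N -> 'I_(size s)}.
have : ~ injective (fun k : 'I_#|T|.+1 => F k).
  by move=> /leq_card; rewrite card_ord ltnn.
move=> /existsNP[i /existsNP[j /not_implyP[Fij ij]]].
have Pij : P i = P j.
  apply/rowP => l; have := congr1 (fun f : T => val (f l)) Fij.
  by rewrite /= !ffunE /= => E; rewrite -(nth_index 0 (Ps i l)) E nth_index.
have [lt|lt|/ord_inj //] := ltngtP i j; first by exists i, j.
by exists j, i.
Qed.

End Northcott.

(** * Iterates of a regular automorphism *)

Section DegreeBounds.
Variable n : nat.

Lemma msize_leD D (p q : mpoly n algC) :
  (msize p <= D)%N -> (msize q <= D)%N -> (msize (p + q) <= D)%N.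
Proof.
by move=> pD qD; apply: leq_trans (mmeasureD_le _ _ _) _; rewrite geq_max pD.
Qed.

Lemma msize_leM a b (p q : mpoly n algC) :
  (msize p <= a.+1)%N -> (msize q <= b.+1)%N -> (msize (p * q) <= (a + b).+1)%N.
Proof.
have [->|p0] := eqVneq p 0; first by rewrite mul0r msize0.
have [->|q0] := eqVneq q 0; first by rewrite mulr0 msize0.
by rewrite msizeM //; clear; move: (msize p) (msize q) => k l; lia.
Qed.

Lemma msize_comp_le N a b (p : mpoly N algC) (g : N.-tuple (mpoly n algC)) :
  (msize p <= a.+1)%N -> (forall i, msize (tnth g i) <= b.+1)%N ->
  (msize (comp_mpoly g p) <= (a * b).+1)%N.
Proof.
move=> pa gb; rewrite /comp_mpoly /mmap big_seq.
apply: (big_ind (fun q : mpoly n algC => (msize q <= (a * b).+1)%N)).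
- by rewrite msize0.
- by move=> q r; apply: msize_leD.
move=> m mp; have ma : (mdeg m <= a)%N by rewrite -ltnS (leq_trans (msize_mdeg_lt mp)).
rewrite -[(a * b)%N]add0n; apply: msize_leM.
  by rewrite msizeC; case: (_ != _).
apply: (@leq_trans (mdeg m * b).+1); last by rewrite ltnS leq_mul2r ma orbT.
rewrite /mmap1 mdegE big_distrl /=.
apply: (big_rec2 (fun (q : mpoly n algC) k => (msize q <= k.+1)%N)); first by rewrite msize1.
move=> i q k _ qk; apply: msize_leM => //.
elim: (m i) => [|l IH]; first by rewrite expr0 msize1.
by rewrite exprS mulSn; apply: msize_leM.
Qed.

End DegreeBounds.

Lemma poly_agree_nz (p q : {poly algC}) :
  (forall t, t != 0 -> p.[t] = q.[t]) -> p = q.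
Proof.
move=> H; apply/eqP; rewrite -subr_eq0; apply/eqP.
have /eqP : (p - q) * 'X = 0.
  apply: contrapT => /eqP /closed_nonrootP[t /negP[]].
  rewrite /root hornerM hornerX; have [->|t0] := eqVneq t 0; first by rewrite mulr0.
  by rewrite hornerD hornerN H // subrr mul0r.
by rewrite mulf_eq0 polyX_eq0 orbF => /eqP.
Qed.

Lemma horner_mmap n (q : 'I_n -> {poly algC}) (p : mpoly n algC) t :
  (mmap (@polyC algC) q p).[t] = meval (fun j => (q j).[t]) p.
Proof.
rewrite mevalE /mmap horner_sum; apply: eq_bigr => m _; rewrite hornerM hornerC.
congr (_ * _); rewrite /mmap1 horner_prod; apply: eq_bigr => i _; exact: horner_exp.
Qed.

Section HomogeneousMap.
Variable N : nat.
Implicit Types (f g : affmap N) (P : 'rV[algC]_N) (y : 'I_N.+1 -> algC).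

(** The degree d of homogenization is free and may exceed that of f, as the product of two degrees
    may for a composition; the lift then vanishes on the hyperplane at infinity. *)
Definition hmap d f y (j : 'I_N.+1) : algC :=
  meval y (homogenize d (if unlift ord0 j is Some i then tnth f i else 1)).

Definition deg_le d f : Prop := forall i, (msize (tnth f i) <= d.+1)%N.

Lemma deg_leP d f : (aff_maxdeg f <= d)%N <-> deg_le d f.
Proof.
split=> H.
  move=> i; have : ((msize (tnth f i)).-1 <= d)%N.
    by apply: leq_trans H; exact: (leq_bigmax (F := fun i => (msize (tnth f i)).-1)).
  by case: (msize _).
by apply/bigmax_leqP => i _; have := H i; case: (msize _).
Qed.

Lemma aff_maxdegP f : deg_le (aff_maxdeg f) f. Proof. exact/deg_leP. Qed.

Lemma hmap0 d f y : hmap d f y ord0 = y ord0 ^+ d.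
Proof.
rewrite /hmap unlift_none meval_homogenize msupp1 big_seq1 mcoeff1 eqxx mul1r.
by rewrite mdeg0 subn0 big1 ?mulr1 // => i _; rewrite mnm0E expr0.
Qed.

Lemma hmapZ d f y l j : deg_le d f -> hmap d f (fun j => l * y j) j = l ^+ d * hmap d f y j.
Proof.
move=> fd; apply: meval_homogenizeZ; case: (unlift _ _) => [i|]; last by rewrite msize1.
by have := fd i; case: (msize _).
Qed.

Lemma hmap_proj d f P j : hmap d f (proj_point P) j = proj_point (aff_eval f P) j.
Proof.
rewrite /hmap meval_homogenize_proj /proj_point; case: unliftP => [i _|_].
  by rewrite mxE.
by rewrite meval1.
Qed.

Lemma hmap_ext d f y y' j : y =1 y' -> hmap d f y j = hmap d f y' j.
Proof. by move=> yy; apply: meval_eq. Qed.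

Lemma aff_eval_comp f g P : aff_eval (aff_comp f g) P = aff_eval f (aff_eval g P).
Proof.
apply/rowP => i; rewrite !mxE tnth_mktuple comp_mpoly_meval.
by apply: meval_eq => j; rewrite mxE.
Qed.

Lemma deg_le_comp a b f g : deg_le a f -> deg_le b g -> deg_le (a * b) (aff_comp f g).
Proof. by move=> fa gb i; rewrite tnth_mktuple; apply: msize_comp_le. Qed.

Lemma hmap_affine d f y : deg_le d f -> y ord0 != 0 -> forall j,
  hmap d f y j = y ord0 ^+ d * proj_point (aff_eval f (\row_i ((y ord0)^-1 * y (lift ord0 i)))) j.
Proof.
move=> fd y0 j; rewrite -(hmap_proj d) -hmapZ //; apply: hmap_ext => l.
case: (unliftP ord0 l) => [i ->|->]; last by rewrite proj_point0 mulr1.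
by rewrite proj_pointS mxE mulrA mulfV // mul1r.
Qed.

(** Where y_0 is nonzero this is composition of affine evaluations, up to scaling. At y_0 = 0 that
    coordinate is replaced by a variable: both sides become polynomials in it that agree at all
    nonzero values, hence at 0. *)
Lemma hmap_comp a b f g y j : deg_le a f -> deg_le b g ->
  hmap (a * b) (aff_comp f g) y j = hmap a f (hmap b g y) j.
Proof.
move=> fa gb; have fg := deg_le_comp fa gb.
have nz z : z ord0 != 0 -> hmap (a * b) (aff_comp f g) z j = hmap a f (hmap b g z) j.
  move=> z0; rewrite hmap_affine // [RHS]hmap_affine //; last by rewrite hmap0 expf_neq0.
  rewrite hmap0 -exprM mulnC; congr (_ * proj_point _ _); rewrite aff_eval_comp; congr aff_eval.
  apply/rowP => i; rewrite [RHS]mxE hmap_affine // proj_pointS.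
  by rewrite mulrA mulVf ?mul1r // expf_neq0.
have [y0|] := eqVneq (y ord0) 0; last exact: nz.
pose q (i : 'I_N.+1) : {poly algC} := if i == ord0 then 'X else (y i)%:P.
pose co (h : affmap N) (j : 'I_N.+1) := if unlift ord0 j is Some i then tnth h i else 1.
pose L := mmap (@polyC algC) q (homogenize (a * b) (co (aff_comp f g) j)).
pose G i := mmap (@polyC algC) q (homogenize b (co g i)).
pose Rt := mmap (@polyC algC) G (homogenize a (co f j)).
have LR : L = Rt.
  apply: poly_agree_nz => t t0; rewrite /L /Rt !horner_mmap.
  transitivity (hmap (a * b) (aff_comp f g) (fun i => (q i).[t]) j); first by [].
  rewrite nz; last by rewrite /q eqxx hornerX.
  by apply: hmap_ext => i; rewrite /G horner_mmap.
have := congr1 (fun p => p.[0]) LR; rewrite /L /Rt !horner_mmap => E.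
have q0 i : (q i).[0] = y i.
  by rewrite /q; case: eqP => [->|_]; rewrite ?hornerX ?hornerC.
rewrite -[LHS]/(meval y (homogenize (a * b) (co (aff_comp f g) j))).
rewrite -(meval_eq _ q0) E; apply: meval_eq => i; rewrite /G horner_mmap; exact: meval_eq.
Qed.

Lemma deg_le_id d : (0 < d)%N -> deg_le d (aff_id N).
Proof. by move=> d0 i; rewrite tnth_mktuple msizeX mdeg1. Qed.

(** In degree d the identity acquires the factor y_0^(d-1). Applied to a composition of f with its
    inverse g, this sends the image at infinity under the lift of f into the zeros of the lift of g,
    as [hext_cancel] states. *)
Lemma hmap_id0 d y j : (1 < d)%N -> y ord0 = 0 -> hmap d (aff_id N) y j = 0.
Proof.
move=> d1 y0; case: (unliftP ord0 j) => [i ->|->]; last first.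
  by rewrite hmap0 y0 expr0n; case: d d1.
rewrite /hmap liftK tnth_mktuple meval_homogenize msuppX big_seq1 mdeg1 y0.
by rewrite expr0n subn_eq0 leqNgt d1 mul0r mulr0.
Qed.

Lemma hmap_id1 y j : hmap 1 (aff_id N) y j = y j.
Proof.
case: (unliftP ord0 j) => [i ->|->]; last by rewrite hmap0 expr1.
rewrite /hmap liftK tnth_mktuple meval_homogenize msuppX big_seq1 mdeg1 expr0 mul1r.
rewrite mcoeffX eqxx mul1r (bigD1 i) //= mnm1E eqxx expr1 big1 ?mulr1 // => l li.
by rewrite mnm1E eq_sym (negPf li) expr0.
Qed.

Lemma aff_iterS f n : aff_iter f n.+1 = aff_comp f (aff_iter f n).
Proof. by []. Qed.

Lemma deg_le_iter f n : deg_le (aff_maxdeg f ^ n) (aff_iter f n).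
Proof.
elim: n => [|n IH]; first exact: deg_le_id.
by rewrite aff_iterS expnS; apply: deg_le_comp => //; exact: aff_maxdegP.
Qed.

Definition hext f y j := hmap (aff_maxdeg f) f y j.

Lemma hmap_iter f n y j : hmap (aff_maxdeg f ^ n) (aff_iter f n) y j = iter n (hext f) y j.
Proof.
elim: n y j => [|n IH] y j; first by rewrite expn0 hmap_id1.
rewrite aff_iterS expnS hmap_comp; [|exact: aff_maxdegP|exact: deg_le_iter].
by rewrite iterS; apply: hmap_ext => i; exact: IH.
Qed.

Lemma aff_eval_iter f n P : aff_eval (aff_iter f n) P = iter n (aff_eval f) P.
Proof.
elim: n => [|n IH]; last by rewrite aff_iterS aff_eval_comp IH.
by apply/rowP => i; rewrite mxE tnth_mktuple mevalXU.
Qed.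

Lemma deg_iter_eq f n y : y ord0 = 0 -> (exists j, iter n (hext f) y j != 0) ->
  aff_maxdeg (aff_iter f n) = (aff_maxdeg f ^ n)%N.
Proof.
move=> y0 [j]; rewrite -hmap_iter => nz; apply/eqP; rewrite eqn_leq.
apply/andP; split; first by apply/deg_leP; exact: deg_le_iter.
rewrite leqNgt; apply: contra nz => lt; have d0 : (0 < aff_maxdeg f ^ n)%N by case: (_ ^ _)%N lt.
case: (unliftP ord0 j) => [i ->|->]; last by rewrite hmap0 y0 expr0n gtn_eqF.
rewrite /hmap liftK meval_homogenize big_seq big1 // => m mp.
have md : (mdeg m < aff_maxdeg f ^ n)%N.
  have := aff_maxdegP (aff_iter f n) i; move=> /(leq_trans (msize_mdeg_lt mp)).
  by rewrite ltnS => /leq_ltn_trans; apply.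
by rewrite y0 expr0n subn_eq0 leqNgt md /= mul0r mulr0.
Qed.

Lemma mem_indeterminacyP f y : (exists j, y j != 0) -> (forall j, hext f y j = 0) ->
  indeterminacy (extension f) (\row_j y j).
Proof.
move=> [j yj] fy; split; first by apply: contraNneq yj => /rowP/(_ j); rewrite !mxE => ->.
move=> i; rewrite -[RHS](fy i); apply: meval_eq => l; rewrite mxE.
by [].
Qed.

Lemma indeterminacyP f (x : 'rV[algC]_N.+1) : indeterminacy (extension f) x ->
  (exists j, x 0 j != 0) /\ forall j, hext f (x 0) j = 0.
Proof.
move=> [x0 fx]; split; last exact: fx.
apply: contrapT => H; case/negP: x0; apply/eqP/rowP => j; rewrite mxE.
by apply/eqP; apply: contrapT => xj; apply: H; exists j; apply/negP.
Qed.

End HomogeneousMap.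

(** * Degrees and indeterminacy of the iterates *)

Section RegularAutomorphism.
Variable N : nat.
Implicit Types (f g : affmap N) (P : 'rV[algC]_N) (y : 'I_N.+1 -> algC).

Lemma aff_eval_cancel f g : aff_comp g f = aff_id N -> cancel (aff_eval f) (aff_eval g).
Proof.
move=> gf P; rewrite -aff_eval_comp gf; apply/rowP => i.
by rewrite mxE tnth_mktuple mevalXU.
Qed.

Lemma nonmorphism_point f : ~ is_morphism (extension f) ->
  (0 < aff_maxdeg f)%N /\
  exists y, [/\ exists j, y j != 0, y ord0 = 0 & forall j, hext f y j = 0].
Proof.
move=> /eqP/set0P[x /indeterminacyP[x0 fx]].
have := fx ord0; rewrite /hext hmap0 => /eqP; rewrite expf_eq0 => /andP[d0 /eqP x00].
by split => //; exists (x 0).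
Qed.

(** In degree 1, an indeterminacy point y at infinity is killed by the linear part of f, so f is
    constant in the direction y. The points y and y / 2 then have the same image, against
    injectivity. *)
Lemma nonmorphism_degree f g : aff_comp g f = aff_id N ->
  ~ is_morphism (extension f) -> (1 < aff_maxdeg f)%N.
Proof.
move=> gf /nonmorphism_point[d0 [y [[j yj] y0 fy]]].
rewrite ltn_neqAle d0 andbT; apply/eqP => d1.
have f1 : deg_le 1 f by rewrite d1; exact: aff_maxdegP.
have fy1 l : hmap 1 f y l = 0 by rewrite d1; exact: fy.
pose ys (s : algC) (l : 'I_N.+1) := if l == ord0 then s else y l.
have ysS s i : ys s (lift ord0 i) = y (lift ord0 i) by [].
have ys0 s : ys s ord0 = s by rewrite /ys eqxx.
have affine s i : hmap 1 f (ys s) (lift ord0 i) = s * hmap 1 f (ys 1) (lift ord0 i).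
  apply/eqP; rewrite -subr_eq0; apply/eqP.
  rewrite -[RHS](mulr0 (1 - s)) -(fy1 (lift ord0 i)) /hmap liftK !meval_homogenize.
  rewrite !mulr_sumr -sumrB; apply: eq_bigr => m _; rewrite y0 !ys0.
  set X := \prod_i y (lift ord0 i) ^+ m i.
  set c := mcoeff _ _; clearbody X c.
  by case: (mdeg m) => [|k]; rewrite ?subn0 ?expr1 ?expr1n ?subSS ?sub0n ?expr0; ring.
have const s i : s != 0 ->
    aff_eval f (\row_i (s^-1 * y (lift ord0 i))) 0 i = hmap 1 f (ys 1) (lift ord0 i).
  move=> s0; have yss : ys s ord0 != 0 by rewrite ys0.
  have := hmap_affine f1 yss (lift ord0 i); rewrite affine ys0 expr1.
  by move=> /(mulfI s0) ->; rewrite proj_pointS.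
have /(congr1 (aff_eval g)) : aff_eval f (\row_i (1^-1 * y (lift ord0 i))) = aff_eval f (\row_i
  (2%:R^-1 * y (lift ord0 i))).
  by apply/rowP => i; rewrite !const // ?oner_neq0 // pnatr_eq0.
rewrite !(aff_eval_cancel gf) => /rowP v.
case: (unliftP ord0 j) yj => [i ->|->]; last by rewrite y0 eqxx.
have := v i; rewrite !mxE invr1 mul1r => E; have {E} E : y (lift ord0 i) * 2%:R = y (lift ord0 i).
  by rewrite {1}E mulrC mulrA mulfV ?mul1r // pnatr_eq0.
rewrite mulr_natr mulr2n in E; move/eqP: E; rewrite -subr_eq0 addrK => /eqP ->.
by rewrite eqxx.
Qed.

Lemma iter_hext0 f n y : (0 < aff_maxdeg f)%N -> y ord0 = 0 -> iter n (hext f) y ord0 = 0.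
Proof.
move=> d0 y0; case: n => [//|n]; rewrite -hmap_iter hmap0 y0 expr0n.
by rewrite gtn_eqF // expn_gt0 d0.
Qed.

Lemma hext_cancel f g y j : aff_comp g f = aff_id N -> (0 < aff_maxdeg f)%N ->
  (1 < aff_maxdeg g)%N -> y ord0 = 0 -> hext g (hext f y) j = 0.
Proof.
move=> gf d0 d1 y0; rewrite -[LHS](hmap_comp _ _ (aff_maxdegP g) (aff_maxdegP f)) gf.
by rewrite hmap_id0 // (leq_trans d1) // leq_pmulr.
Qed.

Section Pair.
Variables f g : affmap N.
Hypotheses (fg : aff_comp f g = aff_id N) (gf : aff_comp g f = aff_id N).
Hypotheses (nf : ~ is_morphism (extension f)) (ng : ~ is_morphism (extension g)).
Hypothesis disj : indeterminacy (extension f) `&` indeterminacy (extension g) = set0.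

Let d_gt1 : (1 < aff_maxdeg f)%N. Proof. exact: nonmorphism_degree gf nf. Qed.
Let d'_gt1 : (1 < aff_maxdeg g)%N. Proof. exact: nonmorphism_degree fg ng. Qed.

Lemma hext_disjoint y : (exists j, y j != 0) -> (forall j, hext f y j = 0) ->
  (forall j, hext g y j = 0) -> False.
Proof.
move=> y0 fy gy; suff : (indeterminacy (extension f) `&` indeterminacy (extension g)) (\row_j y j).
  by rewrite disj.
by split; apply: mem_indeterminacyP.
Qed.

(** Start at an indeterminacy point of g. By [hext_cancel] its images under the lift of f remain
    zeros of the lift of g, hence by disjointness are never zeros of the lift of f. A lift of the
    iterate that does not vanish identically at infinity excludes a drop of the degree. *)
Lemma degree_iter n : aff_maxdeg (aff_iter f n) = (aff_maxdeg f ^ n)%N.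
Proof.
have [_ [y [yj y0 gy]]] := nonmorphism_point ng.
apply: (deg_iter_eq y0).
suff [] : (exists j, iter n (hext f) y j != 0) /\ forall j, hext g (iter n (hext f) y) j = 0 by [].
elim: n => [//|n [nz gn]]; split.
  apply: contrapT => H; apply: (hext_disjoint nz) gn => j.
  by apply/eqP; apply: contrapT => /negP hj; apply: H; exists j.
by move=> j; apply: hext_cancel => //; [exact: ltnW|exact: iter_hext0 (ltnW d_gt1) y0].
Qed.

End Pair.

(** If the vanishing began only at a later step, the last nonzero image would be a zero of the lift
    of f and, being itself an image, of the lift of g. *)
Lemma hext_iter_zero f g n y :
  aff_comp g f = aff_id N -> (1 < aff_maxdeg f)%N -> (1 < aff_maxdeg g)%N ->
  indeterminacy (extension f) `&` indeterminacy (extension g) = set0 ->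
  (exists j, y j != 0) -> y ord0 = 0 -> (forall j, iter n (hext f) y j = 0) ->
  forall j, hext f y j = 0.
Proof.
move=> gf d1 d'1 disj yj y0; elim: n => [H|n IH H].
  by have [j /negP[]] := yj; rewrite [y j]H.
case: n IH H => [//|n] IH H; apply: IH => j.
apply/eqP; apply: contrapT => /negP nz.
apply: (hext_disjoint disj (y := iter n.+1 (hext f) y)); first by exists j.
  exact: H.
by move=> i; apply: hext_cancel => //; [exact: ltnW|exact: iter_hext0 (ltnW d1) y0].
Qed.

(** An iterate is indeterminate only where the map itself is, by [hext_iter_zero]; the exact degrees
    identify the extensions of the iterates with the iterated lifts. *)
Lemma iter_disjoint f g n m : are_inverse f g ->
  ~ is_morphism (extension f) -> ~ is_morphism (extension g) ->
  indeterminacy (extension f) `&` indeterminacy (extension g) = set0 ->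
  indeterminacy (extension (aff_iter f n)) `&` indeterminacy (extension (aff_iter g m)) = set0.
Proof.
move=> [fg gf] nf ng disj.
have d1 := nonmorphism_degree gf nf; have d'1 := nonmorphism_degree fg ng.
have disj' : indeterminacy (extension g) `&` indeterminacy (extension f) = set0 by rewrite setIC.
rewrite -subset0 => x [/indeterminacyP[xj fx] /indeterminacyP[_ gx]].
have {}fx j : iter n (hext f) (x 0) j = 0.
  by have := fx j; rewrite /hext (degree_iter fg gf nf ng disj) hmap_iter.
have {}gx j : iter m (hext g) (x 0) j = 0.
  by have := gx j; rewrite /hext (degree_iter gf fg ng nf disj') hmap_iter.
have x0 : x 0 ord0 = 0.
  have := fx ord0; rewrite -hmap_iter hmap0 => /eqP.
  by rewrite expf_eq0 => /andP[_ /eqP].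
apply: (hext_disjoint disj xj).
  exact: (hext_iter_zero gf d1 d'1 disj xj x0 fx).
exact: (hext_iter_zero fg d'1 d1 disj' xj x0 gx).
Qed.

End RegularAutomorphism.

(** * Growth of heights along an orbit *)

Section RealSequences.
Variable R : realType.

Lemma exprn_bernoulli (x : R) n : 0 <= x -> 1 + n%:R * x <= (1 + x) ^+ n.
Proof.
move=> x0; elim: n => [|n IH]; first by rewrite mul0r addr0 expr0.
rewrite exprS -natr1 mulrDl mul1r; apply: (@le_trans _ _ ((1 + x) * (1 + n%:R * x))).
  have : 0 <= n%:R * x * x by rewrite !mulr_ge0.
  by move: (n%:R : R) => k; nra.
by rewrite ler_wpM2l // addr_ge0.
Qed.

Lemma exprn_exceeds (x B : R) : 1 < x -> exists n0, forall n, (n0 <= n)%N -> B < x ^+ n.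
Proof.
move=> x1; have x10 : 0 < x - 1 by rewrite subr_gt0.
exists (Num.truncn (`|B| / (x - 1))).+1 => n n0.
have B1 : `|B| / (x - 1) < n%:R.
  by apply: lt_le_trans (truncnS_gt _) _; rewrite ler_nat.
rewrite ltr_pdivrMr // in B1.
have xE : 1 + (x - 1) = x by rewrite addrC subrK.
have := exprn_bernoulli n (ltW x10); rewrite xE.
by apply: lt_le_trans; rewrite ltr_pwDl // (le_trans (ler_norm _)) // ltW.
Qed.

Lemma powR_root_le (a c : R) (k : nat) : (0 < k)%N -> 0 <= a -> 0 <= c ->
  (a `^ k%:R^-1 <= c) = (a <= c ^+ k).
Proof.
move=> k0 a0 c0; have kR : (k%:R : R) != 0 by rewrite pnatr_eq0 -lt0n.
have aE : a = (a `^ k%:R^-1) ^+ k by rewrite -powR_mulrn ?powR_ge0 // -powRrM mulVf // powRr1.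
by rewrite {2}aE ler_pXn2r ?nnegrE ?powR_ge0.
Qed.

Lemma powR_root_ge (a c : R) (k : nat) : (0 < k)%N -> 0 <= a -> 0 <= c ->
  (c <= a `^ k%:R^-1) = (c ^+ k <= a).
Proof.
move=> k0 a0 c0; have kR : (k%:R : R) != 0 by rewrite pnatr_eq0 -lt0n.
have aE : a = (a `^ k%:R^-1) ^+ k by rewrite -powR_mulrn ?powR_ge0 // -powRrM mulVf // powRr1.
by rewrite {2}aE ler_pXn2r ?nnegrE ?powR_ge0.
Qed.

Lemma limn_esup_root (h : nat -> R) (delta U : R) :
  0 < delta -> (forall k, 0 <= h k) -> (forall k, h k <= U * delta ^+ k) ->
  (forall c : R, 0 < c < delta -> forall n0, exists2 k, (n0 <= k)%N & c ^+ k <= h k) ->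
  limn_esup (fun k => (h k `^ k%:R^-1)%:E) = delta%:E.
Proof.
move=> d0 h0 hU hc; apply/eqP; rewrite eq_le; apply/andP; split.
  apply/lee_addgt0Pr => e e0.
  have [n0 n0P] : exists n0, forall n, (n0 <= n)%N -> U < ((delta + e) / delta) ^+ n.
    by apply: exprn_exceeds; rewrite ltr_pdivlMr // mul1r ltrDl.
  rewrite /limn_esup /limf_esup.
  apply: (@le_trans _ _ (ereal_sup ((fun k => (h k `^ k%:R^-1)%:E) @` [set k | (n0.+1 <= k)%N]))).
    by apply: ereal_inf_lbound; exists [set k | (n0.+1 <= k)%N] => //; exists n0.+1.
  apply: ge_ereal_sup => _ [k /= kn <-].
  rewrite -EFinD lee_fin powR_root_le //; [|exact: leq_trans kn|by rewrite addr_ge0 // ltW].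
  apply: le_trans (hU k) _; have := n0P k (ltnW kn).
  by rewrite expr_div_n ltr_pdivlMr ?exprn_gt0 // => /ltW.
have lower (c : R) : 0 < c < delta -> (c%:E <= limn_esup (fun k => (h k `^ k%:R^-1)%:E))%E.
  move=> /[dup] /andP[c0 _] cd; apply: le_ereal_inf_tmp => _ [V [n0 _ nV] <-].
  have [k kn ck] := hc c cd n0.+1.
  apply: (@le_trans _ _ (h k `^ k%:R^-1)%:E).
    by rewrite lee_fin powR_root_ge ?(ltW c0) // (leq_trans _ kn).
  by apply: ereal_sup_ubound; exists k => //; apply: nV => /=; rewrite ltnW.
rewrite leNgt; apply/negP => lt.
(* The bound by delta / 2 excludes the value -oo and makes r positive, so that the mean of r and
   delta is an admissible c. *)
have half : 0 < delta / 2 < delta by apply/andP; split; lra.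
have := lower _ half.
move: lt lower; case: (limn_esup _) => [r| |] //= lt lower rh.
rewrite lte_fin in lt; rewrite lee_fin in rh.
have /lower : 0 < (r + delta) / 2 < delta by apply/andP; split; lra.
by rewrite lee_fin; lra.
Qed.

Lemma exists_record (a : nat -> R) K : exists2 j, (j <= K)%N &
  a K <= a j /\ forall l, (l <= K)%N -> a l <= a j.
Proof.
case: (@arg_maxP _ R 'I_K.+1 ord_max predT (fun i => a i) isT) => j _ maxj.
exists j; first by rewrite -ltnS.
have H l : (l <= K)%N -> a l <= a j.
  by rewrite -ltnS => lK; have := maxj (Ordinal lK) isT.
by split => //; exact: H.
Qed.

(* At an index k where a_k exceeds all earlier terms, a_(k-m) <= a_k, so one of the
   next n terms is a record at least K - 2 times as large. *)
Lemma record_growth (a : nat -> R) (n m : nat) (K C : R) :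
  (0 < n)%N -> 3 < K -> (forall k, (m <= k)%N -> K * a k <= a (k + n)%N + a (k - m)%N + C) ->
  (forall B, exists k, B < a k) ->
  exists k0, forall i, exists k, [/\ (i <= k)%N, (k <= k0 + n * i)%N & (K - 2) ^+ i <= a k].
Proof.
move=> n0 K3 aK unb.
(* C <= a k absorbs the additive constant, which with a_(k-m) <= a_k accounts for the 2 in K - 2; 1
   <= a k starts the induction. *)
pose good k := [/\ (m <= k)%N, forall l, (l <= k)%N -> a l <= a k, 1 <= a k & C <= a k].
have [k0 gk0] : exists k0, good k0.
  have [j jm [_ maxj]] := exists_record a m.
  have [k ak] := unb (Num.max (a j) (Num.max 1 C)).
  move: ak; rewrite !gt_max => /andP[ajk /andP[ak1 akC]].
  have [i ik [aki maxi]] := exists_record a k.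
  exists i; split; [|by move=> l li; apply: maxi; apply: leq_trans ik| |].
  - rewrite leqNgt; apply/negP => im; have := maxj i (ltnW im).
    by rewrite leNgt (lt_le_trans ajk aki).
  - by rewrite (le_trans (ltW ak1)).
  - by rewrite (le_trans (ltW akC)).
exists k0 => i.
suff [k [gk ik ki aki]] : exists k, [/\ good k, (k0 + i <= k)%N,
  (k <= k0 + n * i)%N & (K - 2) ^+ i <= a k].
  by exists k; split => //; apply: leq_trans ik; rewrite leq_addl.
elim: i => [|i [k [gk ik ki aki]]].
  by exists k0; have [_ _ a1 _] := gk0; rewrite addn0 muln0 addn0 expr0; split.
have [mk maxk a1 aC] := gk.
have [j jkn [_ maxj]] := exists_record a (k + n).
have step : (K - 2) * a k <= a j.
  apply: le_trans (maxj _ (leqnn _)).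
  have := aK k mk; have := maxk _ (leq_subr m k); lra.
have ak_j : a k < a j.
  by apply: lt_le_trans step; rewrite ltr_pMl ?(lt_le_trans ltr01) //; lra.
have kj : (k < j)%N.
  by rewrite ltnNge; apply/negP => /maxk; rewrite leNgt ak_j.
exists j; split.
- split; [exact: leq_trans (ltnW kj)|by move=> l lj; apply: maxj; apply: leq_trans jkn| |].
    by rewrite (le_trans a1) // ltW.
  by rewrite (le_trans aC) // ltW.
- by rewrite addnS (leq_ltn_trans ik).
- by apply: (leq_trans jkn); rewrite mulnS addnCA [leqRHS]addnC leq_add2r.
- by apply: le_trans step; rewrite exprS ler_wpM2l // subr_ge0; lra.
Qed.

(** For n large, K = delta^n / B exceeds c^n + 2. [record_growth] gives values at least (K - 2)^i at
    indices at most k0 + n i, and (K - 2)^i outgrows c^(k0 + n i). *)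
Lemma growth_lower_bound (a : nat -> R) (delta B : R) :
  1 < delta -> 0 < B ->
  (forall n, (0 < n)%N -> exists m C, forall k, (m <= k)%N ->
     delta ^+ n / B * a k <= a (k + n)%N + a (k - m)%N + C) ->
  (forall M, exists k, M < a k) ->
  forall c : R, 0 < c < delta -> forall n0, exists2 k, (n0 <= k)%N & c ^+ k <= a k.
Proof.
move=> d1 B0 aP unb.
(* For c at least 1 the powers of c increase, so a bound by c^(k0 + n i) covers every smaller
   index. *)
suff H (c : R) : 1 <= c < delta -> forall n0, exists2 k, (n0 <= k)%N & c ^+ k <= a k.
  move=> c /andP[c0 cd] n0.
  have [|k kn ck] := H (Num.max 1 c) _ n0; first by rewrite le_max lexx gt_max d1.
  exists k => //; apply: le_trans ck; apply: lerXn2r; rewrite ?nnegrE ?(ltW c0) //.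
    by rewrite le_max ler01.
  by rewrite le_max lexx orbT.
move=> /andP[c1 cd] n0; have c0 : 0 < c := lt_le_trans ltr01 c1.
(* As c^n is at least 1, the factor 5 yields K > c^n + 4, whence both K > 3 and K - 2 > c^n. *)
have [n1 n1P] : exists n1, forall n, (n1 <= n)%N -> 5 * B < (delta / c) ^+ n.
  by apply: exprn_exceeds; rewrite ltr_pdivlMr // mul1r.
pose n := n1.+1; have := n1P n (leqnSn _); rewrite expr_div_n ltr_pdivlMr ?exprn_gt0 // => nP.
have cn1 : 1 <= c ^+ n by apply: exprn_ege1.
set K := delta ^+ n / B.
have KP : c ^+ n + 4 < K.
  by rewrite /K ltr_pdivlMr //; apply: le_lt_trans nP; move: (c ^+ n) cn1 => x x1; nra.
have [m [C aC]] := aP n isT.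
have K3 : 3 < K by move: (c ^+ n) cn1 KP => x x1; lra.
have [k0 k0P] := record_growth (ltn0Sn n1) K3 aC unb.
have [i0 i0P] : exists i0, forall i, (i0 <= i)%N -> c ^+ k0 < ((K - 2) / c ^+ n) ^+ i.
  apply: exprn_exceeds; rewrite ltr_pdivlMr ?exprn_gt0 // mul1r.
  by move: (c ^+ n) cn1 KP => x x1; lra.
pose i := maxn i0 n0; have [k [ik kk aik]] := k0P i.
exists k; first by apply: leq_trans ik; exact: leq_maxr.
apply: le_trans aik; apply: (@le_trans _ _ (c ^+ (k0 + n * i))).
  by apply: ler_weXn2l.
have := i0P i (leq_maxl _ _); rewrite expr_div_n ltr_pdivlMr ?exprn_gt0 ?exprn_gt0 // => /ltW.
by rewrite exprD exprM.
Qed.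

End RealSequences.

(** * Sizes and heights on an orbit *)

Section Orbits.
Variables (R : realType) (N : nat).
Implicit Types (f g : affmap N) (P : 'rV[algC]_N).
Local Notation normc := (@Normc.normc R).

Lemma size_le_aff_eval f : exists2 C : R, 0 <= C & forall H P,
  size_le H P -> size_le ((aff_maxdeg f)%:R * H + C) (aff_eval f P).
Proof.
set D := aff_maxdeg f.
have [c c0 cP] := @aff_eval_bound R N f D (leqnn _).
have cR : 0 < c%:R :> R by rewrite ltr0n.
exists (ln c%:R); first exact: ln_nat_ge0.
move=> H P [q [M [q0 M1 qM qH MH]]]; have M0 := lt_le_trans ltr01 M1.
have lnpow (x : R) : 0 < x -> ln x <= H -> ln (c%:R * x ^+ D) <= D%:R * H + ln c%:R.
  move=> x0 xH; rewrite lnM ?posrE ?exprn_gt0 // lnXn // addrC lerD2r -[leLHS]mulr_natl.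
  by rewrite ler_wpM2l.
exists (c * q ^ D)%N, (c%:R * M ^+ D); split.
- by rewrite muln_gt0 c0 expn_gt0 q0.
- by apply: mulr_ege1; [rewrite ler1n|exact: exprn_ege1].
- exact: cP.
- by rewrite natrM natrX; apply: lnpow; rewrite ?ltr0n.
- exact: lnpow.
Qed.

Lemma house_le_root (L : fieldExtType rat) (iL : {rmorphism L -> algC}) (B : R) D u :
  (0 < D)%N -> 1 <= B -> house_le B (iL u ^+ D) -> house_le (expR (ln B / D%:R)) (iL u).
Proof.
move=> D0 B1 uB; apply/house_leP => s.
have : normc (s u) ^+ D <= B.
  by move: uB; rewrite -rmorphXn => /house_leP/(_ s); rewrite rmorphXn complex_normX.
have BE : B = expR (ln B / D%:R) ^+ D.
  rewrite -expRM_natl mulrC mulfVK ?pnatr_eq0 -?lt0n //.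
  by rewrite lnK ?posrE ?(lt_le_trans ltr01).
by rewrite {1}BE ler_pXn2r ?nnegrE ?complex_norm_ge0 ?expR_ge0.
Qed.

(** [regular_lower_bound] controls the D-th powers of the coordinates. Taking roots divides ln M by
    D, while [root_denominator] yields r with r^D at most Q^d, whence the factor d / D. *)
Lemma size_le_regular (L : fieldExtType rat) (iL : {rmorphism L -> algC}) f g :
  indeterminacy (extension f) `&` indeterminacy (extension g) = set0 ->
  (0 < aff_maxdeg f <= aff_maxdeg g)%N ->
  exists C : R, forall P Hy Hz, in_field iL P ->
    size_le Hy (aff_eval f P) -> size_le Hz (aff_eval g P) ->
    size_le ((\dim {:L})%:R / (aff_maxdeg f)%:R * (Hy + Hz + C)) P.
Proof.
move=> fg0 /andP[D0 fg]; set D := aff_maxdeg f; set d := \dim {:L}.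
have [c c0 cP] := regular_lower_bound R fg0 fg.
have cR : 0 < c%:R :> R by rewrite ltr0n.
have DR : 0 < D%:R :> R by rewrite ltr0n.
have d1 : 1 <= d%:R :> R by rewrite ler1n dim_gt0.
exists (ln c%:R + ln 2) => P Hy Hz PL [qy [My [qy0 My1 yb qyH MyH]]] [qz [Mz [qz0 Mz1 zb qzH MzH]]].
have bnd := cP P qy qz My Mz My1 Mz1 yb zb.
have Q0 : (0 < c * qy * qz)%N by rewrite !muln_gt0 c0 qy0.
have [r [r0 rQ rint]] := root_denominator L Q0 D0.
set B := c%:R * (My + Mz).
have My0 := lt_le_trans ltr01 My1; have Mz0 := lt_le_trans ltr01 Mz1.
have B1 : 1 <= B.
  by apply: mulr_ege1; [rewrite ler1n|apply: (le_trans My1); rewrite lerDl ltW].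
have ln2 : 0 <= ln 2 :> R by rewrite ln_ge0 // ler1n.
exists r, (expR (ln B / D%:R)); split => //.
- by rewrite -expR0 ler_expR divr_ge0 ?ln_ge0.
- move=> i; have [b1 b2] := bnd i; have [u uE] := PL i.
  split; last by rewrite -uE; apply: house_le_root => //; rewrite uE.
  rewrite -uE -(rmorph_nat iL) -rmorphM; apply/int_integral_iota; apply: rint.
  by apply/(int_integral_iota iL); rewrite rmorphM rmorph_nat rmorphXn uE.
- rewrite mulrAC ler_pdivlMr //.
  apply: (@le_trans _ _ (ln (c * qy * qz)%:R *+ d)).
    rewrite mulr_natr -!lnXn ?ltr0n // ler_ln ?posrE ?exprn_gt0 ?ltr0n //.
    by rewrite -!natrX ler_nat.
  rewrite -[leLHS]mulr_natl ler_wpM2l // !natrM !lnM ?posrE ?mulr_gt0 ?ltr0n //.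
  by move: (ln c%:R) (ln qy%:R) (ln qz%:R) (ln 2) qyH qzH ln2; clear => *; lra.
- rewrite expRK mulrAC ler_wpM2r ?invr_ge0 ?(ltW DR) //.
  have sum_le : ln B <= Hy + Hz + (ln c%:R + ln 2).
    apply: (@le_trans _ _ (ln (c%:R * (2 * (My * Mz))))).
      rewrite ler_ln ?posrE ?mulr_gt0 ?addr_gt0 // ler_wpM2l // ?(ltW cR) //.
      by move: My1 Mz1; clear; nra.
    rewrite !lnM ?posrE ?mulr_gt0 //.
    by move: (ln c%:R) (ln 2) (ln My) (ln Mz) MyH MzH; clear => *; lra.
  apply: (le_trans sum_le); rewrite ler_peMl //; apply: le_trans sum_le.
  exact: ln_ge0.
Qed.

Lemma iter_in_field (L : fieldExtType rat) (iL : {rmorphism L -> algC}) f P k :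
  (forall i m, m \in msupp (tnth f i) -> exists u, iL u = mcoeff m (tnth f i)) ->
  in_field iL P -> in_field iL (iter k (aff_eval f) P).
Proof.
move=> fL PL; elim: k => [//|k IH] i; rewrite iterS mxE.
pose S : set algC := [set y | exists u, iL u = y].
have Sr : subring_set S.
  split; first by exists 1; rewrite rmorph1.
    by move=> _ _ [a <-] [b <-]; exists (a - b); rewrite rmorphB.
  by move=> _ _ [a <-] [b <-]; exists (a * b); rewrite rmorphM.
rewrite -[meval _ _]mul1r; apply: (subring_mevalZ Sr) => [j|m mf]; first exact: IH.
by rewrite mul1r; apply: fL.
Qed.

Lemma orbit_height_upper f P (L : fieldExtType rat) (iL : {rmorphism L -> algC}) :
  (1 < aff_maxdeg f)%N -> (forall k, in_field iL (iter k (aff_eval f) P)) ->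
  exists U : R, forall k, aff_height R (iter k (aff_eval f) P) <= U * (aff_maxdeg f)%:R ^+ k.
Proof.
move=> d1 inL; set D := aff_maxdeg f.
have [C C0 CP] := size_le_aff_eval f; rewrite -/D in CP.
pose H0 := (\dim {:L})%:R * aff_height R P.
have D2 : 2 <= D%:R :> R by rewrite ler_nat.
(* Since D is at least 2, subtracting C makes this form of bound stable under x -> D x + C. *)
have sz k : size_le (D%:R ^+ k * (H0 + C) - C) (iter k (aff_eval f) P).
  elim: k => [|k IH]; first by rewrite expr0 mul1r addrK; exact: aff_height_size (inL 0%N).
  apply: size_le_trans (CP _ _ IH); rewrite exprS mulrBr mulrA.
  by move: (_ * (H0 + C)) => x; nra.
exists ((2 * (\dim {:L}) ^ 3)%:R * (H0 + C)) => k.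
apply: le_trans (aff_height_le (inL k) (sz k)) _.
by rewrite -mulrA ler_wpM2l // mulrC gerBl.
Qed.

Lemma orbit_height_unbounded f g P (L : fieldExtType rat) (iL : {rmorphism L -> algC}) :
  aff_comp g f = aff_id N -> (forall k, in_field iL (iter k (aff_eval f) P)) ->
  ~ periodic f P -> forall B, exists k, B < aff_height R (iter k (aff_eval f) P).
Proof.
move=> gf inL nper B; apply: contrapT => H; apply: nper.
have bd k : aff_height R (iter k (aff_eval f) P) <= B.
  by rewrite leNgt; apply/negP => Bk; apply: H; exists k.
have sz k : size_le ((\dim {:L})%:R * B) (iter k (aff_eval f) P).
  by apply: size_le_trans (aff_height_size R (inL k)); rewrite ler_wpM2l.
have [i [j [ij E]]] := northcott_sequence inL sz.
exists (j - i)%N; first by rewrite subn_gt0.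
have inj : injective (iter i (aff_eval f)).
  have injf := can_inj (aff_eval_cancel gf).
  by elim: i {E ij} => // i IH x y /= /injf/IH.
by apply: inj; rewrite -iterD subnKC // ltnW.
Qed.

(** The constant collects the factor d of [size_le_regular], a factor d from heights to sizes and 2
    d^3 back to heights; none depends on n. Iterates of the inverse lead back along the orbit,
    whence the index k - m. *)
Lemma orbit_height_recursion f g P (L : fieldExtType rat) (iL : {rmorphism L -> algC}) n :
  are_inverse f g -> ~ is_morphism (extension f) -> ~ is_morphism (extension g) ->
  indeterminacy (extension f) `&` indeterminacy (extension g) = set0 ->
  (forall k, in_field iL (iter k (aff_eval f) P)) -> (0 < n)%N ->
  let a k := aff_height R (iter k (aff_eval f) P) in
  exists m C, forall k, (m <= k)%N ->
    (aff_maxdeg f)%:R ^+ n / (2 * (\dim {:L}) ^ 3 * (\dim {:L}) ^ 2)%:R * a k <=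
    a (k + n)%N + a (k - m)%N + C.
Proof.
move=> inv nf ng disj inL n0 a; have [fg gf] := inv.
have d1 := nonmorphism_degree gf nf; have d'1 := nonmorphism_degree fg ng.
have disj' : indeterminacy (extension g) `&` indeterminacy (extension f) = set0 by rewrite setIC.
(* m = D^n meets the degree condition, since m < d'^m for d' at least 2. *)
set D := aff_maxdeg f; set d := \dim {:L}; pose m := (D ^ n)%N.
have Fdeg := degree_iter fg gf nf ng disj n.
have Gdeg := degree_iter gf fg ng nf disj' m.
have FG : (0 < aff_maxdeg (aff_iter f n) <= aff_maxdeg (aff_iter g m))%N.
  rewrite Fdeg Gdeg expn_gt0 (ltnW d1) /=.
  by apply: leq_trans (ltnW (ltn_expl m d'1)).
have [C CP] := size_le_regular iL (iter_disjoint n m inv nf ng disj) FG.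
have d0 : 0 < d%:R :> R by rewrite ltr0n dim_gt0.
exists m, (C / d%:R) => k mk.
have back : iter m (aff_eval g) (iter k (aff_eval f) P) = iter (k - m) (aff_eval f) P.
  rewrite -{1}(subnKC mk) iterD; move: (iter (k - m) _ P) => Q.
  elim: (m) => // l IH; rewrite iterSr iterS (aff_eval_cancel gf); exact: IH.
have := CP _ (d%:R * a (k + n)%N) (d%:R * a (k - m)%N) (inL k).
rewrite !aff_eval_iter -iterD addnC back =>
  /(_ (aff_height_size R (inL _)) (aff_height_size R (inL _))).
move=> /(aff_height_le (inL k)); rewrite Fdeg -/d -/(a k) natrX -/D => ak.
have Dn0 : 0 < D%:R ^+ n :> R by rewrite exprn_gt0 // ltr0n ltnW.
have A0 : 0 < (2 * d ^ 3 * d ^ 2)%:R :> R by rewrite ltr0n !muln_gt0 ?expn_gt0 ?dim_gt0.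
rewrite mulrAC ler_pdivrMr // mulrC.
have : a k * D%:R ^+ n <= (2 * d ^ 3)%:R * (d%:R * (d%:R * a (n + k)%N + d%:R * a (k - m)%N + C)).
  rewrite -ler_pdivlMr //; apply: (le_trans ak); rewrite le_eqVlt; apply/orP; left.
  by apply/eqP; rewrite [_%:R / _ * _]mulrAC [LHS]mulrA.
move=> H; apply: (le_trans H).
have -> : (2 * d ^ 3 * d ^ 2)%:R = (2 * d ^ 3)%:R * (d%:R * d%:R) :> R by rewrite natrM -[(d ^
  2)%N]/(d * d)%N [(d * d)%:R]natrM.
have dd : d%:R * (C / d%:R) = C by rewrite mulrCA mulfV ?mulr1 // gt_eqF.
rewrite le_eqVlt; apply/orP; left; apply/eqP.
by rewrite -{1}dd; move: (2 * d ^ 3)%:R (d%:R : R) (a (n + k)%N) (a (k - m)%N) (C / _) =>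
  x y z t w; ring.
Qed.

Lemma dynamical_degree_regular f (d : nat) : (0 < d)%N ->
  (forall n, aff_maxdeg (aff_iter f n) = (d ^ n)%N) -> dynamical_degree R f = d%:R.
Proof.
move=> d0 fd; apply: cvg_lim => //; apply: cvg_near_cst.
exists 1%N => // n /= n1; rewrite /degree /= fd natrX.
rewrite -powR_mulrn ?ler0n // -powRrM mulfV ?powRr1 ?ler0n // pnatr_eq0 -lt0n //.
Qed.

(** A nonzero height recurs in every period, whereas c^k tends to 0. This is the lower bound for
    periodic points to which the convention for vanishing heights does not apply. *)
Lemma periodic_orbit_height f P p c : (0 < p)%N -> iter p (aff_eval f) P = P ->
  let h k := aff_height R (iter k (aff_eval f) P) in
  ~ (\forall n \near \oo, h n = 0) -> 0 < c < 1 ->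
  forall n0, exists2 k, (n0 <= k)%N & c ^+ k <= h k.
Proof.
move=> p0 pP h nz /andP[c0 c1] n0.
have per k j : h (k + j * p)%N = h k.
  elim: j => [|j IH]; first by rewrite mul0n addn0.
  rewrite -IH /h mulSn addnCA addnC iterD.
  by rewrite pP.
have [k hk] : exists k, h k != 0.
  apply: contrapT => H; apply: nz; exists 0%N => // k _.
  by apply/eqP; apply: contrapT => /negP hk; apply: H; exists k.
have hk0 : 0 < h k by rewrite lt_neqAle eq_sym hk aff_height_ge0.
have [n1 n1P] : exists n1, forall n, (n1 <= n)%N -> (h k)^-1 < (c^-1) ^+ n.
  by apply: exprn_exceeds; rewrite invf_gt1.
pose j := (n0 + n1)%N; exists (k + j * p)%N.
  by rewrite (leq_trans (leq_addr n1 n0)) // (leq_trans _ (leq_addl _ _)) // leq_pmulr.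
rewrite per; have := n1P (k + j * p)%N.
have -> : (n1 <= k + j * p)%N.
  by rewrite (leq_trans (leq_addl n0 n1)) // (leq_trans _ (leq_addl _ _)) // leq_pmulr.
move=> /(_ isT); rewrite exprVn ltf_pV2 ?posrE ?exprn_gt0 //.
exact: ltW.
Qed.

Lemma periodic_orbit_bounded f P p : (0 < p)%N -> iter p (aff_eval f) P = P ->
  exists U : R, forall k, aff_height R (iter k (aff_eval f) P) <= U.
Proof.
move=> p0 pP; exists (\sum_(i < p) aff_height R (iter i (aff_eval f) P)) => k.
have -> : iter k (aff_eval f) P = iter (k %% p)%N (aff_eval f) P.
  rewrite {1}(divn_eq k p) addnC iterD; congr (iter _ _ _).
  by elim: (k %/ p)%N => // j IH; rewrite mulSn iterD IH.
have kp : (k %% p < p)%N by rewrite ltn_mod.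
rewrite (bigD1 (Ordinal kp)) //= lerDl sumr_ge0 // => i _; exact: aff_height_ge0.
Qed.

End Orbits.

Theorem corollary37 (R : realType) (N : nat) (f : affmap N)
    (P : 'rV[algC]_N) :
  regular_affine_automorphism f ->
  (~ periodic f P -> arithmetic_degree R f P = (dynamical_degree R f)%:E) /\
  (periodic f P -> arithmetic_degree R f P = 1%E).
Proof.
move=> [g [inv nf ng disj]]; have [fg gf] := inv.
have d1 := nonmorphism_degree gf nf; set d := aff_maxdeg f in d1.
pose h k := aff_height R (iter k (aff_eval f) P).
split=> [nper|[p p0 pP]]; last first.
  rewrite /arithmetic_degree; case: asboolP => // nz.
  have [U hU] := periodic_orbit_bounded R p0 pP.
  (* Heights on a periodic orbit are bounded, so the growth rate is found with delta = 1. *)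
  apply: (@limn_esup_root R h 1 U) => // [k|k|c c01].
  - exact: aff_height_ge0.
  - by rewrite expr1n mulr1; exact: hU.
  - exact: (periodic_orbit_height p0 pP nz c01).
have [L [iL inL]] := common_field ([seq P 0 i | i : 'I_N] ++
  flatten [seq [seq mcoeff m (tnth f i) | m <- msupp (tnth f i)] | i : 'I_N]).
have PL k : in_field iL (iter k (aff_eval f) P).
  apply: iter_in_field => [i m mf|i]; apply: inL; rewrite mem_cat; apply/orP.
    right; apply/flattenP; exists [seq mcoeff m (tnth f i) | m <- msupp (tnth f i)].
      by apply: map_f; rewrite mem_enum.
    exact: map_f.
  by left; apply: map_f; rewrite mem_enum.
have unb := orbit_height_unbounded (R := R) gf PL nper.
have [U hU] := orbit_height_upper R d1 PL.
rewrite (dynamical_degree_regular R (ltnW d1) (degree_iter fg gf nf ng disj)).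
(* Eventually vanishing heights would be bounded, so the convention giving 1 cannot apply to a
   non-periodic point. *)
rewrite /arithmetic_degree; case: asboolP => [[n0 _ h0]|_].
  have [j _ [_ maxj]] := exists_record h n0.
  have [k hk] := unb (Num.max (h j) 0); exfalso; move: hk; rewrite gt_max => /andP[hjk h0k].
  have [kn|nk] := leqP k n0; first by have := maxj k kn; rewrite leNgt hjk.
  by move: h0k; rewrite (h0 k (ltnW nk)) ltxx.
apply: (@limn_esup_root R h d%:R U) => [|k||].
- by rewrite ltr0n ltnW.
- exact: aff_height_ge0.
- exact: hU.
apply: (growth_lower_bound (B := (2 * (\dim {:L}) ^ 3 * (\dim {:L}) ^ 2)%:R)) => //.
- by rewrite ltr1n.
- by rewrite ltr0n !muln_gt0 ?expn_gt0 ?dim_gt0.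
- by move=> n n0; exact: (orbit_height_recursion R inv nf ng disj PL n0).
Qed.
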